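(* Let $d=1$ and $\omega>0$. Let $\alpha,\beta\in W^{1,\infty}(\mathbb{R})$ be real-valued functions such that, for some constants $\alpha_{\min},\beta_{\min},\alpha_0,\beta_0>0$ and some open bounded interval $\Omega_{in}\subset\mathbb{R}$, one has $\alpha(x)\ge\alpha_{\min}$ and $\beta(x)\ge\beta_{\min}$ for all $x\in\mathbb{R}$, and $\alpha(x)=\alpha_0$, $\beta(x)=\beta_0$ for all $x\in\mathbb{R}\setminus\Omega_{in}$. Let $F\in L^2(\mathbb{R})$ be complex-valued with $\operatorname{supp}F\subset\Omega_{in}$. Let $U$ be the solution of $$-\omega^2U(x)-\beta^{-1}(x)\,\partial_x(\alpha(x)\,\partial_xU(x))=F(x),\quad x\in\mathbb{R},\qquad \lim_{|x|\to\infty}\left[\partial_{|x|}U(x)-i\omega\sqrt{\beta_0/\alpha_0}\,U(x)\right]=0,$$ and let $u$ be the solution of $$\partial_t^2u(x,t)-\beta^{-1}(x)\,\partial_x(\alpha(x)\,\partial_xu(x,t))=e^{-i\omega t}F(x),\quad x\in\mathbb{R},\ t>0,\qquad u(x,0)=0,\ \partial_tu(x,0)=0,\quad x\in\mathbb{R}.$$ Define the constant $$U_\infty:=\frac{1}{2i\omega\sqrt{\alpha_0\beta_0}}\int_{\Omega_{in}}F(x)\beta(x)\,dx.$$ Then there exists a constant $\Lambda>0$ depending on $\alpha,\beta$ and, for every bounded domain $\Omega\subset\mathbb{R}$, a constant $C>0$ depending on $F,\alpha,\beta,\omega$ and $\Omega$, such that $$\|u(\cdot,t)-e^{-i\omega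 t}U-U_\infty\|_{H^1(\Omega)}+\|\partial_tu(\cdot,t)+i\omega e^{-i\omega t}U\|_{L^2(\Omega)}\le Ce^{-\Lambda t},\qquad t\ge0.$$
   Context: In one dimension $\partial_{|x|}=(\operatorname{sgn}x)\,\partial_x$. Solutions are understood in the standard sense: $U\in H^2_{\mathrm{loc}}(\mathbb{R})$ satisfies its equation almost everywhere (it is smooth outside $\overline{\Omega_{in}}$, so the radiation condition is meaningful pointwise); $u\in C([0,\infty),H^1(\mathbb{R}))\cap C^1([0,\infty),L^2(\mathbb{R}))$ is the finite-energy (weak) solution. *)

(* Defs.v *)
From mathcomp Require Import all_boot all_order all_algebra.
From mathcomp Require Import all_classical all_reals all_analysis.
From mathcomp Require Export complex.

Import ComplexField.
Set Implicit Arguments.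
Unset Strict Implicit.
Unset Printing Implicit Defensive.

Import Order.TTheory GRing.Theory Num.Theory.
Import numFieldNormedType.Exports.

Local Open Scope classical_set_scope.
Local Open Scope ring_scope.
Local Open Scope complex_scope.

Section Defs.
Variable R : realType.
Local Notation mu := (@lebesgue_measure R).
Local Notation C := R[i].
Implicit Types (Om : set R) (f g : R -> C).

Definition re f : R -> R := fun x => complex.Re (f x).
Definition im f : R -> R := fun x => complex.Im (f x).

Definition expi (theta : R) : C := cos theta +i* sin theta.

Definition cintegral Om f : C :=
  Rintegral mu Om (re f) +i* Rintegral mu Om (im f).

Definition is_cderive f (x : R) (l : C) : Prop :=
  is_derive x 1 (re f) (complex.Re l) /\ is_derive x 1 (im f) (complex.Im l).

Definition test_fun Om (phi : R -> R) : Prop :=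
  (forall n x, derivable (derive1n n phi) x 1) /\
  exists K, [/\ compact K, K `<=` Om & forall x, ~ K x -> phi x = 0].

Definition is_weak_deriv Om (f g : R -> R) : Prop :=
  [/\ locally_integrable Om f, locally_integrable Om g &
      forall phi, test_fun Om phi ->
        Rintegral mu Om (fun x => f x * derive1 phi x) =
        - Rintegral mu Om (fun x => g x * phi x)].

(* Real test functions suffice, since the pairing is bilinear. *)
Definition is_cweak_deriv Om f g : Prop :=
  is_weak_deriv Om (re f) (re g) /\ is_weak_deriv Om (im f) (im g).

Definition weakly_derivable Om f : Prop := exists g, is_cweak_deriv Om f g.

(* A chosen representative of the weak derivative, which is unique a.e.; it is
   a junk value (0) when [f] is not weakly derivable on [Om]; the functions it is
   applied to below are always weakly derivable under the hypotheses at hand. *)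
Definition wderiv Om f : R -> C :=
  xget (fun=> 0) [set g | is_cweak_deriv Om f g].

Definition W1inf (f : R -> R) : Prop :=
  f \in Lfun mu +oo%E /\
  exists2 g, is_weak_deriv setT f g & g \in Lfun mu +oo%E.

Definition L2 Om f : Prop :=
  ((re f) \_ Om \in Lfun mu 2%:E) /\ ((im f) \_ Om \in Lfun mu 2%:E).

Definition L2loc f : Prop := forall K, compact K -> L2 K f.

Definition H1 Om f : Prop :=
  [/\ L2 Om f, weakly_derivable Om f & L2 Om (wderiv Om f)].

Definition H2loc f : Prop :=
  [/\ L2loc f,
      weakly_derivable setT f, L2loc (wderiv setT f),
      weakly_derivable setT (wderiv setT f) &
      L2loc (wderiv setT (wderiv setT f))].

Definition L2norm Om f : \bar R :=
  'N[mu]_2%:E [(fun x => (Normc.normc (f x))%:E) \_ Om].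

Definition H1norm Om f : \bar R :=
  ((L2norm Om f ^+ 2 + L2norm Om (wderiv Om f) ^+ 2) `^ 2^-1)%E.

(* The support of a class of functions modulo a.e. equality. *)
Definition ess_support f : set R :=
  [set x | forall V, nbhs x V -> ~ (\forall y \ae mu, V y -> f y = 0)].

Definition bounded_domain Om : Prop :=
  [/\ Om !=set0, open Om, connected Om & bounded_set Om].

(* The limits at -oo and +oo of d_{|x|} V - i k V, where V is the representative
   of [U] that is differentiable outside the closure of [Om]. *)
Definition radiation Om (k : R) (U : R -> C) : Prop :=
  exists V dV : R -> C,
    [/\ \forall x \ae mu, U x = V x,
        forall x, ~ closure Om x -> is_cderive V x (dV x),
        Normc.normc ((Num.sg x)%:C * dV x - 'i%C * k%:C * V x)
          @[x --> +oo] --> (0 : R) &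
        Normc.normc ((Num.sg x)%:C * dV x - 'i%C * k%:C * V x)
          @[x --> -oo] --> (0 : R)].

Definition helmholtz_sol (alpha beta : R -> R) (alpha0 beta0 : R) Om
    (omega : R) (F U : R -> C) : Prop :=
  let flux := fun x => (alpha x)%:C * wderiv setT U x in
  [/\ H2loc U, weakly_derivable setT flux,
      \forall x \ae mu,
        - (omega ^+ 2)%:C * U x - ((beta x)^-1)%:C * wderiv setT flux x = F x &
      radiation Om (omega * Num.sqrt (beta0 / alpha0)) U].

(* Continuity of t |-> w t from [0, +oo[ to L2(R), resp. H1(R). *)
Definition continuous_L2 (w : R -> R -> C) : Prop :=
  (forall t, 0 <= t -> L2 setT (w t)) /\
  forall t, 0 <= t ->
    L2norm setT (w s \- w t) @[s --> within `[0, +oo[ (nbhs t)] --> 0%E.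

Definition continuous_H1 (w : R -> R -> C) : Prop :=
  (forall t, 0 <= t -> H1 setT (w t)) /\
  forall t, 0 <= t ->
    H1norm setT (w s \- w t) @[s --> within `[0, +oo[ (nbhs t)] --> 0%E.

(* [w'] is the derivative of t |-> w t, as a curve [0, +oo[ -> L2(R). *)
Definition deriv_L2 (w w' : R -> R -> C) : Prop :=
  forall t, 0 <= t ->
    L2norm setT (fun x => ((s - t)^-1)%:C * (w s x - w t x) - w' t x)
      @[s --> within `[0, +oo[ t^'] --> 0%E.

(* [u] is the finite-energy solution with time derivative [ut]; time comes
   first, [u t x].  The equation, multiplied by beta, is tested in x against
   H1(R) and its time derivative is the ordinary one, which exists because
   the other terms are continuous in time. *)
Definition wave_sol (alpha beta : R -> R) (omega : R) (F : R -> C)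
    (u ut : R -> R -> C) : Prop :=
  [/\ continuous_H1 u, continuous_L2 ut, deriv_L2 u ut,
      (\forall x \ae mu, u 0 x = 0) /\ (\forall x \ae mu, ut 0 x = 0) &
      forall v, H1 setT v -> forall t, 0 < t ->
        is_cderive
          (fun s =>
             cintegral setT (fun x => (beta x)%:C * ut s x * conjc (v x))) t
          (expi (- (omega * t)) *
             cintegral setT (fun x => (beta x)%:C * F x * conjc (v x))
           - cintegral setT (fun x => (alpha x)%:C * wderiv setT (u t) x *
                                      conjc (wderiv setT v x)))].

Definition U_infty (alpha0 beta0 : R) (beta : R -> R) Om (omega : R)
    (F : R -> C) : C :=
  (2 * 'i%C * (omega * Num.sqrt (alpha0 * beta0))%:C)^-1 *
  cintegral Om (fun x => F x * (beta x)%:C).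

End Defs.

(* Main.v *)
(** The argument is the one-dimensional energy method.  Subtract from [u] the time-harmonic
    wave and the constant [U_infty]: the difference [Y] has a conjugate potential [Z], with
    [Z_x = beta Y_t] and [Z_t = alpha Y_x].  Outside the source region [u] and [U] only carry
    outgoing information, and [U_infty] is exactly the constant for which [Z = -+ g Y] with
    [g = sqrt (alpha0 beta0)] at the ends of any interval containing the source.  On such an
    interval the functional
    [int n (beta Y^2 + Z^2 / alpha) + 2 mu beta Y Z]
    is equivalent to the squared [L^2] norm and, for suitable weights [n] and [mu], decays
    exponentially: on the core [n = 1] and [mu] is a small growing exponential, which absorbs
    the derivative of [alpha beta]; on the outer pieces [n -+ g mu] are exponentials.  The rate
    only depends on the core, hence not on the observation window.  Applied to difference
    quotients in time, the same estimate bounds [Y_t] and [Z_t = alpha Y_x]. *)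

Require Import Defs.
From mathcomp Require Import all_boot all_order all_algebra.
From mathcomp Require Import all_classical all_reals all_analysis.
From mathcomp Require Import measurable_realfun ftc ring lra.

Import Order.TTheory GRing.Theory Num.Theory.
Import numFieldNormedType.Exports.

Set Implicit Arguments.
Unset Strict Implicit.
Unset Printing Implicit Defensive.

Local Open Scope classical_set_scope.
Local Open Scope ring_scope.

(** * Integrals and square-integrable functions on an interval *)

Section IntervalIntegral.
Variable R : realType.
Local Notation mu := (@lebesgue_measure R).
Implicit Types (a b c d k : R) (f g h : R -> R).

(** The argument is run on real components. For the real part of [u] the source is
    [cos (om t) F1 + sin (om t) F2] with [(F1, F2)] the real and imaginary parts of [F]; the
    imaginary part is the same problem with [F] multiplied by [- i]. A finite-energy solution has
    only an [L^2] gradient, and its equation holds only against test functions, so [Z] is not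
    obtained by solving [Z_t = alpha Y_x] pointwise. It is a space primitive of [beta] times the
    velocity minus a time primitive of the source, and the weak equation determines the function of
    [t] left free. For a wave starting from rest this time primitive contains the constant-in-time
    term [F2 / om]. Its space integral is a jump of the potential between the two ends of the
    window; shifting [Y] and [Z] by constants gives two unknowns for the two outgoing conditions,
    and the shift of [Y] comes out as a component of [U_infty]. The constant [C] has to be fixed
    before [U] and [u] are given. It is computed from one Helmholtz solution, and carries over to
    any other because both are limits of the same wave. *)

Definition itg a b f : R := \int[mu]_(x in `[a, b]) f x.
Definition intb a b f : Prop := mu.-integrable `[a, b] (EFin \o f).
Definition meas a b f : Prop := measurable_fun `[a, b]%classic f.
Definition aeon a b (P : R -> Prop) : Prop :=
  {ae mu, forall x : R, a <= x <= b -> P x}.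

Lemma ae_sub (P Q : set R) : almost_everywhere mu P -> P `<=` Q ->
  almost_everywhere mu Q.
Proof. by move=> HP PQ; apply: (@filterS _ _ (ae_filter_ringOfSetsType mu) P Q). Qed.

Lemma ae_sub2 (P Q S : set R) : almost_everywhere mu P -> almost_everywhere mu Q ->
  (forall x, P x -> Q x -> S x) -> almost_everywhere mu S.
Proof.
by move=> HP HQ PQS; apply: (@filterS2 _ _ (ae_filter_ringOfSetsType mu) P Q S).
Qed.

Lemma aeonE a b (P : R -> Prop) :
  aeon a b P <-> {ae mu, forall x : R, (`[a, b]%classic : set R) x -> P x}.
Proof.
by split => H; apply: (ae_sub H) => x {}H xi; apply: H; move: xi; rewrite /= in_itv/=.
Qed.

Lemma mitv a b : measurable `[a, b]%classic.
Proof. exact: measurable_itv. Qed.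
Hint Resolve mitv : core.

Lemma aeonW a b (P : R -> Prop) : (forall x, a <= x <= b -> P x) -> aeon a b P.
Proof. by move=> H; exact: (aeW mu H). Qed.

Lemma aeonS a b c d (P : R -> Prop) : a <= c -> d <= b ->
  aeon a b P -> aeon c d P.
Proof.
move=> ac db H; apply: (ae_sub H) => x {}H /andP[cx xd]; apply: H.
by rewrite (le_trans ac cx) (le_trans xd db).
Qed.

Lemma aeon2 a b (P Q S : R -> Prop) :
  (forall x, a <= x <= b -> P x -> Q x -> S x) ->
  aeon a b P -> aeon a b Q -> aeon a b S.
Proof. by move=> H HP HQ; apply: (ae_sub2 HP HQ) => x Px Qx xi; apply: H => //; [exact: Px|exact: Qx]. Qed.

Lemma aeon1 a b (P S : R -> Prop) :
  (forall x, a <= x <= b -> P x -> S x) -> aeon a b P -> aeon a b S.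
Proof.
move=> H HP; apply: (@aeon2 a b P P S) => // x xi ? ?; exact: H.
Qed.

Lemma mu_itv_lty a b : (mu `[a, b] < +oo)%E.
Proof. by rewrite lebesgue_measure_itv/=; case: ifP => _; rewrite ?ltry// -EFinB ltry. Qed.
Hint Resolve mu_itv_lty : core.

Lemma intb_meas a b f : intb a b f -> meas a b f.
Proof. by move=> /(measurable_int mu) /measurable_EFinP. Qed.

Lemma measS a b c d f : a <= c -> d <= b -> meas a b f -> meas c d f.
Proof.
move=> ac db; apply: measurable_funS => // x /=; rewrite !in_itv/= => /andP[cx xd].
by rewrite (le_trans ac cx) (le_trans xd db).
Qed.

Lemma meas_T a b f : measurable_fun setT f -> meas a b f.
Proof. exact: measurable_funS. Qed.

Lemma measD a b f g : meas a b f -> meas a b g -> meas a b (fun x => f x + g x).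
Proof. exact: measurable_funD. Qed.
Lemma measM a b f g : meas a b f -> meas a b g -> meas a b (fun x => f x * g x).
Proof. exact: measurable_funM. Qed.
Lemma meas_cst a b k : meas a b (fun _ => k).
Proof. exact: measurable_cst. Qed.
Lemma measZ a b k f : meas a b f -> meas a b (fun x => k * f x).
Proof. by apply: measM; exact: meas_cst. Qed.
Lemma measN a b f : meas a b f -> meas a b (fun x => - f x).
Proof. by move=> /(measZ (-1)); congr meas; apply: funext => x; rewrite mulN1r. Qed.
Lemma measB a b f g : meas a b f -> meas a b g -> meas a b (fun x => f x - g x).
Proof. by move=> mf mg; apply: measD => //; exact: measN. Qed.
Lemma measX a b f n : meas a b f -> meas a b (fun x => f x ^+ n).
Proof. exact: measurable_funX. Qed.

Lemma intbS a b c d f : a <= c -> d <= b -> intb a b f -> intb c d f.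
Proof.
move=> ac db; apply: integrableS => // x /=; rewrite !in_itv/= => /andP[cx xd].
by rewrite (le_trans ac cx) (le_trans xd db).
Qed.

Lemma intbD a b f g : intb a b f -> intb a b g -> intb a b (fun x => f x + g x).
Proof. by move=> fi gi; exact: (@integrableD _ _ _ mu _ (measurable_itv _) _ _ fi gi). Qed.
Lemma intbZ a b k f : intb a b f -> intb a b (fun x => k * f x).
Proof. by move=> fi; exact: (@integrableZl _ _ _ mu _ (measurable_itv _) k _ fi). Qed.
Lemma intbN a b f : intb a b f -> intb a b (fun x => - f x).
Proof. by move=> /(intbZ (-1)); congr intb; apply: funext => x; rewrite mulN1r. Qed.
Lemma intbB a b f g : intb a b f -> intb a b g -> intb a b (fun x => f x - g x).
Proof. by move=> fi gi; apply: intbD => //; exact: intbN. Qed.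

Lemma intb_le0 a b k f : meas a b f -> (forall x, `|f x| <= k) -> intb a b f.
Proof.
move=> mf fk; apply/integrableP; split; first exact/measurable_EFinP.
apply: le_lt_trans; first apply: (integral_le_bound k%:E) => //.
- exact/measurable_EFinP.
- by rewrite lee_fin (le_trans _ (fk a)).
- by apply: aeW => x _; rewrite lee_fin.
- by apply: lte_mul_pinfty => //; [rewrite lee_fin (le_trans _ (fk a))|exact: mu_itv_lty].
Qed.

Lemma intb_cst a b k : intb a b (fun _ => k).
Proof.
apply: (@intb_le0 _ _ (`|k|)) => //; exact: measurable_cst.
Qed.

Lemma intb_le a b f g : meas a b f -> intb a b g ->
  aeon a b (fun x => `|f x| <= g x) -> intb a b f.
Proof.
move=> mf gi fg; apply/integrableP; split; first exact/measurable_EFinP.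
have /integrableP[mg] := gi; apply: le_lt_trans.
apply: ae_ge0_le_integral => //.
- by apply: measurableT_comp => //; exact/measurable_EFinP.
- by apply: measurableT_comp => //; exact/measurable_EFinP.
- move/aeonE: fg => fg; apply: (ae_sub fg) => x H xi; rewrite /= lee_fin (le_trans (H xi))//.
  exact: ler_norm.
Qed.

Lemma intb_ae a b f g : meas a b g -> intb a b f ->
  aeon a b (fun x => f x = g x) -> intb a b g.
Proof.
move=> mg fi fg; apply: (@intb_le _ _ _ (fun x => `|f x|)) => //.
  exact: integrable_norm.
by apply: aeon1 fg => x _ ->.
Qed.

Lemma intb_abs a b f : intb a b f -> intb a b (fun x => `|f x|).
Proof. exact: integrable_norm. Qed.

Lemma intb_bdd a b f k : meas a b f -> aeon a b (fun x => `|f x| <= k) -> intb a b f.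
Proof. by move=> mf; apply: intb_le => //; exact: intb_cst. Qed.

Lemma intb_bM a b f g k : meas a b g -> aeon a b (fun x => `|g x| <= k) ->
  intb a b f -> intb a b (fun x => g x * f x).
Proof.
move=> mg gk fi; apply: (@intb_le _ _ _ (fun x => k * `|f x|)).
- by apply: measM => //; exact: intb_meas.
- by apply: intbZ; exact: intb_abs.
- by apply: aeon1 gk => x _ gk; rewrite normrM ler_wpM2r.
Qed.

Lemma itg_ext a b f g : (forall x, a <= x <= b -> f x = g x) -> itg a b f = itg a b g.
Proof.
move=> fg; apply: eq_Rintegral => x; rewrite inE/= in_itv/=; exact: fg.
Qed.

Lemma itg_ae a b f g : meas a b f -> meas a b g -> aeon a b (fun x => f x = g x) ->
  itg a b f = itg a b g.
Proof.
move=> mf mg fg; rewrite /itg /Rintegral; congr fine.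
apply: ae_eq_integral => //; [exact/measurable_EFinP|exact/measurable_EFinP|].
by move/aeonE: fg => fg; apply: (ae_sub fg) => x H xi; rewrite /= (H xi).
Qed.

Lemma itgD a b f g : intb a b f -> intb a b g ->
  itg a b (fun x => f x + g x) = itg a b f + itg a b g.
Proof. by move=> fi gi; rewrite /itg RintegralD. Qed.
Lemma itgB a b f g : intb a b f -> intb a b g ->
  itg a b (fun x => f x - g x) = itg a b f - itg a b g.
Proof. by move=> fi gi; rewrite /itg RintegralB. Qed.
Lemma itgZ a b k f : intb a b f -> itg a b (fun x => k * f x) = k * itg a b f.
Proof. by move=> fi; rewrite /itg RintegralZl. Qed.
Lemma itgN a b f : intb a b f -> itg a b (fun x => - f x) = - itg a b f.
Proof.
move=> fi; rewrite -mulN1r -itgZ//; apply: itg_ext => x _; by rewrite mulN1r.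
Qed.

Lemma itg_cst a b k : a <= b -> itg a b (fun _ => k) = k * (b - a).
Proof.
move=> ab; rewrite /itg Rintegral_cst//; congr (_ * _).
have : mu `[a, b] = (b - a)%:E.
  rewrite lebesgue_measure_itv/= lte_fin.
  case: ltP => [//|ba].
  have -> : a = b by apply/eqP; rewrite eq_le ab ba.
  by rewrite subrr.
by move=> /(congr1 fine).
Qed.

Lemma itg_ge0 a b f : intb a b f -> aeon a b (fun x => 0 <= f x) -> 0 <= itg a b f.
Proof.
move=> fi f0; have mf := intb_meas fi.
rewrite (@itg_ae _ _ f (fun x => `|f x|))//.
- by apply: Rintegral_ge0.
- exact: intb_meas (intb_abs fi).
- by apply: aeon1 f0 => x _ H; rewrite ger0_norm.
Qed.

Lemma itg_le a b f g : intb a b f -> intb a b g ->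
  aeon a b (fun x => f x <= g x) -> itg a b f <= itg a b g.
Proof.
move=> fi gi fg; rewrite -subr_ge0 -itgB//; apply: itg_ge0; first exact: intbB.
by apply: aeon1 fg => x _; rewrite subr_ge0.
Qed.

Lemma itg_abs a b f : intb a b f -> `|itg a b f| <= itg a b (fun x => `|f x|).
Proof. by move=> fi; exact: le_normr_Rintegral. Qed.

Lemma itg_split a c b f : a <= c -> c <= b -> intb a b f ->
  itg a b f = itg a c f + itg c b f.
Proof.
move=> ac cb fi; apply/eqP; rewrite addrC -subr_eq /itg Rintegral_itvB//.
rewrite Rintegral_itv_obnd_cbnd//.
apply: integrableS fi => // x /=; rewrite !in_itv/= => /andP[cx ->].
by rewrite (le_trans ac (ltW cx)).
Qed.

Lemma itg_pt a f : itg a a f = 0.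
Proof. by rewrite /itg set_itv1 Rintegral_set1. Qed.

Lemma itg_eq0 a b f : intb a b f -> aeon a b (fun x => 0 <= f x) -> itg a b f = 0 ->
  aeon a b (fun x => f x = 0).
Proof.
move=> fi f0 If.
have mf : measurable_fun `[a, b]%classic (EFin \o f) by exact: measurable_int fi.
have : (\int[mu]_(x in `[a, b]) `|(EFin \o f) x| = 0)%E.
  have fin : (\int[mu]_(x in `[a, b]) `|(EFin \o f) x|)%E \is a fin_num.
    by apply: integrable_fin_num => //; exact: integrable_abse.
  rewrite -(fineK fin); congr EFin; rewrite -[RHS]If.
  apply: esym; rewrite /itg /Rintegral; congr fine; apply: ae_eq_integral => //.
    by apply: measurableT_comp => //.
  by move/aeonE: f0 => f0; apply: (ae_sub f0) => x H /[dup] xi /H fx0; rewrite /= ger0_norm.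
move=> /(ae_eq_integral_abs mu (mitv a b) mf).1.
by move=> H; apply/aeonE; apply: (ae_sub H) => x {}H /H [].
Qed.

(** Integrability of [f ^+ 2] says nothing about the measurability of [f], hence the first
    clause. *)
Definition sq a b f : Prop := meas a b f /\ intb a b (fun x => f x ^+ 2).

Lemma sqM a b f g : sq a b f -> sq a b g -> intb a b (fun x => f x * g x).
Proof.
move=> [mf f2] [mg g2]; apply: (@intb_le _ _ _ (fun x => f x ^+ 2 + g x ^+ 2)).
- exact: measM.
- exact: intbD.
- by apply: aeonW => x _; rewrite ler_norml; apply/andP; split; nra.
Qed.

Lemma sq_cst a b k : sq a b (fun _ => k).
Proof. by split; [exact: meas_cst|exact: intb_cst]. Qed.

Lemma sq_intb a b f : sq a b f -> intb a b f.
Proof.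
move=> sf; have := sqM sf (sq_cst a b 1); congr intb.
by apply: funext => x; rewrite mulr1.
Qed.

Lemma sqD a b f g : sq a b f -> sq a b g -> sq a b (fun x => f x + g x).
Proof.
move=> sf sg; split; first by apply: measD; [exact: sf.1|exact: sg.1].
have := intbD (intbD sf.2 sg.2) (intbZ 2 (sqM sf sg)); congr intb.
by apply: funext => x; ring.
Qed.

Lemma sq_bM a b f g k : meas a b g -> aeon a b (fun x => `|g x| <= k) ->
  sq a b f -> sq a b (fun x => g x * f x).
Proof.
move=> mg gk [mf f2]; split; first exact: measM.
have : intb a b (fun x => g x ^+ 2 * f x ^+ 2).
  apply: (@intb_bM _ _ _ _ (k ^+ 2)) => //; first exact: measX.
  apply: aeon1 gk => x _ H; rewrite normrX ler_sqr ?nnegrE//.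
  exact: le_trans H.
by congr intb; apply: funext => x; rewrite exprMn.
Qed.

Lemma sqZ a b f k : sq a b f -> sq a b (fun x => k * f x).
Proof.
by apply: (@sq_bM _ _ _ _ `|k|); [exact: meas_cst|exact: aeonW].
Qed.
Lemma sqN a b f : sq a b f -> sq a b (fun x => - f x).
Proof. by move=> /(sqZ (-1)); congr sq; apply: funext => x; rewrite mulN1r. Qed.
Lemma sqB a b f g : sq a b f -> sq a b g -> sq a b (fun x => f x - g x).
Proof. by move=> sf sg; apply: sqD => //; exact: sqN. Qed.

Lemma sqS a b c d f : a <= c -> d <= b -> sq a b f -> sq c d f.
Proof.
by move=> ac db [mf f2]; split; [exact: measS mf|exact: intbS f2].
Qed.

Lemma sq_ae a b f g : meas a b g -> sq a b f -> aeon a b (fun x => f x = g x) -> sq a b g.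
Proof.
move=> mg [mf f2] fg; split => //; apply: intb_ae f2 _; first exact: measX.
by apply: aeon1 fg => x _ ->.
Qed.

Definition nrm a b f : R := Num.sqrt (itg a b (fun x => f x ^+ 2)).

Lemma nrm_ge0 a b f : 0 <= nrm a b f.
Proof. exact: sqrtr_ge0. Qed.

Lemma itg_sqr_ge0 a b f : 0 <= itg a b (fun x => f x ^+ 2).
Proof. by apply: Rintegral_ge0 => x _; exact: sqr_ge0. Qed.

Lemma nrm_sqr a b f : nrm a b f ^+ 2 = itg a b (fun x => f x ^+ 2).
Proof. by rewrite sqr_sqrtr// itg_sqr_ge0. Qed.

(** The discriminant argument behind Cauchy-Schwarz: for positive [C] the minimum is at [t = B / C],
    and for [C = 0] an affine function bounded below has slope zero. *)
Lemma discr_le (A B C : R) : 0 <= A -> 0 <= C ->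
  (forall t, 0 <= A - 2 * t * B + t ^+ 2 * C) -> B ^+ 2 <= A * C.
Proof.
move=> A0 C0 H; have [C0'|C0'] := eqVneq C 0.
  have [->|B0] := eqVneq B 0; first by rewrite C0' expr2 !mulr0.
  (* At this point the affine expression equals [-1]. *)
  have := H ((A + 1) / (2 * B)).
  rewrite C0' mulr0 addr0.
  have -> : 2 * ((A + 1) / (2 * B)) * B = A + 1 by field.
  by lra.
have := H (B / C).
have -> : A - 2 * (B / C) * B + (B / C) ^+ 2 * C = A - B ^+ 2 / C by field.
by rewrite subr_ge0 ler_pdivrMr// lt_def C0' C0.
Qed.

Lemma itg_CS a b f g : sq a b f -> sq a b g ->
  `|itg a b (fun x => f x * g x)| <= nrm a b f * nrm a b g.
Proof.
move=> sf sg; rewrite -ler_sqr ?nnegrE ?mulr_ge0 ?nrm_ge0// real_normK ?num_real//.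
rewrite exprMn !nrm_sqr; apply: discr_le; try exact: itg_sqr_ge0.
move=> t.
have -> : itg a b (fun x => f x ^+ 2) - 2 * t * itg a b (fun x => f x * g x) +
   t ^+ 2 * itg a b (fun x => g x ^+ 2) = itg a b (fun x => (f x - t * g x) ^+ 2).
  have i1 := intbZ (2 * t) (sqM sf sg); have i2 := intbZ (t ^+ 2) sg.2.
  rewrite -itgZ; last exact: sqM.
  rewrite -itgZ; last exact: sg.2.
  rewrite -itgB//; last exact: sf.2.
  rewrite -itgD//; last by apply: intbB => //; exact: sf.2.
  by apply: itg_ext => x _; ring.
exact: itg_sqr_ge0.
Qed.

Lemma nrm_ae a b f g : meas a b f -> meas a b g -> aeon a b (fun x => f x = g x) ->
  nrm a b f = nrm a b g.
Proof.
move=> mf mg fg; congr Num.sqrt; apply: itg_ae; try exact: measX.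
by apply: aeon1 fg => x _ ->.
Qed.

Lemma nrm_ext a b f g : (forall x, a <= x <= b -> f x = g x) -> nrm a b f = nrm a b g.
Proof. by move=> fg; congr Num.sqrt; apply: itg_ext => x /fg ->. Qed.

Lemma nrmD a b f g : sq a b f -> sq a b g ->
  nrm a b (fun x => f x + g x) <= nrm a b f + nrm a b g.
Proof.
move=> sf sg; rewrite -ler_sqr ?nnegrE ?addr_ge0 ?nrm_ge0//.
rewrite sqrrD !nrm_sqr.
have -> : itg a b (fun x => (f x + g x) ^+ 2) = itg a b (fun x => f x ^+ 2) +
   2 * itg a b (fun x => f x * g x) + itg a b (fun x => g x ^+ 2).
  have i1 := sqM sf sg.
  rewrite -itgZ// -itgD; [|exact: sf.2|exact: intbZ].
  rewrite -itgD; [|apply: intbD; [exact: sf.2|exact: intbZ]|exact: sg.2].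
  by apply: itg_ext => x _; ring.
rewrite lerD2r lerD2l mulr2n mulrDl mul1r.
by have := le_trans (ler_norm _) (itg_CS sf sg) => ?; apply: lerD.
Qed.

Lemma nrmZ a b f k : sq a b f -> nrm a b (fun x => k * f x) = `|k| * nrm a b f.
Proof.
move=> sf; rewrite /nrm -sqrtr_sqr -sqrtrM ?sqr_ge0// -itgZ; last exact: sf.2.
by congr Num.sqrt; apply: itg_ext => x _; rewrite exprMn.
Qed.

Lemma nrm_bM a b f g k : 0 <= k -> meas a b g -> aeon a b (fun x => `|g x| <= k) ->
  sq a b f -> nrm a b (fun x => g x * f x) <= k * nrm a b f.
Proof.
move=> k0 mg gk sf; have sgf := sq_bM mg gk sf.
rewrite -[k]ger0_norm// -nrmZ// ler_sqrt; last by rewrite itg_sqr_ge0.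
apply: itg_le; [exact: sgf.2|exact: (sqZ k sf).2|].
apply: aeon1 gk => x _ H; rewrite !exprMn ler_wpM2r ?sqr_ge0//.
by rewrite -[g x ^+ 2]real_normK ?num_real// ler_sqr ?nnegrE.
Qed.

Lemma nrmS a b c d f : a <= c -> d <= b -> sq a b f -> nrm c d f <= nrm a b f.
Proof.
move=> ac db sf; have [cd|dc] := leP c d; last first.
  by rewrite /nrm [X in Num.sqrt X](_ : _ = 0) ?sqrtr0 ?sqrtr_ge0//
    /itg set_itv_ge -?ltNge// Rintegral_set0.
rewrite ler_sqrt ?itg_sqr_ge0//.
have [i1 i2] : intb a c (fun x => f x ^+ 2) /\ intb c b (fun x => f x ^+ 2).
  by split; apply: intbS sf.2 => //; rewrite ?(le_trans cd)// (le_trans ac).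
rewrite (@itg_split a c b)//; [|by rewrite (le_trans cd)|exact: sf.2].
rewrite (@itg_split c d b)//.
have := itg_sqr_ge0 a c f; have := itg_sqr_ge0 d b f; lra.
Qed.

Lemma nrm_sup a b f k : a <= b -> 0 <= k -> meas a b f ->
  aeon a b (fun x => `|f x| <= k) -> nrm a b f <= k * Num.sqrt (b - a).
Proof.
move=> ab k0 mf fk; rewrite -[X in X * _]ger0_norm// -sqrtr_sqr -sqrtrM ?sqr_ge0//.
rewrite ler_sqrt; last by rewrite mulr_ge0 ?sqr_ge0 ?subr_ge0.
rewrite -itg_cst//; apply: itg_le => //; last 2 first.
- exact: intb_cst.
- apply: aeon1 fk => x _ H.
  by rewrite -[f x ^+ 2]real_normK ?num_real// ler_sqr ?nnegrE.
- apply: (@intb_bdd _ _ _ (k ^+ 2)); first exact: measX.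
  apply: aeon1 fk => x _ H.
  by rewrite normrX ler_sqr ?nnegrE.
Qed.

End IntervalIntegral.
#[global] Hint Resolve mitv : core.
#[global] Hint Resolve mu_itv_lty : core.

(** * Absolutely continuous functions *)

Section Prim.
Variable R : realType.
Local Notation mu := (@lebesgue_measure R).
Implicit Types (a b c d k : R) (f g h : R -> R).

Lemma intb_restrict a b f : intb a b f <-> mu.-integrable setT (EFin \o (f \_ `[a, b])).
Proof.
by rewrite -restrict_EFin; exact: (@integrable_mkcond _ _ _ mu _ _ (measurable_itv _)).
Qed.

Lemma itg_restrict a b f : itg a b f = \int[mu]_x (f \_ `[a, b]) x.
Proof. by rewrite /itg Rintegral_mkcond. Qed.

(** Both sides integrate [f x * g y] over the triangle [a <= y <= x <= b]. Integration by parts for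
    absolutely continuous functions rests on this exchange. *)
Lemma itg_fubini_tri a b f g : intb a b f -> intb a b g ->
  itg a b (fun x => f x * itg a x g) = itg a b (fun y => g y * itg y b f).
Proof.
move=> /intb_restrict fi /intb_restrict gi.
pose f1 := f \_ `[a, b]; pose g1 := g \_ `[a, b].
have mf1 : measurable_fun setT f1.
  by move/measurable_int : fi => /measurable_EFinP.
have mg1 : measurable_fun setT g1.
  by move/measurable_int : gi => /measurable_EFinP.
pose h (z : R * R) : \bar R := (f1 z.1 * (if z.2 <= z.1 then g1 z.2 else 0))%:E.
have mh : measurable_fun setT h.
  apply/measurable_EFinP; apply: measurable_funM.
    exact: measurableT_comp mf1 measurable_fst.
  apply: measurable_fun_ifT => //.
    exact: measurable_fun_ler measurable_snd measurable_fst.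
  exact: measurableT_comp mg1 measurable_snd.
have hi : (mu \x mu)%E.-integrable setT h.
  apply/integrable12ltyP => //.
  have /integrableP[_ fi'] := fi; have /integrableP[_ gi'] := gi.
  set N := (\int[mu]_y `|(EFin \o g1) y|)%E in gi'.
  have N0 : (0 <= N)%E by apply: integral_ge0.
  (* The triangle is enlarged to the square, where the integral is the product of two [L^1]
     norms. *)
  apply: (@le_lt_trans _ _ (\int[mu]_x (N * `|(EFin \o f1) x|))%E); last first.
    rewrite ge0_integralZl//; last exact/measurableT_comp/measurable_EFinP.
    by apply: lte_mul_pinfty => //; rewrite ge0_fin_numE.
  apply: ge0_le_integral => //.
  - by move=> x _; apply: integral_ge0.
  - apply: (@measurable_fun_fubini_tonelli_F _ _ _ _ _ mu (fun z => `|h z|%E)) => //.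
    exact: measurableT_comp.
  - by apply: emeasurable_funM => //; exact/measurableT_comp/measurable_EFinP.
  - move=> x _; rewrite muleC -ge0_integralZl//; last exact/measurableT_comp/measurable_EFinP.
    apply: ge0_le_integral => //.
    + by apply: measurableT_comp => //; exact: (measurableT_comp mh (measurable_pair1 x)).
    + by apply: emeasurable_funM => //; exact/measurableT_comp/measurable_EFinP.
    + move=> y _; rewrite /h/= lee_fin normrM ler_wpM2l//.
      by case: ifP => // _; rewrite normr0.
have := Fubini hi.
have -> : (fun x => \int[mu]_y h (x, y))%E = EFin \o ((fun x => f x * itg a x g) \_ `[a, b]).
  apply: funext => x /=; rewrite /h/=.
  have [xi|xi] := boolP (x \in `[a, b]%classic); last first.
    under eq_integral => y _.
      rewrite /f1 patchE (negbTE xi) mul0r.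
      over.
    by rewrite integral0 patchE (negbTE xi).
  rewrite [in RHS]patchE xi.
  move: (xi); rewrite inE/= in_itv/= => /andP[ax xb].
  have -> : (fun y => (f1 x * (if y <= x then g1 y else 0))%:E) =
     (fun y => ((f1 x)%:E * (EFin \o (g \_ `[a, x])) y)%E).
    apply: funext => y /=; rewrite -EFinM; congr (_ * _)%:E.
    rewrite /g1 !patchE !mem_setE !in_itv/=.
    case: (leP a y) => ay /=; last by case: ifP.
    by case: (leP y x) => yx //=; rewrite (le_trans yx xb).
  have gix : intb a x g by apply: intbS (lexx _) xb _; apply/intb_restrict.
  rewrite integralZl//; last by apply/intb_restrict.
  rewrite /f1 patchE xi EFinM; congr (_ * _)%E.
  rewrite itg_restrict /Rintegral fineK//; apply: integrable_fin_num => //.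
  by apply/intb_restrict.
have -> : (fun y => \int[mu]_x h (x, y))%E = EFin \o ((fun y => g y * itg y b f) \_ `[a, b]).
  apply: funext => y /=; rewrite /h/=.
  have [yi|yi] := boolP (y \in `[a, b]%classic); last first.
    under eq_integral => x _.
      rewrite /g1 patchE (negbTE yi) if_same mulr0.
      over.
    by rewrite integral0 patchE (negbTE yi).
  rewrite [in RHS]patchE yi.
  move: (yi); rewrite inE/= in_itv/= => /andP[ay yb].
  have -> : (fun x => (f1 x * (if y <= x then g1 y else 0))%:E) =
     (fun x => ((g y)%:E * (EFin \o (f \_ `[y, b])) x)%E).
    apply: funext => x /=; rewrite -EFinM /g1 /f1 !patchE yi !mem_setE !in_itv/=.
    case: (leP y x) => yx /=; last by rewrite !mulr0.
    by rewrite (le_trans ay yx)/=; rewrite mulrC.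
  have fiy : intb y b f by apply: intbS ay (lexx _) _; apply/intb_restrict.
  rewrite integralZl//; last by apply/intb_restrict.
  rewrite EFinM; congr (_ * _)%E.
  rewrite itg_restrict /Rintegral fineK//; apply: integrable_fin_num => //.
  by apply/intb_restrict.
by rewrite !itg_restrict /Rintegral => ->.
Qed.

(** Absolute continuity in integral form. The density [f'] is an explicit argument, so it may be
    changed on a null set, while [f] is a function with pointwise values, so its values at end
    points make sense. *)
Definition prim a b f f' : Prop :=
  intb a b f' /\ forall x, a <= x <= b -> f x = f a + itg a x f'.

Lemma primB a b f f' x y : prim a b f f' -> a <= x -> x <= y -> y <= b ->
  f y - f x = itg x y f'.
Proof.
move=> [fi fE] ax xy yb.
rewrite (fE y) ?yb ?(le_trans ax xy)// (fE x) ?ax ?(le_trans xy yb)//.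
rewrite (@itg_split _ a x y)//; last exact: intbS fi.
by rewrite opprD addrACA subrr add0r addrAC subrr add0r.
Qed.

Lemma primS a b c d f f' : a <= c -> d <= b -> prim a b f f' -> prim c d f f'.
Proof.
move=> ac db pf; split; first by apply: intbS pf.1.
move=> x /andP[cx xd]; rewrite -(@primB a b f f' c x)//; last exact: le_trans db.
by rewrite addrC subrK.
Qed.

Lemma prim_ae a b f f' g' : meas a b g' -> aeon a b (fun x => f' x = g' x) ->
  prim a b f f' -> prim a b f g'.
Proof.
move=> mg fg [fi fE]; split; first exact: intb_ae fi fg.
move=> x xi; rewrite (fE _ xi); congr (_ + _); apply: itg_ae.
- by apply: measS (intb_meas fi) => //; case/andP: xi.
- by apply: measS mg => //; case/andP: xi.
- by apply: aeonS fg => //; case/andP: xi.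
Qed.

Lemma prim_ext a b f g f' : (forall x, a <= x <= b -> f x = g x) ->
  prim a b f f' -> prim a b g f'.
Proof.
move=> fg [fi fE]; split => // x xi; have ab : a <= b by case/andP: xi => /le_trans; apply.
by rewrite -(fg x xi) -(fg a) ?lexx ?ab// (fE x xi).
Qed.

Lemma prim_cst a b k : prim a b (fun _ => k) (fun _ => 0).
Proof.
split; first exact: intb_cst.
by move=> x /andP[ax _]; rewrite itg_cst// mul0r addr0.
Qed.

Lemma primD a b f f' g g' : prim a b f f' -> prim a b g g' ->
  prim a b (fun x => f x + g x) (fun x => f' x + g' x).
Proof.
move=> [fi fE] [gi gE]; split; first exact: intbD.
move=> x xi; have /andP[ax xb] := xi.
rewrite (fE x xi) (gE x xi) itgD; [ring|exact: intbS fi|exact: intbS gi].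
Qed.

Lemma primZ a b f f' k : prim a b f f' ->
  prim a b (fun x => k * f x) (fun x => k * f' x).
Proof.
move=> [fi fE]; split; first exact: intbZ.
move=> x xi; have /andP[ax xb] := xi.
by rewrite (fE x xi) mulrDr itgZ//; exact: intbS fi.
Qed.

Lemma primN a b f f' : prim a b f f' -> prim a b (fun x => - f x) (fun x => - f' x).
Proof.
by move=> /(primZ (-1)); congr prim; apply: funext => x; rewrite mulN1r.
Qed.

Lemma prim_sub a b f f' g g' : prim a b f f' -> prim a b g g' ->
  prim a b (fun x => f x - g x) (fun x => f' x - g' x).
Proof. by move=> pf pg; apply: primD => //; exact: primN. Qed.

Lemma prim_itg a b f' : intb a b f' -> prim a b (fun x => itg a x f') f'.
Proof. by move=> fi; split => // x _; rewrite itg_pt add0r. Qed.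

Lemma prim_cont a b f f' : a <= b -> prim a b f f' -> {within `[a, b], continuous f}.
Proof.
move=> ab [fi fE].
have := parameterized_integral_continuous ab fi.
set F := (X in continuous X) => cF.
have : {within `[a, b], continuous (fun x => f a + F x)}.
  by move=> x; apply: cvgD; [exact: cvg_cst|exact: cF].
apply: subspace_eq_continuous => x; rewrite inE/= in_itv/= => xi.
exact: (esym (fE x xi)).
Qed.

Lemma prim_meas a b f f' : prim a b f f' -> meas a b f.
Proof.
have [ab pf|ba _] := leP a b; last first.
  by rewrite /meas set_itv_ge -?ltNge//; exact: measurable_fun_set0.
by apply: subspace_continuous_measurable_fun => //; exact: prim_cont pf.
Qed.

Lemma prim_bdd a b f f' : prim a b f f' ->
  forall x, a <= x <= b -> `|f x| <= `|f a| + itg a b (fun y => `|f' y|).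
Proof.
move=> [fi fE] x xi; have /andP[ax xb] := xi.
rewrite (fE _ xi) (le_trans (ler_normD _ _))// lerD2l.
have fi' : intb a x f' by exact: intbS fi.
rewrite (le_trans (itg_abs fi'))//.
rewrite (@itg_split _ a x b)//; last exact: intb_abs.
rewrite lerDl; apply: itg_ge0; last exact: aeonW.
by apply: intb_abs; exact: intbS fi.
Qed.

Lemma prim_sq a b f f' : prim a b f f' -> sq a b f.
Proof.
move=> pf; have mf := prim_meas pf; split => //.
apply: (@intb_bdd _ _ _ _ ((`|f a| + itg a b (fun y => `|f' y|)) ^+ 2)); first exact: measX.
apply: aeonW => x xi; have H := prim_bdd pf xi.
by rewrite normrX ler_sqr ?nnegrE// (le_trans _ H).
Qed.

Lemma prim_intb a b f f' : prim a b f f' -> intb a b f.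
Proof. by move=> /prim_sq /sq_intb. Qed.

Lemma prim_intbM a b f f' g : prim a b f f' -> intb a b g -> intb a b (fun x => f x * g x).
Proof.
move=> pf gi; apply: (intb_bM (prim_meas pf) _ gi).
by apply: aeonW; exact: prim_bdd pf.
Qed.

(** Writing each function as its value at [a] plus an integral leaves one genuinely double term.
    Exchanging the order in one half of it turns the two triangles into the square, that is, into
    the product of the two total integrals. *)
Lemma itg_by_parts a b f f' g g' : a <= b -> prim a b f f' -> prim a b g g' ->
  itg a b (fun x => f' x * g x + f x * g' x) = f b * g b - f a * g a.
Proof.
move=> ab pf pg; have [fi fE] := pf; have [gi gE] := pg.
have pF := prim_itg fi; have pG := prim_itg gi.
have i1 : intb a b (fun x => f' x * itg a x g').
  by have := prim_intbM pG fi; congr intb; apply: funext => x; rewrite mulrC.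
have i2 : intb a b (fun x => g' x * itg a x f').
  by have := prim_intbM pF gi; congr intb; apply: funext => x; rewrite mulrC.
rewrite (@itg_ext _ a b _ (fun x => (g a * f' x + f a * g' x) +
    (f' x * itg a x g' + g' x * itg a x f'))); last first.
  by move=> x xi; rewrite (fE x)// (gE x)//; ring.
rewrite itgD; [|by apply: intbD; exact: intbZ|exact: intbD].
rewrite itgD; [|exact: intbZ|exact: intbZ].
rewrite itgD// !itgZ// itg_fubini_tri//.
have -> : itg a b (fun y => g' y * itg y b f') =
  itg a b (fun y => itg a b f' * g' y - g' y * itg a y f').
  apply: itg_ext => y /andP[ay yb]; rewrite (@itg_split _ a y b f')//.
  by ring.
rewrite itgB//; last exact: intbZ.
rewrite itgZ// (fE b) ?lexx ?ab// (gE b) ?lexx ?ab//.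
by ring.
Qed.

Lemma primM a b f f' g g' : prim a b f f' -> prim a b g g' ->
  prim a b (fun x => f x * g x) (fun x => f' x * g x + f x * g' x).
Proof.
move=> pf pg; split.
  apply: intbD; last exact: prim_intbM pf pg.1.
  by have := prim_intbM pg pf.1; congr intb; apply: funext => x; rewrite mulrC.
move=> x /andP[ax xb]; rewrite itg_by_parts ?(addrC (f a * g a)) ?subrK//.
  exact: primS pf.
exact: primS pg.
Qed.

Lemma prim_C1 a b f f' : (forall x : R, is_derive x 1 f (f' x)) -> continuous f' ->
  prim a b f f'.
Proof.
move=> df cf'.
have f'i : intb a b f'.
  apply: continuous_compact_integrable; first exact: segment_compact.
  exact: continuous_subspaceT.
split => // x /andP[ax xb].
move: ax; rewrite le_eqVlt => /predU1P[<-|ax]; first by rewrite itg_pt addr0.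
rewrite /itg /Rintegral (@continuous_FTC2 _ f' f)//.
- by rewrite /= addrCA subrr addr0.
- exact: continuous_subspaceT.
- have cf y : {for y, continuous f}.
    by apply: differentiable_continuous; apply/derivable1_diffP; have [] := df y.
  split => [y _||]; first by have [] := df y.
  + by apply: cvg_at_right_filter; exact: cf.
  + by apply: cvg_at_left_filter; exact: cf.
- by move=> y _; rewrite derive1E; have [_ ->] := df y.
Qed.

End Prim.

(** * Smooth cutoff functions *)

Section EpsDerive.
Variable R : realType.
Implicit Types (f g : R -> R) (x l : R).

(** The error form without division. [rd] and [L2d] have the same shape, for the closed half-line
    and for curves in [L^2]. *)
Lemma is_derive_eps f x l :
  is_derive x 1 f l <->
  forall e, 0 < e -> exists2 d, 0 < d & forall y, `|y - x| < d ->
    `|f y - f x - (y - x) * l| <= e * `|y - x|.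
Proof.
split=> [[df fl] e e0|H].
- have : h^-1 *: ((f \o shift x) (h *: 1) - f x) @[h --> 0^'] --> l.
    by rewrite -fl; exact: df.
  move=> /cvgrPdist_le /(_ _ e0) [d /= d0 dP].
  exists d => // y yd; have [->|yx] := eqVneq y x.
    by rewrite !subrr mul0r subr0 normr0 mulr0.
  have hN0 : y - x != 0 by rewrite subr_eq0.
  have := dP (y - x); rewrite /= sub0r normrN => /(_ yd hN0).
  rewrite /= scaler1 subrK => ineq.
  have -> : f y - f x - (y - x) * l = - ((y - x) * (l - (y - x)^-1 * (f y - f x))).
    by field.
  by rewrite normrN normrM mulrC ler_wpM2r.
- suff dl : h^-1 *: ((f \o shift x) (h *: 1) - f x) @[h --> 0^'] --> l.
    by apply: DeriveDef; [apply/cvg_ex; exists l|exact: cvg_lim].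
  apply/cvgrPdist_le => e e0; have [d d0 dP] := H _ e0.
  exists d => //= h; rewrite /= sub0r normrN => hd h0.
  have := dP (h + x); rewrite addrK => /(_ hd).
  rewrite scaler1 => ineq.
  have -> : l - h^-1 * (f (h + x) - f x) = - (h^-1 * (f (h + x) - f x - h * l)).
    by field.
  by rewrite normrN normrM normfV ler_pdivrMl ?normr_gt0// [_ * e]mulrC.
Qed.

End EpsDerive.

Section Bump.
Variable R : realType.
Variable w : {poly R}.

(* This family is closed under differentiation: (flat Q m)' = flat (flatD Q m) m.+2. *)
Definition flat (Q : {poly R}) (m : nat) (x : R) : R :=
  if 0 < w.[x] then Q.[x] / w.[x] ^+ m * expR (- (w.[x])^-1) else 0.

Definition flatD (Q : {poly R}) (m : nat) : {poly R} :=
  (Q^`() * w ^+ 2 - m%:R%:P * Q * w^`() * w + Q * w^`())%R.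

Lemma is_derive_horner (p : {poly R}) (x : R) : is_derive x 1 (horner p) (p^`()).[x].
Proof.
by apply: DeriveDef; [exact: derivable_horner|rewrite derivE derive1E].
Qed.

(** One term of the exponential series, [expR s >= s ^+ m.+2 / m.+2!] at [s = y^-1]. The factor
    [y ^+ 2] left over makes the gluing with zero differentiable. *)
Lemma flat_exp_le (m : nat) (y : R) : 0 < y ->
  (y ^+ m)^-1 * expR (- y^-1) <= (m.+2)`!%:R * y ^+ 2.
Proof.
move=> y0; have yi0 : 0 <= y^-1 by rewrite invr_ge0 ltW.
have := expR_ge1Dxn m.+1 yi0; rewrite expRN => H.
have H' : y ^- m.+2 / (m.+2)`!%:R <= expR y^-1.
  by rewrite -exprVn (le_trans _ H)// lerDr.
have fpos : 0 < (m.+2)`!%:R :> R by rewrite ltr0n fact_gt0.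
rewrite ler_pdivrMr ?expR_gt0//.
apply: (@le_trans _ _ ((m.+2)`!%:R * y ^+ 2 * (y ^- m.+2 / (m.+2)`!%:R))).
  have yN0 : y != 0 by rewrite gt_eqF.
  have ymN0 : y ^+ m != 0 by rewrite expf_neq0.
  have -> : y ^+ m.+2 = y ^+ m * y ^+ 2 by rewrite -exprD addn2.
  have cN0 : (m.+2)`!%:R != 0 :> R by rewrite gt_eqF.
  move: ((m.+2)`!%:R) cN0 => c cN0.
  by rewrite le_eqVlt; apply/orP; left; apply/eqP; field; rewrite cN0 ymN0 yN0.
by apply: ler_wpM2l => //; rewrite mulr_ge0 ?sqr_ge0 ?ltW.
Qed.

Lemma horner_near_le (p : {poly R}) (x : R) :
  exists2 d, 0 < d & forall y, `|y - x| < d -> `|p.[y]| <= `|p.[x]| + 1.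
Proof.
have /cvgrPdist_le/(_ 1 ltr01)[d /= d0 dP] := @continuous_horner R p x.
exists d => // y yd; have := dP y; rewrite /= distrC => /(_ yd) H.
by rewrite -lerBlDl (le_trans _ H)// distrC lerB_dist.
Qed.

(** Where [w] is positive this is the quotient rule. Where [w.[x] <= 0], positive values [w.[y]]
    nearby are at most a multiple of [|y - x|], so the function is quadratically small around [x]
    and its derivative is zero. *)
Lemma flat_derive (Q : {poly R}) (m : nat) (x : R) :
  is_derive x 1 (flat Q m) (flat (flatD Q m) m.+2 x).
Proof.
have dw := is_derive_horner w x; have dQ := is_derive_horner Q x.
have [wx|wx] := ltP 0 w.[x].
- have wxN0 : w.[x] != 0 by rewrite gt_eqF.
  apply: (@near_eq_is_derive _ _ _
     (fun y => Q.[y] / w.[y] ^+ m * expR (- (w.[y])^-1))).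
    have : \forall y \near x, 0 < w.[y].
      by have /cvgr_gt := @continuous_horner R w x; apply.
    by apply: filterS => y yw; rewrite /flat yw.
  rewrite /flat wx.
  have d1 : is_derive x 1 (fun y => (w.[y])^-1) (- (w.[x]) ^- 2 *: (w^`()).[x]).
    exact: is_deriveV.
  have d2 : is_derive x 1 (fun y => (w.[y])^-1 ^+ m)
     ((m%:R * (w.[x])^-1 ^+ m.-1) *: (- (w.[x]) ^- 2 *: (w^`()).[x])).
    have -> : (fun y => (w.[y])^-1 ^+ m) = (fun y => (w.[y])^-1) ^+ m.
      by apply: funext => y; rewrite exprfctE.
    exact: is_deriveX.
  have d3 : is_derive x 1 (fun y => expR (- (w.[y])^-1))
     (expR (- (w.[x])^-1) *: (- (- (w.[x]) ^- 2 *: (w^`()).[x]))).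
    apply: is_derive1_comp.
  have := @is_deriveM _ _ _ _ _ _ _ _ (@is_deriveM _ _ _ _ _ _ _ _ dQ d2) d3.
  rewrite (_ : _ * _ = (fun y => Q.[y] / w.[y] ^+ m * expR (- (w.[y])^-1))); last first.
    by apply: funext => y; rewrite !mulrfctE /= exprVn.
  move=> [Hd HE]; apply: (DeriveDef Hd); rewrite {}HE.
  rewrite /flatD !hornerE/= /GRing.scale/=.
  rewrite !mulrfctE; clear d1 d2 d3 Hd.
  move: (expR (- (w.[x])^-1)) => e; move: wxN0; move: (w.[x]) => v v0.
  move: (Q.[x]) (Q^`().[x]) (w^`().[x]) => q q' w'.
  case: m => [|m]; first by rewrite !expr0 !exprS expr0; field.
  rewrite !exprVn /= !exprS; have : v ^+ m != 0 by rewrite expf_neq0.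
  by move: (v ^+ m) => z z0; field; rewrite v0 z0.
- apply/is_derive_eps => e e0.
  have -> : flat (flatD Q m) m.+2 x = 0 by rewrite /flat ltNge wx.
  have fx : flat Q m x = 0 by rewrite /flat ltNge wx.
  rewrite fx.
  have [d1 d10 d1P] := horner_near_le Q x.
  have [d2 d20 d2P] := (is_derive_eps _ _ _).1 dw 1 ltr01.
  pose L := `|(w^`()).[x]| + 1.
  have L0 : 0 < L by rewrite ltr_wpDl.
  pose M := (`|Q.[x]| + 1) * (m.+2)`!%:R * L ^+ 2.
  have M0 : 0 < M.
    rewrite !mulr_gt0 ?exprn_gt0// ?ltr_wpDl//; by rewrite ltr0n fact_gt0.
  exists (Num.min (Num.min d1 d2) (e / M)).
    by rewrite !lt_min d10 d20 divr_gt0.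
  move=> y; rewrite !lt_min => /andP[/andP[yd1 yd2] yeM].
  rewrite mulr0 !subr0.
  apply: (@le_trans _ _ (M * `|y - x| * `|y - x|)); last first.
    by rewrite ler_wpM2r// mulrC -ler_pdivlMr// ltW.
  rewrite /flat; case: ifPn => [wy|_]; last first.
    by rewrite normr0 !mulr_ge0// ltW.
  have wyL : w.[y] <= L * `|y - x|.
    have := d2P _ yd2; rewrite mul1r => H.
    have -> : w.[y] = (w.[y] - w.[x] - (y - x) * (w^`()).[x]) +
        (y - x) * (w^`()).[x] + w.[x] by ring.
    have : (y - x) * (w^`()).[x] <= `|(w^`()).[x]| * `|y - x|.
      by rewrite mulrC -normrM ler_norm.
    have -> : L * `|y - x| = `|(w^`()).[x]| * `|y - x| + `|y - x| by rewrite /L; ring.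
    by have := le_trans (ler_norm _) H; lra.
  rewrite -mulrA normrM.
  rewrite [X in _ * X]ger0_norm; last by rewrite mulr_ge0 ?expR_ge0 ?invr_ge0 ?exprn_ge0 ?ltW.
  apply: (@le_trans _ _ ((`|Q.[x]| + 1) * ((m.+2)`!%:R * w.[y] ^+ 2))).
    apply: ler_pM => //; [|exact: d1P|exact: flat_exp_le].
    by rewrite mulr_ge0 ?expR_ge0 ?invr_ge0 ?exprn_ge0 ?ltW.
  have -> : M * `|y - x| * `|y - x| =
      (`|Q.[x]| + 1) * ((m.+2)`!%:R * (L * `|y - x|) ^+ 2) by rewrite /M; ring.
  rewrite ler_wpM2l ?addr_ge0// ler_wpM2l//.
  by rewrite ler_sqr ?nnegrE ?(ltW wy)// mulr_ge0// ltW.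
Qed.

Lemma flat_derive1n (Q : {poly R}) (m n : nat) :
  exists Q' m', derive1n n (flat Q m) = flat Q' m'.
Proof.
elim: n => [|n [Q' [m' IH]]]; first by exists Q, m.
exists (flatD Q' m'), m'.+2; rewrite derive1nS IH; apply: funext => x.
by rewrite derive1E; have [_ ->] := flat_derive Q' m' x.
Qed.

Lemma flat_smooth (Q : {poly R}) (m n : nat) x :
  derivable (derive1n n (flat Q m)) x 1.
Proof.
have [Q' [m' ->]] := flat_derive1n Q m n.
by have [] := flat_derive Q' m' x.
Qed.

End Bump.

(** * Cutoffs exhausting an interval, and the fundamental lemma of the calculus of variations *)

Section Fund.
Variable R : realType.
Local Notation mu := (@lebesgue_measure R).
Implicit Types (a b c d k p q : R) (f g h : R -> R).

(** The function [expR (- ((n+1)(x - p)(q - x))^-1)] between [p] and [q], zero outside. The factor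
    [n + 1] makes it tend to the indicator of the open interval as [n] grows. *)
Definition cutoff (n : nat) p q : R -> R :=
  flat ((n.+1)%:R%:P * ('X - p%:P) * (q%:P - 'X))%R 1 0.

Lemma cutoffE n p q x : p <= q -> cutoff n p q x =
  if p < x < q then expR (- (n.+1%:R * ((x - p) * (q - x)))^-1) else 0.
Proof.
move=> pq; rewrite /cutoff /flat.
have -> : ((n.+1)%:R%:P * ('X - p%:P) * (q%:P - 'X)).[x] = n.+1%:R * ((x - p) * (q - x)).
  by rewrite !hornerE/= ?mulrA.
rewrite hornerC expr0 divr1 mul1r pmulr_rgt0 ?ltr0n//.
case: (ltP p x) => px /=.
  by rewrite pmulr_rgt0 subr_gt0.
have xq := le_trans px pq.
by rewrite ifF//; apply/negbTE; rewrite -leNgt mulr_le0_ge0// ?subr_le0 ?subr_ge0.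
Qed.

Lemma cutoff_ge0 n p q x : p <= q -> 0 <= cutoff n p q x.
Proof. by move=> pq; rewrite cutoffE//; case: ifP => // _; exact: expR_ge0. Qed.

Lemma cutoff_le1 n p q x : p <= q -> cutoff n p q x <= 1.
Proof.
move=> pq; rewrite cutoffE//; case: ifP => // /andP[px xq].
by rewrite expR_le1 oppr_le0 invr_ge0 !mulr_ge0// subr_ge0 ltW.
Qed.

Lemma cutoff_out n p q x : p <= q -> ~ (p <= x <= q) -> cutoff n p q x = 0.
Proof.
move=> pq xi; rewrite cutoffE//; case: ifP => // /andP[/ltW px /ltW xq].
by case: xi; rewrite px.
Qed.

Lemma cutoff_cvg p q x : p < x -> x < q -> (fun n => cutoff n p q x) @ \oo --> (1 : R).
Proof.
move=> px xq; have pq := ltW (lt_trans px xq).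
pose y := (x - p) * (q - x).
have -> : (fun n => cutoff n p q x) = (fun n => expR (- (n.+1%:R^-1 * y^-1))).
  by apply: funext => n; rewrite cutoffE// px xq/= invfM.
have : (fun n => expR (- (n.+1%:R^-1 * y^-1))) @ \oo --> expR (- (0 * y^-1)).
  apply: continuous_cvg; first exact: continuous_expR.
  apply: cvgN; apply: cvgM; last exact: cvg_cst.
  exact: (@cvg_harmonic R).
by rewrite mul0r oppr0 expR0.
Qed.

Lemma cutoff_smooth m p q n x : derivable (derive1n n (cutoff m p q)) x 1.
Proof. exact: flat_smooth. Qed.

Lemma cutoff_continuous m p q : continuous (cutoff m p q).
Proof.
move=> x; apply: differentiable_continuous; apply/derivable1_diffP.
exact: (@cutoff_smooth m p q 0%N x).
Qed.

Lemma cutoff_test Om m p q : p <= q -> `[p, q]%classic `<=` Om -> test_fun Om (cutoff m p q).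
Proof.
move=> pq sub; split; first by move=> n x; exact: cutoff_smooth.
exists `[p, q]%classic; split => //; first exact: segment_compact.
by move=> x xi; apply: cutoff_out => //; move: xi; rewrite /= in_itv.
Qed.

Lemma Rintegral_supp Om f p q : `[p, q]%classic `<=` Om ->
  (forall x, ~ (p <= x <= q) -> f x = 0) -> Rintegral mu Om f = itg p q f.
Proof.
move=> sub f0; rewrite /itg Rintegral_mkcond [RHS]Rintegral_mkcond.
congr Rintegral; apply: funext => x; rewrite !patchE.
have [xi|xi] := boolP (p <= x <= q).
  have xpq : `[p, q]%classic x by rewrite /= in_itv.
  by rewrite (mem_set xpq) (mem_set (sub _ xpq)).
rewrite f0; last exact/negP.
by rewrite !if_same.
Qed.

Lemma itg_cutoff_cvg h p q : p < q -> intb p q h ->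
  (fun n => itg p q (fun x => h x * cutoff n p q x)) @ \oo --> itg p q h.
Proof.
move=> pq hi; have pq' := ltW pq.
have mb n : meas p q (cutoff n p q).
  apply: subspace_continuous_measurable_fun => //.
  by apply: continuous_subspaceT; exact: cutoff_continuous.
have mh := intb_meas hi.
have [] := @dominated_convergence _ _ _ mu `[p, q]%classic (measurable_itv _)
  (fun n x => (h x * cutoff n p q x)%:E) (EFin \o h) (fun x => `|h x|%:E).
- by move=> n; apply/measurable_EFinP; exact: measM.
- exact/measurable_EFinP.
- have : {ae mu, forall x : R, x != p}.
    exists [set p]; split; [exact: measurable_set1|exact: lebesgue_measure_set1|].
    by move=> x /= /negP; rewrite negbK => /eqP.
  have : {ae mu, forall x : R, x != q}.
    exists [set q]; split; [exact: measurable_set1|exact: lebesgue_measure_set1|].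
    by move=> x /= /negP; rewrite negbK => /eqP.
  move=> H1 H2; apply: (ae_sub2 H1 H2) => x xq xp; rewrite /= in_itv/= => /andP[px qx].
  apply: cvg_EFin; first by near=> n.
  rewrite /= -[X in _ --> X]mulr1; apply: cvgM; first exact: cvg_cst.
  by apply: cutoff_cvg; rewrite lt_def ?px ?qx ?andbT// eq_sym.
- exact: intb_abs.
- apply: aeW => x n _; rewrite lee_fin normrM ler_piMr//.
  by rewrite ger0_norm ?cutoff_ge0// cutoff_le1.
move=> _ _ H; rewrite /itg /Rintegral.
apply: (@fine_cvg _ _ _ _ (fun n => (\int[mu]_(x in `[p, q]) (h x * cutoff n p q x)%:E)%E)).
rewrite fineK; first exact: H.
exact: integrable_fin_num.
Unshelve. all: by end_near. Qed.

Lemma fund_itg Om h p q : p < q -> `[p, q]%classic `<=` Om -> intb p q h ->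
  (forall n, Rintegral mu Om (fun x => h x * cutoff n p q x) = 0) -> itg p q h = 0.
Proof.
move=> pq sub hi H; have := itg_cutoff_cvg pq hi.
have -> : (fun n => itg p q (fun x => h x * cutoff n p q x)) = fun=> 0.
  apply: funext => n; rewrite -(H n); apply/esym; apply: Rintegral_supp => //.
  by move=> x xi; rewrite cutoff_out ?mulr0// ltW.
by move=> H'; rewrite (cvg_unique _ H' (cvg_cst 0)).
Qed.

(** Lebesgue differentiation: almost everywhere [h] is the derivative of its indefinite integral,
    which is zero. The extension by zero makes that integral vanish for every upper limit, also
    beyond [b]. *)
Lemma itg_all0 a b h : intb a b h -> (forall x, a <= x <= b -> itg a x h = 0) ->
  aeon a b (fun x => h x = 0).
Proof.
move=> hi H; have [ab|ba] := leP a b; last first.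
  by apply: aeonW => x /andP[ax /(le_trans ax)]; rewrite leNgt ba.
pose h1 := h \_ `[a, b].
have h1i : mu.-integrable setT (EFin \o h1) by apply/intb_restrict.
have H1 y : itg a y h1 = 0.
  have [ya|ay] := ltP y a.
    by rewrite /itg set_itv_ge -?ltNge// Rintegral_set0.
  have -> : itg a y h1 = itg a (Num.min y b) h.
    rewrite !itg_restrict; congr Rintegral; apply: funext => x.
    rewrite /h1 !patchE !mem_setE !in_itv/= le_min.
    by case: (a <= x) (x <= y) (x <= b) => [] [] [].
  by apply: H; rewrite le_min ay ab/= ge_min lexx orbT.
have := @FTC1 R h1 (BLeft a) _ _ => /(_ _ _)[||].
- move=> y; apply: integrableS h1i => //.
- have := integrable_locally (@measurableT _ R) h1i.
  by rewrite patch_setT.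
(* The differentiation theorem speaks only of points to the right of the lower limit, so [a] joins
   the null set. *)
move=> N [mN N0 sub]; exists (N `|` [set a]); split.
- by apply: measurableU.
- by apply: null_set_setU => //; exact: lebesgue_measure_set1.
move=> x /= Hx; have [->|xa] := eqVneq x a; first by right.
left; apply: sub => /= H2; apply: Hx => /andP[ax xb].
have ax' : (a%:E < x%:E)%E by rewrite lte_fin lt_def xa.
have := H2 ax' => -[_].
have -> : (fun x => \int[mu]_(t in `[a, x]) h1 t) = fun=> 0.
  by apply: funext => y; exact: H1.
rewrite derive1_cst /h1 patchE mem_set//.
by rewrite /= in_itv/= ax.
Qed.

(** Cutoffs suffice as test functions: in the limit they give the integral of [h] over every
    subinterval. *)
Lemma fund_ae Om h a b : `[a, b]%classic `<=` Om -> intb a b h ->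
  (forall n p q, a <= p -> p < q -> q <= b ->
    Rintegral mu Om (fun x => h x * cutoff n p q x) = 0) ->
  aeon a b (fun x => h x = 0).
Proof.
move=> sub hi H; apply: itg_all0 => // x /andP[].
rewrite le_eqVlt => /predU1P[<-|ax] xb; first by rewrite itg_pt.
apply: (@fund_itg Om) => //.
- apply: subset_trans sub => y /=; rewrite !in_itv/= => /andP[-> yx].
  exact: le_trans yx xb.
- exact: intbS hi.
- by move=> n; exact: H.
Qed.

Lemma prim_unique a b f g1 g2 : prim a b f g1 -> prim a b f g2 ->
  aeon a b (fun x => g1 x = g2 x).
Proof.
move=> p1 p2; have := @itg_all0 a b (fun x => g1 x - g2 x).
move=> /(_ (intbB p1.1 p2.1)) H.
apply: aeon1 (H _) => [x _ /eqP|x /andP[ax xb]]; first by rewrite subr_eq0 => /eqP.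
rewrite itgB; [|exact: intbS p1.1|exact: intbS p2.1].
by rewrite -(primB p1)// -(primB p2)// subrr.
Qed.

End Fund.

(** * Weak derivatives *)

Section WeakDeriv.
Variable R : realType.
Local Notation mu := (@lebesgue_measure R).
Implicit Types (a b c d k p q : R) (f g h F : R -> R).

Lemma ae_aeon (P : R -> Prop) : {ae mu, forall x : R, P x} -> forall a b, aeon a b P.
Proof. by move=> H a b; apply: (ae_sub H) => x Px _. Qed.

Lemma aeon_ae (P : R -> Prop) : (forall a b, aeon a b P) -> {ae mu, forall x : R, P x}.
Proof.
move=> H; have /ae_foralln H' := (fun n : nat => H (- n%:R) n%:R); apply: (ae_sub H') => x Hx.
have := archi_boundP (normr_ge0 x); set n := Num.bound _ => xn.
by apply: (Hx n); rewrite -ler_norml ltW.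
Qed.

Lemma li_intb Om f a b : locally_integrable Om f -> `[a, b]%classic `<=` Om -> intb a b f.
Proof.
move=> [mf oO Hf] sub; apply/integrableP; split.
  apply/measurable_EFinP; apply: measurable_funS mf => //; exact: open_measurable.
by apply: Hf => //; exact: segment_compact.
Qed.

Lemma measT f : (forall a b, meas a b f) -> measurable_fun setT f.
Proof.
move=> H; have -> : [set: R] = \bigcup_(n in @setT nat) `[- n%:R, n%:R]%classic.
  apply/seteqP; split => // x _.
  have := archi_boundP (normr_ge0 x); set n := Num.bound _ => xn.
  by exists n => //=; rewrite in_itv/= -ler_norml ltW.
by apply/measurable_fun_bigcup => // n; exact: H.
Qed.

Lemma compact_itv (K : set R) : compact K ->
  exists2 M, 0 < M & forall x, K x -> - M < x < M.
Proof.
move=> /compact_bounded [M [Mr HM]].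
exists (`|M| + 2); first by rewrite ltr_wpDl.
move=> x Kx; rewrite -ltr_norml; apply: (@le_lt_trans _ _ (`|M| + 1)).
  by apply: HM => //; rewrite (le_lt_trans (ler_norm _))// ltrDl.
by rewrite ltrD2l ltr1n.
Qed.

Lemma intb_li f : (forall a b, intb a b f) -> locally_integrable setT f.
Proof.
move=> H; split.
- by apply: measT => a b; exact: intb_meas.
- exact: openT.
- move=> K _ cK; have [M M0 KM] := compact_itv cK.
  have /integrableP[mf] := H (- M) M; apply: le_lt_trans.
  apply: ge0_subset_integral => //.
  + exact: compact_measurable.
  + by apply/measurable_EFinP; apply: measurableT_comp => //; exact/measurable_EFinP.
  + by move=> x /KM /andP[/ltW ? /ltW ?]; rewrite /= in_itv/=; apply/andP.
Qed.

Definition sint g x : R := if 0 <= x then itg 0 x g else - itg x 0 g.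

Lemma sint_prim g : (forall a b, intb a b g) -> forall a b, prim a b (sint g) g.
Proof.
move=> gi a b; split => // x /andP[ax _]; rewrite /sint.
have [a0|a0] := leP 0 a.
  by rewrite (le_trans a0 ax) -(@itg_split _ 0 a x).
have [x0|x0] := leP 0 x.
  by rewrite (@itg_split _ a 0 x)//; [ring|exact: ltW].
by rewrite (@itg_split _ a x 0)//; [ring|exact: ltW].
Qed.

Lemma test_smooth Om phi : test_fun Om phi ->
  continuous (derive1 phi) /\ forall x : R, is_derive x 1 phi (derive1 phi x).
Proof.
move=> [sm _]; split => x.
  apply: differentiable_continuous; apply/derivable1_diffP; exact: (sm 1%N x).
by apply: DeriveDef; [exact: (sm 0%N x)|rewrite derive1E].
Qed.

Lemma test_supp (phi : R -> R) : test_fun setT phi -> exists2 M : R, 0 < M &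
  forall x : R, ~ (- M < x < M) -> phi x = 0 /\ derive1 phi x = 0.
Proof.
move=> [_ [K [cK _ phi0]]]; have [M M0 KM] := compact_itv cK.
exists M => // x xM; have xK : (~` K) x by move=> /KM.
split; first exact: phi0.
rewrite derive1E (@near_eq_derive _ _ _ _ (cst 0)) ?derive_cst//.
have oK : open (~` K) by apply: closed_openC; apply: compact_closed => //; exact: Rhausdorff.
have := open_nbhs_nbhs (conj oK xK).
by apply: filterS => y yK; exact: phi0.
Qed.

Lemma intb_cM a b f g : continuous g -> intb a b f -> intb a b (fun x => f x * g x).
Proof.
move=> cg fi.
have mg : meas a b g.
  apply: subspace_continuous_measurable_fun => //; exact: continuous_subspaceT.
have /compact_itv [M M0 HM] : compact (g @` `[a, b]).
  apply: continuous_compact; first exact: continuous_subspaceT.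
  exact: segment_compact.
have : intb a b (fun x => g x * f x).
  apply: (@intb_bM _ _ _ _ _ M) => //; apply: aeonW => x xi.
  have /HM : (g @` `[a, b]) (g x) by exists x => //=; rewrite in_itv.
  by move=> /andP[? ?]; rewrite ler_norml !ltW.
by congr intb; apply: funext => x; rewrite mulrC.
Qed.

Lemma prim_weak F g : (forall a b, prim a b F g) -> is_weak_deriv setT F g.
Proof.
move=> H; split.
- by apply: intb_li => a b; exact: prim_intb (H a b).
- by apply: intb_li => a b; exact: (H a b).1.
move=> phi tphi; have [cphi' dphi] := test_smooth tphi.
have [M M0 out] := test_supp tphi.
have sw x : ~ (- M <= x <= M) -> ~ (- M < x < M).
  by move=> xM /andP[/ltW ? /ltW ?]; apply: xM; apply/andP.
rewrite (@Rintegral_supp _ _ _ (- M) M)//; last by move=> x /sw/out[_ ->]; rewrite mulr0.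
rewrite (@Rintegral_supp _ _ _ (- M) M)//; last by move=> x /sw/out[-> _]; rewrite mulr0.
have pphi := @prim_C1 _ (- M) M _ _ dphi cphi'.
have MM : - M <= M by rewrite -subr_ge0 opprK addr_ge0// ltW.
have := itg_by_parts MM (H (- M) M) pphi.
have [-> _] : phi M = 0 /\ derive1 phi M = 0 by apply: out; rewrite ltxx andbF.
have [-> _] : phi (- M) = 0 /\ derive1 phi (- M) = 0 by apply: out; rewrite ltxx.
rewrite !mulr0 subr0 itgD.
- by move=> /eqP; rewrite addr_eq0 => /eqP ->; rewrite opprK.
- apply: intb_cM; last exact: (H _ _).1.
  by move=> x; apply: differentiable_continuous; apply/derivable1_diffP; have [] := dphi x.
- by apply: intb_cM => //; exact: prim_intb (H _ _).
Qed.

Lemma derive1n_lin f g k : (forall n x, derivable (derive1n n f) x 1) ->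
  (forall n x, derivable (derive1n n g) x 1) -> forall n,
  derive1n n (fun x => f x - k * g x) = fun x => derive1n n f x - k * derive1n n g x.
Proof.
move=> sf sg; elim=> [//|n IH]; rewrite !derive1nS IH; apply: funext => x.
rewrite !derive1E.
have d1 : is_derive x 1 (derive1n n f) ('D_1 (derive1n n f) x) by apply: DeriveDef.
have d2 : is_derive x 1 (derive1n n g) ('D_1 (derive1n n g) x) by apply: DeriveDef.
have := @is_deriveB _ _ _ _ _ _ _ _ _ d1 (@is_deriveZ _ _ _ _ k _ _ _ d2).
by move=> [].
Qed.

Lemma smooth_lin f g k : (forall n x, derivable (derive1n n f) x 1) ->
  (forall n x, derivable (derive1n n g) x 1) -> forall n (x : R),
  derivable (derive1n n (fun x => f x - k * g x)) x 1.
Proof.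
move=> sf sg n x; rewrite derive1n_lin//.
have d2 := @derivableZ _ _ _ _ k _ _ (sg n x).
exact: (derivableB (sf n x) d2).
Qed.

(** The du Bois-Reymond lemma. A cutoff minus the multiple of a fixed bump [th] with the same
    integral is the derivative of a test function. Testing with it shows that [h], minus its
    [th]-average, annihilates every cutoff. *)
Lemma dubois h : (forall a b, intb a b h) ->
  (forall phi, test_fun setT phi -> Rintegral mu setT (fun x => h x * derive1 phi x) = 0) ->
  exists c, forall a b, aeon a b (fun x => h x = c).
Proof.
move=> hi H.
have mb n p q a b : intb a b (cutoff n p q).
  apply: continuous_compact_integrable; first exact: segment_compact.
  by apply: continuous_subspaceT; exact: cutoff_continuous.
have hb n p q a b : p <= q -> intb a b (fun x => h x * cutoff n p q x).
  move=> pq.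
  have : intb a b (fun x => cutoff n p q x * h x).
    apply: (@intb_bM _ _ _ _ _ 1) => //; first exact: intb_meas.
    by apply: aeonW => x _; rewrite ger0_norm ?cutoff_ge0 ?cutoff_le1.
  by congr intb; apply: funext => x; rewrite mulrC.
(* The integrals of the cutoffs over the unit interval tend to 1, so they are not all zero. *)
have [n0 In0] : exists n0, itg 0 1 (cutoff n0 (0 : R) 1) != 0.
  apply: contrapT => /forallNP H0.
  have := @itg_cutoff_cvg R (fun=> 1) 0 1 ltr01 (intb_cst _ _ _).
  rewrite itg_cst// subr0 mulr1.
  have -> : (fun n => itg 0 1 (fun x => 1 * cutoff n (0 : R) 1 x)) = fun=> 0.
    apply: funext => n; have := H0 n; case: eqVneq => // E _.
    by rewrite -[RHS]E; apply: itg_ext => x _; rewrite mul1r.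
  move=> H1; have E : 1 = 0 :> R.
    by apply: (cvg_unique _ H1 (cvg_cst 0)); exact: Rhausdorff.
  by have := oner_neq0 R; rewrite E eqxx.
set th := cutoff n0 (0 : R) 1 in In0 *.
exists (itg 0 1 (fun x => h x * th x) / itg 0 1 th); set c := (_ / _).
move=> a b.
suff : aeon a b (fun x => h x - c = 0) by apply: aeon1 => x _ /eqP; rewrite subr_eq0 => /eqP.
apply: (@fund_ae _ setT) => //; first by apply: intbB => //; exact: intb_cst.
move=> n p q _ pq _; have pq' := ltW pq.
pose ps := cutoff n p q.
(* The margin 1 puts the supports of both bumps strictly inside [[A, B]]. *)
pose A := Num.min 0 p - 1; pose B := Num.max 1 q + 1.
have A0 : A < 0 by rewrite /A ltrBlDr add0r gt_min ltr01.
have Ap : A < p by rewrite /A ltrBlDr gt_min (ltrDl p) ltr01 orbT.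
have B1 : 1 < B by rewrite /B ltr_pwDr// le_max lexx.
have Bq : q < B by rewrite /B ltr_pwDr// le_max lexx orbT.
pose k := itg p q ps / itg 0 1 th.
pose ch x := ps x - k * th x.
have AB : A <= B by rewrite ltW// (lt_trans A0)// (lt_trans ltr01).
have supp f u v : A <= u -> u <= v -> v <= B -> intb A B f ->
   (forall x, ~ (u <= x <= v) -> f x = 0) -> itg A B f = itg u v f.
  move=> Au uv vB fi f0.
  rewrite -(@Rintegral_supp _ setT f A B)//; last first.
    move=> x xAB; apply: f0 => /andP[ux xv]; apply: xAB.
    by rewrite (le_trans Au ux) (le_trans xv vB).
  exact: Rintegral_supp.
have psE : itg A B ps = itg p q ps.
  by apply: supp; [exact: ltW|exact: ltW|exact: ltW|exact: mb|move=> x; exact: cutoff_out].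
have thE : itg A B th = itg 0 1 th.
  by apply: supp; [exact: ltW|exact: ler01|exact: ltW|exact: mb|move=> x; exact: cutoff_out].
have psi u v : intb u v ps by exact: mb.
have thi u v : intb u v th by exact: mb.
have chi u v : intb u v ch.
  by apply: intbB; [exact: psi|apply: intbZ; exact: thi].
have ch0 : itg A B ch = 0.
  rewrite itgB; [|exact: psi|by apply: intbZ; exact: thi].
  by rewrite (itgZ k (thi _ _)) psE thE /k divfK// subrr.
have chout x : ~ (A < x < B) -> ch x = 0.
  move=> xAB; rewrite /ch /ps /th !cutoff_out ?mulr0 ?subr0//.
    move=> /andP[px xq]; apply: xAB.
    by rewrite (lt_le_trans A0 px) (le_lt_trans xq B1).
  move=> /andP[px xq]; apply: xAB.
  by rewrite (lt_le_trans Ap px) (le_lt_trans xq Bq).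
have cch : continuous ch.
  move=> x; apply: cvgB; first exact: cutoff_continuous.
  by apply: cvgM; [exact: cvg_cst|exact: cutoff_continuous].
pose phi x := itg A x ch.
(* Since [ch] vanishes left of [A], the base point of the primitive can be moved below any point
   where [phi] is to be differentiated. *)
have base M : M <= A -> phi = (fun y => itg M y ch).
  move=> MA; apply: funext => y; rewrite /phi.
  have vanish u v : v <= A -> itg u v ch = 0.
    move=> vA; have [uv|vu] := leP u v; last first.
      by rewrite /itg set_itv_ge -?ltNge// Rintegral_set0.
    rewrite -[RHS](mul0r (v - u)) -itg_cst//; apply: itg_ext => x /andP[_ xv].
    by apply: chout => /andP[Ax _]; have := le_lt_trans (le_trans xv vA) Ax; rewrite ltxx.
  have [Ay|yA] := leP A y; last by rewrite !vanish// ltW.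
  by rewrite (@itg_split _ M A y)// (vanish M A)// add0r.
have dphi (x : R) : is_derive x 1 phi (ch x).
  pose M := Num.min x A - 1.
  have Mx : M < x by rewrite /M ltrBlDr gt_min (ltrDl x) ltr01.
  have MA : M <= A by rewrite ltW// /M ltrBlDr gt_min (ltrDl A) ltr01 orbT.
  rewrite (base M)//.
  have xx : x < x + 1 by rewrite ltrDl.
  have [d1 d2] := continuous_FTC1_closed xx (chi M (x + 1)) Mx (cch x).
  by apply: DeriveDef; [exact: d1|move: d2; rewrite derive1E].
have dphi1 : derive1 phi = ch.
  by apply: funext => x; rewrite derive1E; have [_ ->] := dphi x.
have tphi : test_fun setT phi.
  split.
    case=> [|m] x; first by have [] := dphi x.
    rewrite derive1Sn dphi1; apply: smooth_lin; exact: cutoff_smooth.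
  exists `[A, B]%classic; split => //; first exact: segment_compact.
  move=> x /negP; rewrite in_itv/= negb_and -!ltNge => /orP[xA|Bx].
    by rewrite /phi /itg set_itv_ge -?ltNge// Rintegral_set0.
  rewrite /phi (@itg_split _ A B x)//; last exact: ltW.
  rewrite ch0 add0r -[RHS](mul0r (x - B)) -itg_cst ?ltW//.
  apply: itg_ext => y /andP[By _]; apply: chout => /andP[_ yB].
  by have := le_lt_trans By yB; rewrite ltxx.
have := H _ tphi; rewrite dphi1.
rewrite (@Rintegral_supp _ _ _ A B)//; last first.
  move=> x xAB; rewrite chout ?mulr0// => /andP[/ltW ? /ltW ?]; apply: xAB.
  by apply/andP.
rewrite (@Rintegral_supp _ _ _ p q)//; last first.
  by move=> x xpq; rewrite cutoff_out ?mulr0.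
have -> : itg A B (fun x => h x * ch x) =
   itg A B (fun x => h x * ps x) - k * itg A B (fun x => h x * th x).
  rewrite -itgZ; last exact: hb.
  rewrite -itgB; [|exact: hb|by apply: intbZ; exact: hb].
  by apply: itg_ext => x _; rewrite /ch; ring.
have -> : itg A B (fun x => h x * ps x) = itg p q (fun x => h x * ps x).
  apply: supp; [exact: ltW|exact: ltW|exact: ltW|exact: hb|].
  by move=> x xi; rewrite /ps cutoff_out ?mulr0.
have -> : itg A B (fun x => h x * th x) = itg 0 1 (fun x => h x * th x).
  apply: supp; [exact: ltW|exact: ler01|exact: ltW|exact: hb|].
  by move=> x xi; rewrite /th cutoff_out ?mulr0.
move=> E; rewrite -[RHS]E.
have -> : itg p q (fun x => (h x - c) * cutoff n p q x) =
  itg p q (fun x => h x * ps x) - c * itg p q ps.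
  rewrite -(itgZ c (psi _ _)) -itgB; [|exact: hb|by apply: intbZ; exact: psi].
  by apply: itg_ext => x _; rewrite mulrBl.
rewrite /c /k; congr (_ - _).
move: (itg 0 1 (fun x => h x * th x)) (itg p q ps) ((itg 0 1 th)^-1) => J P m.
by rewrite mulrC -[RHS]mulrA [m * J]mulrC.
Qed.

(** The difference of [f] and the global primitive of its weak derivative annihilates all
    derivatives of test functions, so it is constant. All pointwise values used later are those of
    this representative. *)
Lemma weak_prim f g : is_weak_deriv setT f g ->
  exists F, (forall a b, prim a b F g) /\ {ae mu, forall x : R, f x = F x}.
Proof.
move=> [lf lg H].
have fi a b : intb a b f by exact: li_intb lf _.
have gi a b : intb a b g by exact: li_intb lg _.
have pG := sint_prim gi.
have Gi a b : intb a b (sint g) by exact: prim_intb (pG a b).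
have [] := @dubois (fun x => f x - sint g x).
- by move=> a b; exact: intbB.
- move=> phi tphi; have [_ _ HG] := prim_weak pG.
  have [cphi' dphi] := test_smooth tphi; have [M M0 out] := test_supp tphi.
  have sw x : ~ (- M <= x <= M) -> ~ (- M < x < M).
    by move=> xM /andP[/ltW ? /ltW ?]; apply: xM; apply/andP.
  have R0 F : Rintegral mu setT (fun x => F x * derive1 phi x) =
      itg (- M) M (fun x => F x * derive1 phi x).
    by apply: Rintegral_supp => // x /sw/out[_ ->]; rewrite mulr0.
  have := H _ tphi; rewrite -(HG _ tphi) !R0 => E.
  have -> : itg (- M) M (fun x => (f x - sint g x) * derive1 phi x) =
     itg (- M) M (fun x => f x * derive1 phi x) -
     itg (- M) M (fun x => sint g x * derive1 phi x).
    rewrite -itgB; [|exact: intb_cM|exact: intb_cM].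
    by apply: itg_ext => x _; rewrite mulrBl.
  by rewrite E subrr.
- move=> c Hc; exists (fun x => sint g x + c); split.
    move=> a b; have := primD (pG a b) (prim_cst a b c); congr prim.
    by apply: funext => x; rewrite addr0.
  apply: aeon_ae => a b; apply: aeon1 (Hc a b) => x _ /eqP.
  by rewrite subr_eq addrC => /eqP.
Qed.

End WeakDeriv.

(** * Uniqueness and localisation of weak derivatives *)

Section WeakDeriv2.
Local Open Scope complex_scope.
Variable R : realType.
Local Notation mu := (@lebesgue_measure R).
Implicit Types (a b c d k p q : R) (f g h F : R -> R).

Lemma derive1_off_support (K : set R) (phi : R -> R) (x : R) : compact K ->
  (forall y, ~ K y -> phi y = 0) -> ~ K x -> derive1 phi x = 0.
Proof.
move=> cK phi0 xK; rewrite derive1E (@near_eq_derive _ _ _ _ (cst 0)) ?derive_cst//.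
have oK : open (~` K) by apply: closed_openC; apply: compact_closed => //; exact: Rhausdorff.
by have := open_nbhs_nbhs (conj oK xK); apply: filterS => y; exact: phi0.
Qed.

(** On a subinterval the cutoffs are themselves test functions on [Om], so both derivatives pair
    with them alike. Two functions [f], [f'] are allowed because representatives agree only almost
    everywhere. *)
Lemma wd_unique Om f f' g1 g2 a b : `[a, b]%classic `<=` Om ->
  is_weak_deriv Om f g1 -> is_weak_deriv Om f' g2 ->
  aeon a b (fun x => f x = f' x) -> aeon a b (fun x => g1 x = g2 x).
Proof.
move=> sub [lf lg1 H1] [lf' lg2 H2] ff'.
have g1i := li_intb lg1 sub; have g2i := li_intb lg2 sub.
have fi := li_intb lf sub; have f'i := li_intb lf' sub.
suff : aeon a b (fun x => g1 x - g2 x = 0).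
  by apply: aeon1 => x _ /eqP; rewrite subr_eq0 => /eqP.
apply: (@fund_ae _ Om) => //; first exact: intbB.
move=> n p q ap pq qb; have pq' := ltW pq.
have subpq : `[p, q]%classic `<=` Om.
  apply: subset_trans sub => x /=; rewrite !in_itv/= => /andP[px xq].
  by rewrite (le_trans ap px) (le_trans xq qb).
have tc := cutoff_test n pq' subpq.
have cc' : continuous (derive1 (cutoff n p q)) by have [] := test_smooth tc.
have c'0 x : ~ (p <= x <= q) -> derive1 (cutoff n p q) x = 0.
  move=> xpq; apply: (@derive1_off_support `[p, q]%classic); first exact: segment_compact.
    by move=> y; rewrite /= in_itv/= => yi; exact: cutoff_out.
  by rewrite /= in_itv.
have E F : Rintegral mu Om (fun x => F x * cutoff n p q x) =
   itg p q (fun x => F x * cutoff n p q x).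
  by apply: Rintegral_supp => // x xi; rewrite cutoff_out ?mulr0.
have E' F : Rintegral mu Om (fun x => F x * derive1 (cutoff n p q) x) =
   itg p q (fun x => F x * derive1 (cutoff n p q) x).
  by apply: Rintegral_supp => // x xi; rewrite c'0 ?mulr0.
have := H1 _ tc; have := H2 _ tc; rewrite !E !E' => {H1 H2} H2 H1.
have iS G : intb a b G -> intb p q G by exact: intbS.
have -> : itg p q (fun x => (g1 x - g2 x) * cutoff n p q x) =
   itg p q (fun x => g1 x * cutoff n p q x) - itg p q (fun x => g2 x * cutoff n p q x).
  rewrite -itgB.
  - by apply: itg_ext => x _; rewrite mulrBl.
  - by apply: intb_cM; [exact: cutoff_continuous|exact: iS].
  - by apply: intb_cM; [exact: cutoff_continuous|exact: iS].
rewrite -[X in X - _]opprK -H1 -[X in _ - X]opprK -H2 opprK.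
rewrite (@itg_ae _ _ _ (fun x => f x * derive1 (cutoff n p q) x)
   (fun x => f' x * derive1 (cutoff n p q) x)) ?addNr//.
- by apply: intb_meas; apply: intb_cM; [exact: cc'|exact: iS].
- by apply: intb_meas; apply: intb_cM; [exact: cc'|exact: iS].
- by have := aeonS ap qb ff'; apply: aeon1 => x _ ->.
Qed.

Lemma li_ae f F : measurable_fun setT f -> (forall a b, intb a b F) ->
  {ae mu, forall x : R, f x = F x} -> locally_integrable setT f.
Proof.
move=> mf Fi fF; apply: intb_li => a b; apply: intb_ae (Fi a b) _; first exact: meas_T.
by apply: (ae_aeon _) => {a b}; apply: (ae_sub fF) => x ->.
Qed.

Lemma prim_weak_ae f F g : (forall a b, prim a b F g) -> measurable_fun setT f ->
  {ae mu, forall x : R, f x = F x} -> is_weak_deriv setT f g.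
Proof.
move=> pF mf fF; have [lF lg H] := prim_weak pF; split => //.
  by apply: li_ae fF => // a b; exact: prim_intb (pF a b).
move=> phi tphi; rewrite -(H _ tphi); rewrite /Rintegral; congr fine.
have [cphi' _] := test_smooth tphi.
have mphi' : measurable_fun setT (derive1 phi) by exact: continuous_measurable_fun.
apply: ae_eq_integral => //.
- by apply/measurable_EFinP; exact: measurable_funM.
- apply/measurable_EFinP; apply: measurable_funM => //.
  by have [] := lF.
- by apply: (ae_sub fF) => x /= -> _.
Qed.

Lemma wd_restrict Om f g : open Om -> is_weak_deriv setT f g -> is_weak_deriv Om f g.
Proof.
move=> oO [[mf _ lf] [mg _ lg] H]; split.
- by split => // [|K KO]; [exact: measurable_funS mf|exact: lf].
- by split => // [|K KO]; [exact: measurable_funS mg|exact: lg].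
move=> phi [sm [K [cK KO phi0]]].
have := H phi; rewrite [in X in _ -> X]Rintegral_mkcond [in X in _ -> _ = - X]Rintegral_mkcond.
have -> : (fun x => f x * derive1 phi x) \_ Om = (fun x => f x * derive1 phi x).
  apply: funext => x; rewrite patchE; case: ifPn => // xO.
  rewrite (@derive1_off_support K phi)// ?mulr0// => xK; move: xO; rewrite notin_setE.
  by apply; exact: KO.
have -> : (fun x => g x * phi x) \_ Om = (fun x => g x * phi x).
  apply: funext => x; rewrite patchE; case: ifPn => // xO.
  rewrite phi0 ?mulr0// => xK; move: xO; rewrite notin_setE.
  by apply; exact: KO.
by apply; split => //; exists K.
Qed.

Lemma wderivP Om (f : R -> R[i]) : weakly_derivable Om f -> is_cweak_deriv Om f (wderiv Om f).
Proof. by move=> [g Hg]; apply: (xgetPex _ (ex_intro _ g Hg)). Qed.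

End WeakDeriv2.

(** * Complex [L^2] and [H^1] norms compared with interval norms; curves in [L^2] *)

Section L2conv.
Local Open Scope complex_scope.
Variable R : realType.
Local Notation mu := (@lebesgue_measure R).
Implicit Types (a b : R) (f g : R -> R[i]) (Om : set R).

Lemma Lfun2_sq (h : R -> R) (K : set R) a b : h \_ K \in Lfun mu 2%:E ->
  `[a, b]%classic `<=` K -> sq a b h.
Proof.
move=> hL sub; have h2 := Lfun2_integrable_sqr hL.
move: hL; rewrite inE => /andP[/[!inE]/= mh _].
have E x : a <= x <= b -> (h \_ K) x = h x.
  by move=> xi; rewrite patchE mem_set//; apply: sub; rewrite /= in_itv.
split.
  have : meas a b (h \_ K) by exact: meas_T.
  apply: eq_measurable_fun => x; rewrite inE/= in_itv/=; exact: E.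
have : intb a b (fun x => (h \_ K) x ^+ 2) by apply: integrableS h2.
apply: eq_integrable => // x; rewrite inE/= in_itv/= => xi.
by rewrite /= E.
Qed.

Lemma L2_sq K f a b : L2 K f -> `[a, b]%classic `<=` K -> sq a b (re f) /\ sq a b (im f).
Proof. by move=> [H1 H2] sub; split; [exact: Lfun2_sq H1 sub|exact: Lfun2_sq H2 sub]. Qed.

Lemma L2T_meas f : L2 setT f -> measurable_fun setT (re f) /\ measurable_fun setT (im f).
Proof.
move=> [H1 H2]; split; [move: H1|move: H2];
  by rewrite patch_setT inE => /andP[/[!inE]/= ? _].
Qed.

Lemma L2normE Om f : L2norm Om f =
  ((\int[mu]_(x in Om) (re f x ^+ 2 + im f x ^+ 2)%:E) `^ 2^-1)%E.
Proof.
rewrite /L2norm unlock; congr (_ `^ _)%E; rewrite [RHS]integral_mkcond.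
apply: eq_integral => x _; rewrite !patchE; case: ifP => _; last first.
  by rewrite abse0 poweR0r.
rewrite /= -?EFin_expe; congr EFin; rewrite powR_mulrn; last exact: normr_ge0.
rewrite /re /im; case: (f x) => u v /=.
rewrite ger0_norm ?sqrtr_ge0// sqr_sqrtr// addr_ge0// sqr_ge0//.
Qed.

Lemma sqrt_poweR (x : R) : 0 <= x -> ((x%:E) `^ 2^-1)%E = (Num.sqrt x)%:E.
Proof. by move=> x0; rewrite poweR_EFin -powR12_sqrt. Qed.

Lemma L2norm_le Om f a b x : measurable Om -> Om `<=` `[a, b]%classic ->
  sq a b (re f) -> sq a b (im f) -> 0 <= x ->
  nrm a b (re f) ^+ 2 + nrm a b (im f) ^+ 2 <= x ^+ 2 -> (L2norm Om f <= x%:E)%E.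
Proof.
move=> mO sub [mr r2] [mi i2] x0 H; rewrite L2normE.
have -> : x%:E = ((x ^+ 2)%:E `^ 2^-1)%E by rewrite sqrt_poweR ?sqr_ge0// sqrtr_sqr ger0_norm.
have f0 : forall y, (0 <= (re f y ^+ 2 + im f y ^+ 2)%:E)%E.
  by move=> y; rewrite lee_fin addr_ge0 ?sqr_ge0.
apply: gt0_ler_poweR.
- by rewrite invr_ge0.
- by rewrite in_itv/= leey andbT; apply: integral_ge0.
- by rewrite in_itv/= leey andbT lee_fin sqr_ge0.
apply: (@le_trans _ _ (\int[mu]_(x in `[a, b]) (re f x ^+ 2 + im f x ^+ 2)%:E)%E).
  apply: ge0_subset_integral => //.
  by apply/measurable_EFinP; apply: measurable_funD; exact: measurable_funX.
have i12 := intbD r2 i2.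
have -> : (\int[mu]_(x in `[a, b]) (re f x ^+ 2 + im f x ^+ 2)%:E)%E =
    (itg a b (fun x => re f x ^+ 2 + im f x ^+ 2))%:E.
  by rewrite /itg /Rintegral fineK//; exact: integrable_fin_num.
by rewrite lee_fin itgD// -!nrm_sqr.
Qed.

Lemma nrm_le_L2norm f a b : sq a b (re f) -> sq a b (im f) ->
  measurable_fun setT (re f) -> measurable_fun setT (im f) ->
  ((nrm a b (re f))%:E <= L2norm setT f)%E /\ ((nrm a b (im f))%:E <= L2norm setT f)%E.
Proof.
move=> [_ r2] [_ i2] mr mi; rewrite L2normE.
have f0 : forall y, (0 <= (re f y ^+ 2 + im f y ^+ 2)%:E)%E.
  by move=> y; rewrite lee_fin addr_ge0 ?sqr_ge0.
have i12 := intbD r2 i2.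
have H x : x <= itg a b (fun x => re f x ^+ 2 + im f x ^+ 2) -> 0 <= x ->
  ((Num.sqrt x)%:E <= (\int[mu]_x (re f x ^+ 2 + im f x ^+ 2)%:E) `^ 2^-1)%E.
  move=> Hx x0; rewrite -sqrt_poweR//; apply: gt0_ler_poweR.
  - by rewrite invr_ge0.
  - by rewrite in_itv/= leey andbT.
  - by rewrite in_itv/= leey andbT; apply: integral_ge0.
  apply: (@le_trans _ _ (\int[mu]_(x in `[a, b]) (re f x ^+ 2 + im f x ^+ 2)%:E)%E).
    rewrite (_ : (\int[mu]_(x in `[a, b]) (re f x ^+ 2 + im f x ^+ 2)%:E)%E =
      (itg a b (fun x => re f x ^+ 2 + im f x ^+ 2))%:E) ?lee_fin//.
    by rewrite /itg /Rintegral fineK//; exact: integrable_fin_num.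
  apply: ge0_subset_integral => //.
  by apply/measurable_EFinP; apply: measurable_funD; exact: measurable_funX.
split; (apply: H; last exact: itg_sqr_ge0); apply: itg_le => //; apply: aeonW => x _.
  by rewrite lerDl sqr_ge0.
by rewrite lerDr sqr_ge0.
Qed.

Lemma L2norm_ge0 Om f : (0 <= L2norm Om f)%E.
Proof. by rewrite L2normE poweR_ge0. Qed.

Lemma L2norm_le_H1norm Om f :
  (L2norm Om f <= H1norm Om f)%E /\ (L2norm Om (wderiv Om f) <= H1norm Om f)%E.
Proof.
have H (x y : \bar R) : (0 <= x -> 0 <= y -> x <= (x ^+ 2 + y ^+ 2) `^ 2^-1)%E.
  move=> x0 y0.
  have E : x = ((x ^+ 2) `^ 2^-1)%E.
    case: x x0 => [x|//|//] x0.
      by rewrite -EFin_expe sqrt_poweR ?sqr_ge0// sqrtr_sqr ger0_norm.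
    by rewrite expe2 mulyy poweRyr // invr_eq0 pnatr_eq0.
  have x2 : (0 <= x ^+ 2)%E by exact: mule_ge0.
  have y2 : (0 <= y ^+ 2)%E by exact: mule_ge0.
  rewrite {1}E; apply: gt0_ler_poweR; rewrite ?invr_ge0 ?in_itv/= ?leey ?andbT//.
    exact: adde_ge0.
  exact: leeDl.
by rewrite /H1norm; split; [apply: H|rewrite addeC; apply: H]; exact: L2norm_ge0.
Qed.

Lemma H1norm_le Om f (x y : R) : 0 <= x -> 0 <= y -> (L2norm Om f <= x%:E)%E ->
  (L2norm Om (wderiv Om f) <= y%:E)%E -> (H1norm Om f <= (x + y)%:E)%E.
Proof.
move=> x0 y0 Hx Hy; rewrite /H1norm.
have -> : (x + y)%:E = (((x + y) ^+ 2)%:E `^ 2^-1)%E.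
  by rewrite sqrt_poweR ?sqr_ge0// sqrtr_sqr ger0_norm ?addr_ge0.
have sqle (u : \bar R) (v : R) : (0 <= u -> u <= v%:E -> u ^+ 2 <= (v ^+ 2)%:E)%E.
  move=> u0 uv; case: u u0 uv => [u|//|//]; rewrite !lee_fin => u0 uv.
  by rewrite ler_sqr ?nnegrE// (le_trans u0 uv).
apply: gt0_ler_poweR; rewrite ?invr_ge0 ?in_itv/= ?leey ?andbT//.
- by apply: adde_ge0; apply: mule_ge0; exact: L2norm_ge0.
- by rewrite lee_fin sqr_ge0.
apply: (@le_trans _ _ ((x ^+ 2)%:E + (y ^+ 2)%:E)%E).
  by apply: leeD; apply: sqle => //; exact: L2norm_ge0.
by rewrite -EFinD lee_fin; nra.
Qed.

(** Differentiability of a curve with values in [L^2] of the interval. Only nonnegative [s] are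
    compared, so the derivative at time zero is one-sided. *)
Definition L2d a b (f f' : R -> R -> R) : Prop := forall t, 0 <= t -> forall e, 0 < e ->
  exists2 d, 0 < d & forall s, 0 <= s -> `|s - t| < d ->
    nrm a b (fun x => f s x - f t x - (s - t) * f' t x) <= e * `|s - t|.

Definition L2c a b (f : R -> R -> R) : Prop := forall t, 0 <= t -> forall e, 0 < e ->
  exists2 d, 0 < d & forall s, 0 <= s -> `|s - t| < d ->
    nrm a b (fun x => f s x - f t x) <= e.

Lemma cvg0_eps (G : R -> \bar R) (t : R) : 0 <= t -> (forall s, (0 <= G s)%E) ->
  (G s @[s --> within `[0, +oo[ (nbhs t)] --> 0%E) ->
  forall e, 0 < e -> exists2 d, 0 < d & forall s, 0 <= s -> `|s - t| < d -> (G s <= e%:E)%E.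
Proof.
move=> t0 G0 H e e0.
have V : nbhs (0%E : \bar R) [set x | (x < e%:E)%E].
  by apply: open_nbhs_nbhs; split; [exact: open_ereal_lt_ereal|rewrite /= lte_fin].
have [d /= d0 dP] := H _ V.
exists d => // s s0 sd; apply/ltW; apply: dP => //=; last by rewrite in_itv/= s0.
by rewrite distrC.
Qed.

Lemma cvg0_eps' (G : R -> \bar R) (t : R) : 0 <= t -> (forall s, (0 <= G s)%E) ->
  (G s @[s --> within `[0, +oo[ (nbhs t^')] --> 0%E) ->
  forall e, 0 < e -> exists2 d, 0 < d & forall s, 0 <= s -> s != t -> `|s - t| < d -> (G s <= e%:E)%E.
Proof.
move=> t0 G0 H e e0.
have V : nbhs (0%E : \bar R) [set x | (x < e%:E)%E].
  by apply: open_nbhs_nbhs; split; [exact: open_ereal_lt_ereal|rewrite /= lte_fin].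
have [d /= d0 dP] := H _ V.
exists d => // s s0 st sd; apply/ltW; apply: dP => //=; last by rewrite in_itv/= s0.
by rewrite distrC.
Qed.

End L2conv.

(** * Calculus in time *)

Section TimeCalculus.
Variable R : realType.
Implicit Types (a b t s : R) (phi psi : R -> R) (f g : R -> R -> R).

(* Differentiability on the closed half-line: one-sided at 0. *)
Definition rd phi phi' : Prop := forall t, 0 <= t -> forall e, 0 < e ->
  exists2 d, 0 < d & forall s, 0 <= s -> `|s - t| < d ->
    `|phi s - phi t - (s - t) * phi' t| <= e * `|s - t|.

Lemma rd_ext phi psi phi' psi' : (forall t, 0 <= t -> phi t = psi t) ->
  (forall t, 0 <= t -> phi' t = psi' t) -> rd phi phi' -> rd psi psi'.
Proof.
move=> E E' H t t0 e e0; have [d d0 dP] := H t t0 e e0; exists d => // s s0 sd.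
by rewrite -!E// -E'//; exact: dP.
Qed.

Lemma rdD phi psi phi' psi' : rd phi phi' -> rd psi psi' ->
  rd (fun t => phi t + psi t) (fun t => phi' t + psi' t).
Proof.
move=> H1 H2 t t0 e e0; have e20 : 0 < e / 2 by rewrite divr_gt0.
have [d1 d10 d1P] := H1 t t0 _ e20; have [d2 d20 d2P] := H2 t t0 _ e20.
exists (Num.min d1 d2); first by rewrite lt_min d10.
move=> s s0; rewrite lt_min => /andP[sd1 sd2].
have := d1P s s0 sd1; have := d2P s s0 sd2 => A1 A2.
have -> : phi s + psi s - (phi t + psi t) - (s - t) * (phi' t + psi' t) =
  (phi s - phi t - (s - t) * phi' t) + (psi s - psi t - (s - t) * psi' t) by ring.
apply: le_trans (ler_normD _ _) _.
rewrite [leRHS](_ : _ = e / 2 * `|s - t| + e / 2 * `|s - t|); last by field.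
exact: lerD.
Qed.

Lemma rdZ phi phi' k : rd phi phi' -> rd (fun t => k * phi t) (fun t => k * phi' t).
Proof.
move=> H t t0 e e0; have e20 : 0 < e / (`|k| + 1) by rewrite divr_gt0// ltr_wpDl.
have [d d0 dP] := H t t0 _ e20; exists d => // s s0 sd.
rewrite -!mulrBr (mulrCA _ k) -mulrBr normrM.
apply: le_trans (ler_wpM2l (normr_ge0 _) (dP s s0 sd)) _.
rewrite mulrA ler_wpM2r// mulrCA ler_piMr ?ltW//.
by rewrite ltr_pdivrMr ?mul1r ?ltrDl// ltr_wpDl.
Qed.

Lemma rd_cont phi phi' t : rd phi phi' -> 0 <= t -> forall e, 0 < e ->
  exists2 d, 0 < d & forall s, 0 <= s -> `|s - t| < d -> `|phi s - phi t| <= e.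
Proof.
move=> H t0 e e0; have [d d0 dP] := H t t0 1 ltr01.
have K0 : 0 < `|phi' t| + 1 by rewrite ltr_wpDl.
exists (Num.min d (e / (`|phi' t| + 1))); first by rewrite lt_min d0 divr_gt0.
move=> s s0; rewrite lt_min => /andP[/(dP s s0) H1 H2].
have -> : phi s - phi t = (phi s - phi t - (s - t) * phi' t) + (s - t) * phi' t by ring.
apply: le_trans (ler_normD _ _) _; rewrite normrM.
move: H2; rewrite ltr_pdivlMr// => H2.
move: H1 H2; rewrite mul1r mulrDr mulr1 => H1 H2; lra.
Qed.

Lemma rd_derive phi phi' t : rd phi phi' -> 0 < t -> is_derive t 1 phi (phi' t).
Proof.
move=> H t0; apply/is_derive_eps => e e0; have [d d0 dP] := H t (ltW t0) e e0.
exists (Num.min d t); first by rewrite lt_min d0.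
move=> s; rewrite lt_min => /andP[sd st]; apply: dP => //.
move: st; rewrite ltr_norml => /andP[st _]; lra.
Qed.

Lemma rd_le phi phi' T : 0 <= T -> rd phi phi' ->
  (forall t, 0 < t -> t < T -> phi' t <= 0) -> phi T <= phi 0.
Proof.
move=> T0 H le0; have cont : {within `[0, T], continuous phi}.
  apply/subspace_continuousP => t; rewrite /= in_itv/= => /andP[t0 tT].
  apply/cvgrPdist_le => e e0; have [d d0 dP] := rd_cont H t0 e0.
  exists d => //= s /= sd; rewrite in_itv/= => /andP[s0 _]; rewrite distrC.
  by apply: dP => //; rewrite distrC.
have dphi t : t \in `]0, T[ -> derivable phi t 1.
  by rewrite in_itv/= => /andP[t0 _]; have [] := rd_derive H t0.
have phi'0 t : t \in `]0, T[ -> (phi^`() t <= 0)%classic.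
  rewrite in_itv/= => /andP[t0 tT]; rewrite derive1E.
  by have [_ ->] := rd_derive H t0; exact: le0.
have := @ler0_derive1_le_cc R phi 0 T dphi phi'0 cont T 0.
by apply; rewrite ?in_itv/= ?lexx ?T0.
Qed.

Lemma rdM phi psi phi' psi' : rd phi phi' -> rd psi psi' ->
  rd (fun t => phi t * psi t) (fun t => phi' t * psi t + phi t * psi' t).
Proof.
move=> H1 H2 t t0 e e0.
pose K := `|phi t| + `|psi t| + `|psi' t| + 1.
have K0 : 0 < K by rewrite /K ltr_wpDl// !addr_ge0.
pose e1 := Num.min 1 (e / (2 * K)).
have e10 : 0 < e1 by rewrite lt_min ltr01 divr_gt0// mulr_gt0.
have e1K : e1 * K <= e / 2.
  have : e1 <= e / (2 * K) by rewrite ge_min lexx orbT.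
  by rewrite -(ler_pM2r K0) => /le_trans; apply; rewrite le_eqVlt; apply/orP; left;
    apply/eqP; field; rewrite gt_eqF.
have [d1 d10 d1P] := H1 t t0 _ e10; have [d2 d20 d2P] := H2 t t0 _ e10.
have e2 : 0 < e / (2 * K) by rewrite divr_gt0// mulr_gt0.
have [d3 d30 d3P] := rd_cont H1 t0 e2.
exists (Num.min (Num.min d1 d2) d3); first by rewrite !lt_min d10 d20.
move=> s s0; rewrite !lt_min => /andP[/andP[sd1 sd2] sd3].
have := d1P s s0 sd1; have := d2P s s0 sd2; have := d3P s s0 sd3.
set r1 := phi s - phi t - _; set r2 := psi s - psi t - _ => A3 A2 A1.
have -> : phi s * psi s - phi t * psi t - (s - t) * (phi' t * psi t + phi t * psi' t) =
   r1 * psi t + phi t * r2 + (phi s - phi t) * (r2 + (s - t) * psi' t).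
  by rewrite /r1 /r2; ring.
set D := phi s - phi t in A3 *; set h := `|s - t| in A1 A2 *.
have h0 : 0 <= h by exact: normr_ge0.
have B1 : `|r1 * psi t| <= e1 * h * `|psi t| by rewrite normrM ler_wpM2r.
have B2 : `|phi t * r2| <= `|phi t| * (e1 * h) by rewrite normrM ler_wpM2l.
have e11 : e1 <= 1 by rewrite ge_min lexx.
have B3 : `|D * (r2 + (s - t) * psi' t)| <= e / (2 * K) * (h * (1 + `|psi' t|)).
  rewrite normrM; apply: ler_pM => //; apply: le_trans (ler_normD _ _) _.
  rewrite normrM -/h mulrDr mulr1 lerD2r (le_trans A2)// ler_piMl//.
have B3' : e / (2 * K) * (h * (1 + `|psi' t|)) <= e / 2 * h.
  have -> : e / (2 * K) * (h * (1 + `|psi' t|)) = e / 2 * h * ((1 + `|psi' t|) / K).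
    by field; rewrite gt_eqF.
  rewrite ler_piMr// ?mulr_ge0 ?divr_ge0 ?(ltW e0)//.
  rewrite ler_pdivrMr// mul1r /K.
  by have := normr_ge0 (phi t); have := normr_ge0 (psi t); lra.
have B12 : e1 * h * `|psi t| + `|phi t| * (e1 * h) <= e / 2 * h.
  have -> : e1 * h * `|psi t| + `|phi t| * (e1 * h) = e1 * (`|psi t| + `|phi t|) * h by ring.
  rewrite ler_wpM2r// (le_trans _ e1K)// ler_wpM2l ?(ltW e10)// /K.
  by have := normr_ge0 (psi' t); lra.
apply: le_trans (ler_normD _ _) _; apply: le_trans (lerD (ler_normD _ _) (lexx _)) _.
have -> : e * h = e / 2 * h + e / 2 * h by field.
lra.
Qed.

Lemma rd_exp k : rd (fun t => expR (k * t)) (fun t => k * expR (k * t)).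
Proof.
move=> t t0 e e0.
have : is_derive t 1 (fun t => expR (k * t)) (k * expR (k * t)).
  have dk : is_derive t 1 (fun t => k * t) (k *: 1) by exact: is_deriveZ.
  have := @is_derive1_comp R _ _ _ _ _ (is_derive_expR (k * t)) dk.
  by rewrite /GRing.scale/= mulr1 mulrC.
move=> /is_derive_eps/(_ e e0)[d d0 dP]; exists d => // s _; exact: dP.
Qed.

(** The product [expR (k * t) * phi t] is nonincreasing. *)
Lemma gronwall phi phi' k T : 0 <= T -> rd phi phi' ->
  (forall t, 0 < t -> t < T -> phi' t + k * phi t <= 0) ->
  phi T <= expR (- (k * T)) * phi 0.
Proof.
move=> T0 H le0; have H1 := rdM (rd_exp k) H.
have := rd_le T0 H1; rewrite mulr0 expR0 mul1r => H2.
have H3 : expR (k * T) * phi T <= phi 0.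
  apply: H2 => t t0 tT.
  have -> : k * expR (k * t) * phi t + expR (k * t) * phi' t =
     expR (k * t) * (phi' t + k * phi t) by ring.
  by rewrite pmulr_rle0 ?expR_gt0// le0.
by rewrite expRN mulrC ler_pdivlMr ?expR_gt0// mulrC.
Qed.

Lemma L2d_cont a b f f' t : (forall t, 0 <= t -> sq a b (f t)) ->
  (forall t, 0 <= t -> sq a b (f' t)) -> L2d a b f f' -> 0 <= t ->
  exists2 d, 0 < d & forall s, 0 <= s -> `|s - t| < d ->
    nrm a b (fun x => f s x - f t x) <= (nrm a b (f' t) + 1) * `|s - t|.
Proof.
move=> sf sf' H t0; have [d d0 dP] := H t t0 1 ltr01.
exists d => // s s0 sd; have := dP s s0 sd; rewrite mul1r => H1.
rewrite (@nrm_ext _ a b _ (fun x => (f s x - f t x - (s - t) * f' t x) + (s - t) * f' t x));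
  last by move=> x _; rewrite subrK.
have s1 : sq a b (fun x => (s - t) * f' t x) by apply: sqZ; exact: sf'.
have s2 : sq a b (fun x => f s x - f t x - (s - t) * f' t x).
  by apply: sqB => //; apply: sqB; exact: sf.
apply: le_trans (nrmD s2 s1) _; rewrite nrmZ; last exact: sf'.
by rewrite mulrDl mul1r addrC lerD// mulrC.
Qed.

(** The product rule for the inner product. The difference splits into two first-order errors tested
    against fixed functions and a product of increments, which Cauchy-Schwarz makes quadratic in
    [s - t]. No derivative in [t] at fixed [x] is involved. *)
Lemma L2d_rd a b f f' g g' :
  (forall t, 0 <= t -> sq a b (f t)) -> (forall t, 0 <= t -> sq a b (f' t)) ->
  (forall t, 0 <= t -> sq a b (g t)) -> (forall t, 0 <= t -> sq a b (g' t)) ->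
  L2d a b f f' -> L2d a b g g' ->
  rd (fun t => itg a b (fun x => f t x * g t x))
     (fun t => itg a b (fun x => f' t x * g t x + f t x * g' t x)).
Proof.
move=> sf sf' sg sg' Hf Hg t t0 e e0.
pose K := nrm a b (f t) + nrm a b (g t) + (nrm a b (f' t) + 1) * (nrm a b (g' t) + 1) + 1.
have n0 h : 0 <= nrm a b h by exact: nrm_ge0.
have K1 : 0 <= (nrm a b (f' t) + 1) * (nrm a b (g' t) + 1).
  by rewrite mulr_ge0// addr_ge0.
have K0 : 0 < K.
  by rewrite /K ltr_wpDl// !addr_ge0.
have e1 : 0 < e / K by rewrite divr_gt0.
have [d1 d10 d1P] := Hf t t0 _ e1; have [d2 d20 d2P] := Hg t t0 _ e1.
have [d3 d30 d3P] := L2d_cont sf sf' Hf t0.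
have [d4 d40 d4P] := L2d_cont sg sg' Hg t0.
exists (Num.min (Num.min d1 d2) (Num.min (Num.min d3 d4) (e / K))).
  by rewrite !lt_min d10 d20 d30 d40.
move=> s s0; rewrite !lt_min => /andP[/andP[sd1 sd2] /andP[/andP[sd3 sd4] sd5]].
have := d1P s s0 sd1; have := d2P s s0 sd2; have := d3P s s0 sd3; have := d4P s s0 sd4.
set h := `|s - t|; have h0 : 0 <= h by exact: normr_ge0.
move=> A4 A3 A2 A1.
have [Sf Sf' Sg Sg'] : [/\ sq a b (f t), sq a b (f' t), sq a b (g t) & sq a b (g' t)].
  by split; [exact: sf|exact: sf'|exact: sg|exact: sg'].
have s1 : sq a b (fun x => f s x - f t x) by apply: sqB => //; exact: sf.
have s2 : sq a b (fun x => g s x - g t x) by apply: sqB => //; exact: sg.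
have s3 : sq a b (fun x => f s x - f t x - (s - t) * f' t x).
  by apply: sqB => //; exact: sqZ.
have s4 : sq a b (fun x => g s x - g t x - (s - t) * g' t x).
  by apply: sqB => //; exact: sqZ.
have i1 := sqM s3 Sg; have i2 := sqM Sf s4; have i3 := sqM s1 s2.
have -> : itg a b (fun x => f s x * g s x) - itg a b (fun x => f t x * g t x) -
    (s - t) * itg a b (fun x => f' t x * g t x + f t x * g' t x) =
  itg a b (fun x => (f s x - f t x - (s - t) * f' t x) * g t x) +
  itg a b (fun x => f t x * (g s x - g t x - (s - t) * g' t x)) +
  itg a b (fun x => (f s x - f t x) * (g s x - g t x)).
  have j1 := sqM (sf s s0) (sg s s0); have j2 := sqM Sf Sg.
  have j3 := intbD (sqM Sf' Sg) (sqM Sf Sg').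
  rewrite -(itgZ (s - t) j3) -itgB// -itgB//; last exact: intbZ.
    by rewrite -itgD// -itgD//; [apply: itg_ext => x _; ring|exact: intbD].
  exact: intbB.
apply: le_trans (ler_normD _ _) _; apply: le_trans (lerD (ler_normD _ _) (lexx _)) _.
have B1 := le_trans (itg_CS s3 Sg) (ler_wpM2r (n0 _) A1).
have B2 := le_trans (itg_CS Sf s4) (ler_wpM2l (n0 _) A2).
have B3 := le_trans (itg_CS s1 s2) (ler_pM (n0 _) (n0 _) A3 A4).
apply: le_trans (lerD (lerD B1 B2) B3) _.
have hK : h <= e / K by exact: ltW.
have B3' : (nrm a b (f' t) + 1) * h * ((nrm a b (g' t) + 1) * h) <=
    (nrm a b (f' t) + 1) * (nrm a b (g' t) + 1) * (e / K) * h.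
  rewrite [leLHS](_ : _ = (nrm a b (f' t) + 1) * (nrm a b (g' t) + 1) * h * h); last by ring.
  by rewrite ler_wpM2r// ler_wpM2l.
apply: le_trans (lerD (lexx _) B3') _.
have -> : e / K * h * nrm a b (g t) + nrm a b (f t) * (e / K * h) +
  (nrm a b (f' t) + 1) * (nrm a b (g' t) + 1) * (e / K) * h = (K - 1) * (e / K * h).
  by rewrite /K; ring.
have -> : e * h = K * (e / K * h) by field; rewrite gt_eqF.
apply: ler_wpM2r; first by rewrite mulr_ge0 ?(ltW e1).
by rewrite lerBlDr lerDl.
Qed.

Lemma L2d_bM a b f f' m k : meas a b m -> aeon a b (fun x => `|m x| <= k) -> 0 <= k ->
  (forall t, 0 <= t -> sq a b (f t)) -> (forall t, 0 <= t -> sq a b (f' t)) ->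
  L2d a b f f' -> L2d a b (fun t x => m x * f t x) (fun t x => m x * f' t x).
Proof.
move=> mm mk k0 sf sf' H t t0 e e0.
have e20 : 0 < e / (k + 1) by rewrite divr_gt0// ltr_wpDl.
have [d d0 dP] := H t t0 _ e20; exists d => // s s0 sd.
rewrite (@nrm_ext _ a b _ (fun x => m x * (f s x - f t x - (s - t) * f' t x))); last first.
  by move=> x _; ring.
have s2 : sq a b (fun x => f s x - f t x - (s - t) * f' t x).
  by apply: sqB; [apply: sqB; exact: sf|apply: sqZ; exact: sf'].
apply: le_trans (nrm_bM k0 mm mk s2) _.
apply: le_trans (ler_wpM2l k0 (dP s s0 sd)) _.
rewrite mulrA ler_wpM2r// mulrCA ler_piMr ?ltW//.
by rewrite ltr_pdivrMr ?mul1r ?ltrDl// ltr_wpDl.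
Qed.

Lemma L2dD a b f f' g g' :
  (forall t, 0 <= t -> sq a b (f t)) -> (forall t, 0 <= t -> sq a b (f' t)) ->
  (forall t, 0 <= t -> sq a b (g t)) -> (forall t, 0 <= t -> sq a b (g' t)) ->
  L2d a b f f' -> L2d a b g g' ->
  L2d a b (fun t x => f t x + g t x) (fun t x => f' t x + g' t x).
Proof.
move=> sf sf' sg sg' H1 H2 t t0 e e0; have e20 : 0 < e / 2 by rewrite divr_gt0.
have [d1 d10 d1P] := H1 t t0 _ e20; have [d2 d20 d2P] := H2 t t0 _ e20.
exists (Num.min d1 d2); first by rewrite lt_min d10.
move=> s s0; rewrite lt_min => /andP[sd1 sd2].
have := d1P s s0 sd1; have := d2P s s0 sd2 => A1 A2.
rewrite (@nrm_ext _ a b _ (fun x => (f s x - f t x - (s - t) * f' t x) +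
   (g s x - g t x - (s - t) * g' t x))); last by move=> x _; ring.
apply: le_trans (nrmD _ _) _.
- by apply: sqB; [apply: sqB; exact: sf|apply: sqZ; exact: sf'].
- by apply: sqB; [apply: sqB; exact: sg|apply: sqZ; exact: sg'].
rewrite [leRHS](_ : _ = e / 2 * `|s - t| + e / 2 * `|s - t|); last by field.
exact: lerD.
Qed.

Lemma L2d_rdM a b (th th' f : R -> R) : sq a b f -> rd th th' ->
  L2d a b (fun t x => th t * f x) (fun t x => th' t * f x).
Proof.
move=> sf H t t0 e e0.
have n0 : 0 <= nrm a b f by exact: nrm_ge0.
have e20 : 0 < e / (nrm a b f + 1) by rewrite divr_gt0// ltr_wpDl.
have [d d0 dP] := H t t0 _ e20; exists d => // s s0 sd.
rewrite (@nrm_ext _ a b _ (fun x => (th s - th t - (s - t) * th' t) * f x)); last first.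
  by move=> x _; ring.
rewrite nrmZ//; apply: le_trans (ler_wpM2r n0 (dP s s0 sd)) _.
rewrite mulrAC ler_wpM2r// -mulrA ler_piMr ?ltW// mulrC.
by rewrite ltr_pdivrMr ?mul1r ?ltrDl// ltr_wpDl.
Qed.

Lemma L2d_cst a b (f : R -> R) : L2d a b (fun t x => f x) (fun t x => 0).
Proof.
move=> t t0 e e0; exists 1 => // s _ _.
rewrite (@nrm_ext _ a b _ (fun=> 0)); last by move=> x _; ring.
by rewrite /nrm /itg /Rintegral; under eq_integral do rewrite expr0n/=;
  rewrite integral0/= sqrtr0 mulr_ge0// ltW.
Qed.

Lemma L2d_eq a b (f f' g g' : R -> R -> R) : (forall t x, f t x = g t x) ->
  (forall t x, f' t x = g' t x) -> L2d a b f f' -> L2d a b g g'.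
Proof.
move=> fg fg'.
have -> : g = f by apply: funext => t; apply: funext => x.
by have -> : g' = f' by apply: funext => t; apply: funext => x.
Qed.

Lemma L2dS a b c d f f' : a <= c -> d <= b ->
  (forall t, 0 <= t -> sq a b (f t)) -> (forall t, 0 <= t -> sq a b (f' t)) ->
  L2d a b f f' -> L2d c d f f'.
Proof.
move=> ac db sf sf' H t t0 e e0; have [r r0 rP] := H t t0 _ e0.
exists r => // s s0 sr; apply: le_trans (rP s s0 sr); apply: nrmS => //.
by apply: sqB; [apply: sqB; exact: sf|apply: sqZ; exact: sf'].
Qed.

Lemma L2d_ext a b f f' g g' : (forall t, 0 <= t -> aeon a b (fun x => f t x = g t x)) ->
  (forall t, 0 <= t -> aeon a b (fun x => f' t x = g' t x)) ->
  (forall t, 0 <= t -> sq a b (f t)) -> (forall t, 0 <= t -> sq a b (f' t)) ->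
  (forall t, 0 <= t -> meas a b (g t)) -> (forall t, 0 <= t -> meas a b (g' t)) ->
  L2d a b f f' -> L2d a b g g'.
Proof.
move=> fg fg' sf sf' mg mg' H t t0 e e0; have [r r0 rP] := H t t0 _ e0.
exists r => // s s0 sr.
rewrite (@nrm_ae _ a b _ (fun x => f s x - f t x - (s - t) * f' t x)).
- exact: rP.
- by apply: measB; [apply: measB; exact: mg|apply: measZ; exact: mg'].
- apply: measB; [apply: measB; exact: (sf _ _).1|apply: measZ; exact: (sf' _ _).1].
- have := aeon2 (S := fun x => f s x - f t x = g s x - g t x) _ (fg s s0) (fg t t0).
  move=> /(_ _)/aeon2 H1; apply: (H1 _ _ _ _ (fg' t t0)) => [x _ -> ->//|x _ -> ->//].
Qed.

End TimeCalculus.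

(** * Weighted energies *)

Section Lyapunov.
Variable R : realType.
Implicit Types (a b t : R) (al be : R -> R) (Y Z Yt Zt : R -> R -> R).

(** The lower bounds hold everywhere, so division by [al] is always meaningful; the upper bounds
    come from an essential supremum and hold only almost everywhere. *)
Definition coefs a b al be m M : Prop :=
  [/\ meas a b al, meas a b be, 0 < m, (forall x, m <= al x) /\
      (forall x, m <= be x) & aeon a b (fun x => al x <= M /\ be x <= M)].

Lemma meas_inv a b al m : 0 < m -> (forall x, m <= al x) -> meas a b al ->
  meas a b (fun x => (al x)^-1).
Proof.
move=> m0 alm mal.
have -> : (fun x => (al x)^-1) = (@powR R ^~ (-1)) \o al.
  by apply: funext => x /=; rewrite powR_inv1// (le_trans (ltW m0)).
by apply: (measurableT_comp (measurable_powR _)).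
Qed.

Lemma coefsS a b c d al be m M : a <= c -> d <= b -> coefs a b al be m M ->
  coefs c d al be m M.
Proof.
move=> ac db [mal mbe m0 [alm bem] H].
by split => //; [exact: measS mal|exact: measS mbe|exact: aeonS H].
Qed.

(* First-order form of the wave equation: Y_t = Yt, Z_t = Zt, Y_x = Zt / al and Z_x = be Yt. *)
Definition pot_sol a b al be Y Z Yt Zt : Prop :=
  [/\ (forall t, 0 <= t -> prim a b (Y t) (fun x => (al x)^-1 * Zt t x)),
      (forall t, 0 <= t -> prim a b (Z t) (fun x => be x * Yt t x)),
      (forall t, 0 <= t -> sq a b (Yt t)) /\ (forall t, 0 <= t -> sq a b (Zt t)),
      L2d a b Y Yt & L2d a b Z Zt].

Lemma pot_solS a b c d al be Y Z Yt Zt : a <= c -> d <= b ->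
  pot_sol a b al be Y Z Yt Zt -> pot_sol c d al be Y Z Yt Zt.
Proof.
move=> ac db [pY pZ [sYt sZt] dY dZ].
have sY t : 0 <= t -> sq a b (Y t) by move=> /pY/prim_sq.
have sZ t : 0 <= t -> sq a b (Z t) by move=> /pZ/prim_sq.
split.
- by move=> t t0; apply: primS (pY t t0).
- by move=> t t0; apply: primS (pZ t t0).
- by split=> t t0; [apply: sqS (sYt t t0)|apply: sqS (sZt t t0)].
- exact: L2dS dY.
- exact: L2dS dZ.
Qed.

(* The time derivative of the integral of [lyap] is the increment of [lflux] minus the
   integral of the quadratic form in [2 n' y z + mu' z^2 + (mu q)' y^2], q = al be. *)
Definition lyap al be (n mu : R -> R) (y z : R -> R) x : R :=
  n x * be x * y x * y x + n x * (al x)^-1 * z x * z x + 2 * mu x * be x * y x * z x.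

Definition lflux (n mu q : R -> R) (y z : R -> R) x : R :=
  2 * (n x * (y x * z x)) + mu x * (z x * z x) + mu x * q x * (y x * y x).

Lemma prim_bd a b f f' : prim a b f f' -> a <= b ->
  exists2 K, 0 < K & forall x, a <= x <= b -> `|f x| <= K.
Proof.
move=> pf ab; exists (`|f a| + itg a b (fun y => `|f' y|) + 1).
  rewrite ltr_wpDl// addr_ge0// itg_ge0//; [exact/intb_abs/pf.1|exact: aeonW].
by move=> x xi; rewrite (le_trans (prim_bdd pf xi))// lerDl.
Qed.

Section Weights.
Variables (a b : R) (al be : R -> R) (m M : R) (n n' mu mu' : R -> R).
Hypothesis ab : a <= b.
Hypothesis Hc : coefs a b al be m M.
Hypothesis pn : prim a b n n'.
Hypothesis pmu : prim a b mu mu'.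

Lemma wbd : exists K, [/\ 0 <= K,
  meas a b (fun x => n x * be x) /\ aeon a b (fun x => `|n x * be x| <= K),
  meas a b (fun x => n x * (al x)^-1) /\ aeon a b (fun x => `|n x * (al x)^-1| <= K) &
  meas a b (fun x => 2 * mu x * be x) /\ aeon a b (fun x => `|2 * mu x * be x| <= K)].
Proof.
have [mal mbe m0 [alm bem] H] := Hc.
have [Kn Kn0 KnP] := prim_bd pn ab; have [Km Km0 KmP] := prim_bd pmu ab.
exists (Kn * `|M| + Kn * m^-1 + 2 * Km * `|M|).
have mi0 : 0 < m^-1 by rewrite invr_gt0.
have H1 : 0 <= Kn * `|M| by rewrite mulr_ge0// ltW.
have H2 : 0 <= Kn * m^-1 by rewrite mulr_ge0// ltW.
have H3 : 0 <= 2 * Km * `|M| by rewrite !mulr_ge0// ltW.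
have beM x : be x <= M -> `|be x| <= `|M|.
  move=> bM; have b0 : 0 <= be x by rewrite (le_trans (ltW m0)).
  by rewrite (ger0_norm b0) (le_trans bM)// ler_norm.
split; first lra.
- split; first by apply: measM => //; exact: prim_meas pn.
  apply: aeon1 H => x xi [_ bM]; rewrite normrM.
  by have := ler_pM (normr_ge0 _) (normr_ge0 _) (KnP x xi) (beM x bM); lra.
- split; first by apply: measM; [exact: prim_meas pn|exact: (meas_inv m0 alm mal)].
  apply: aeon1 H => x xi [_ bM]; rewrite normrM.
  have al0 : 0 < al x by rewrite (lt_le_trans m0).
  have ai : `|(al x)^-1| <= m^-1 by rewrite ger0_norm ?invr_ge0 ?(ltW al0)// lef_pV2.
  by have := ler_pM (normr_ge0 _) (normr_ge0 _) (KnP x xi) ai; lra.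
- split; first by apply: measM => //; apply: measZ; exact: prim_meas pmu.
  apply: aeon1 H => x xi [_ bM]; rewrite !normrM ger0_norm//.
  have := ler_pM (normr_ge0 _) (normr_ge0 _) (KmP x xi) (beM x bM).
  rewrite -!mulrA => ?; lra.
Qed.

Lemma lyap_intb y z : sq a b y -> sq a b z -> intb a b (lyap al be n mu y z).
Proof.
move=> sy sz; have [K [K0 [m1 b1] [m2 b2] [m3 b3]]] := wbd.
apply: intbD; first apply: intbD.
- exact: sqM (sq_bM m1 b1 sy) sy.
- exact: sqM (sq_bM m2 b2 sz) sz.
- exact: sqM (sq_bM m3 b3 sy) sz.
Qed.

Variables (q q' : R -> R) (k : R).
Hypothesis pq : prim a b q q'.
Hypothesis qE : aeon a b (fun x => q x = al x * be x).
Hypothesis Hform : aeon a b (fun x => forall y z,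
  k * (n x * be x * y * y + n x * (al x)^-1 * z * z + 2 * mu x * be x * y * z) <=
  2 * n' x * y * z + mu' x * z * z + (mu' x * q x + mu x * q' x) * y * y).

(** After [be * Yt] and [(al)^-1 * Zt] are read as [Z_x] and [Y_x], the time derivative of the
    density is the derivative of [lflux] minus the quadratic form of [Hform]. Only [Y], [Z], the
    weights and [q] are differentiated in [x]; [q] stands for the product of the coefficients
    because it has to be absolutely continuous. *)
Lemma segment_energy Y Z Yt Zt : pot_sol a b al be Y Z Yt Zt ->
  exists2 Q' : R -> R, rd (fun t => itg a b (lyap al be n mu (Y t) (Z t))) Q' &
   forall t, 0 <= t -> Q' t + k * itg a b (lyap al be n mu (Y t) (Z t)) <=
     lflux n mu q (Y t) (Z t) b - lflux n mu q (Y t) (Z t) a.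
Proof.
move=> [pY pZ [sYt sZt] dY dZ].
have [mal mbe m0 [alm bem] _] := Hc.
have sY t : 0 <= t -> sq a b (Y t) by move=> /pY/prim_sq.
have sZ t : 0 <= t -> sq a b (Z t) by move=> /pZ/prim_sq.
have [K [K0 [m1 b1] [m2 b2] [m3 b3]]] := wbd.
have bs g (f : R -> R -> R) : meas a b g -> aeon a b (fun x => `|g x| <= K) ->
  (forall t, 0 <= t -> sq a b (f t)) -> forall t, 0 <= t -> sq a b (fun x => g x * f t x).
  by move=> mg bg sf t t0; apply: sq_bM bg (sf t t0).
have r1 := L2d_rd (bs _ _ m1 b1 sY) (bs _ _ m1 b1 sYt) sY sYt (L2d_bM m1 b1 K0 sY sYt dY) dY.
have r2 := L2d_rd (bs _ _ m2 b2 sZ) (bs _ _ m2 b2 sZt) sZ sZt (L2d_bM m2 b2 K0 sZ sZt dZ) dZ.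
have r3 := L2d_rd (bs _ _ m3 b3 sY) (bs _ _ m3 b3 sYt) sZ sZt (L2d_bM m3 b3 K0 sY sYt dY) dZ.
pose I1 t x := n x * be x * Yt t x * Y t x + n x * be x * Y t x * Yt t x.
pose I2 t x := n x * (al x)^-1 * Zt t x * Z t x + n x * (al x)^-1 * Z t x * Zt t x.
pose I3 t x := 2 * mu x * be x * Yt t x * Z t x + 2 * mu x * be x * Y t x * Zt t x.
have i1 t : 0 <= t -> intb a b (I1 t).
  by move=> t0; apply: intbD; apply: sqM; auto.
have i2 t : 0 <= t -> intb a b (I2 t).
  by move=> t0; apply: intbD; apply: sqM; auto.
have i3 t : 0 <= t -> intb a b (I3 t).
  by move=> t0; apply: intbD; apply: sqM; auto.
exists (fun t => itg a b (I1 t) + itg a b (I2 t) + itg a b (I3 t)).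
  apply: rd_ext (rdD (rdD r1 r2) r3) => // t t0.
  rewrite -itgD; [|by apply: sqM; auto|by apply: sqM; auto].
  rewrite -itgD//; last by apply: sqM; auto.
  by apply: intbD; apply: sqM; auto.
move=> t t0; have li := lyap_intb (sY t t0) (sZ t t0).
have pYZ := primM (pY t t0) (pZ t t0).
have pYY := primM (pY t t0) (pY t t0); have pZZ := primM (pZ t t0) (pZ t t0).
have pF := primD (primD (primZ 2 (primM pn pYZ)) (primM pmu pZZ)) (primM (primM pmu pq) pYY).
have {pF} := (primB pF (lexx a) ab (lexx b)); rewrite -/(lflux n mu q (Y t) (Z t) _) => ->.
have i12 := intbD (i1 t t0) (i2 t t0).
rewrite -itgZ// -itgD//; [|exact: i1|exact: i2].
rewrite -itgD//; last exact: i3.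
rewrite -itgD//; [|by apply: intbD => //; exact: i3|exact: intbZ].
apply: itg_le.
- by apply: intbD; [apply: intbD => //; exact: i3|exact: intbZ].
- have := primD (primD (primZ 2 (primM pn pYZ)) (primM pmu pZZ)) (primM (primM pmu pq) pYY).
  by move=> [].
apply: aeon2 qE Hform => x _ qx /(_ (Y t x) (Z t x)) H.
rewrite /I1 /I2 /I3 /lyap -lerBrDl; apply: le_trans H _.
rewrite le_eqVlt; apply/orP; left; apply/eqP; rewrite qx.
have alN0 : al x != 0 by rewrite gt_eqF// (lt_le_trans m0).
by field.
Qed.

End Weights.

End Lyapunov.

(** * Weights on the core and on the outer pieces *)

Section Weights.
Variable R : realType.
Implicit Types (a b t : R) (al be : R -> R).

Lemma prim_exp a b c k p : prim a b (fun x => c * expR (k * (x - p)))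
  (fun x => c * (k * expR (k * (x - p)))).
Proof.
have ce (j : R) : continuous (fun x : R => expR (j * (x - p))).
  move=> x; apply: continuous_comp; last exact: continuous_expR.
  by apply: cvgM; [exact: cvg_cst|apply: cvgB; [exact: cvg_id|exact: cvg_cst]].
apply: primZ; apply: prim_C1 => [x|]; last first.
  by move=> x; apply: cvgM; [exact: cvg_cst|exact: ce].
have dk : is_derive x 1 (fun y : R => k * (y - p)) (k *: (1 - 0)).
  by apply: is_deriveZ; apply: is_deriveB.
have := @is_derive1_comp R expR (fun y : R => k * (y - p)) x _ _ (is_derive_expR _) dk.
by rewrite /GRing.scale/= subr0 mulr1 mulrC.
Qed.

(* Weights on [a, b] for which the energy decays at rate k, and is equivalent to the
   squared L^2 norm with constants de and D. *)
Definition wseg a b al be k n n' mu mu' q q' (de D : R) : Prop :=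
  [/\ prim a b n n' /\ prim a b mu mu', prim a b q q',
    aeon a b (fun x => q x = al x * be x),
    aeon a b (fun x => forall y z : R,
    k * (n x * be x * y * y + n x * (al x)^-1 * z * z + 2 * mu x * be x * y * z) <=
    2 * n' x * y * z + mu' x * z * z + (mu' x * q x + mu x * q' x) * y * y) &
    aeon a b (fun x => forall y z : R,
      de * (y * y + z * z) <=
      n x * be x * y * y + n x * (al x)^-1 * z * z + 2 * mu x * be x * y * z <=
      D * (y * y + z * z))].

(** Here [n = 1] and [mu' = kk * mu]. The choice of [kk] lets half of [kk * q] absorb [q'], since
    [K <= K / m^2 * q]. There remains at least [kk * e * m / 2] times [E], and dividing by the upper
    bound [3/2 * E] of the weighted energy gives the factor [1/3] of the rate. *)
Lemma core_form (m M K e kk : R) (al be q q' mu y z : R) :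
  0 < m -> m <= al <= M -> m <= be <= M -> q = al * be -> `|q'| <= K ->
  0 < e -> kk = 2 * K / m ^+ 2 + 1 -> e <= mu -> mu * (1 + M ^+ 2) <= 2^-1 ->
  let E := be * y * y + al^-1 * z * z in
  [/\ (kk * e * m / 3) * (1 * be * y * y + 1 * al^-1 * z * z + 2 * mu * be * y * z) <=
      2 * 0 * y * z + kk * mu * z * z + (kk * mu * q + mu * q') * y * y,
      2^-1 * E <= 1 * be * y * y + 1 * al^-1 * z * z + 2 * mu * be * y * z &
      1 * be * y * y + 1 * al^-1 * z * z + 2 * mu * be * y * z <= 3 / 2 * E].
Proof.
move=> m0 /andP[mal alM] /andP[mbe beM] qE q'K e0 kkE emu muM E.
have al0 : 0 < al by lra.
have be0 : 0 < be by lra.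
have K0 : 0 <= K by rewrite (le_trans _ q'K).
have mu0 : 0 < mu by lra.
have m20 : 0 < m ^+ 2 by rewrite exprn_gt0.
have q0 : 0 < q by rewrite qE mulr_gt0.
have qM : q <= M ^+ 2 by rewrite qE expr2 ler_pM// ltW.
have qm : m ^+ 2 <= q by rewrite qE expr2 ler_pM// ltW.
have kk1 : 1 <= kk by rewrite kkE lerDr divr_ge0 ?mulr_ge0// ltW.
have ali0 : 0 < al^-1 by rewrite invr_gt0.
have y2 : 0 <= y * y by rewrite -expr2 sqr_ge0.
have z2 : 0 <= z * z by rewrite -expr2 sqr_ge0.
have E1 : 0 <= be * y * y by rewrite -mulrA mulr_ge0// ltW.
have E2 : 0 <= al^-1 * z * z by rewrite -mulrA mulr_ge0// ltW.
have E0 : 0 <= E by rewrite addr_ge0.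
have bz : be * (z * z) = q * (al^-1 * z * z).
  by rewrite qE; field; rewrite gt_eqF.
have bzM : be * (z * z) <= M ^+ 2 * E.
  rewrite bz (le_trans (ler_wpM2r E2 qM))// ler_wpM2l ?lerDr//.
  by rewrite (le_trans _ qM)// ltW.
(* Origin of the factor [1 + M ^+ 2]: twice the product [y z] is at most [y^2 + z^2], and
   [be * z^2 = q * z^2 / al] costs a factor [q <= M ^+ 2]. *)
have cross : `|2 * mu * be * y * z| <= 2^-1 * E.
  have -> : 2 * mu * be * y * z = mu * (2 * be * (y * z)) by ring.
  rewrite normrM (gtr0_norm mu0).
  have H : `|2 * be * (y * z)| <= (1 + M ^+ 2) * E.
    have yz : `|2 * (y * z)| <= y * y + z * z.
      rewrite ler_norml; apply/andP; split.
        by have := sqr_ge0 (y + z); lra.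
      by have := sqr_ge0 (y - z); lra.
    have -> : 2 * be * (y * z) = be * (2 * (y * z)) by ring.
    rewrite normrM (gtr0_norm be0).
    apply: le_trans (ler_wpM2l (ltW be0) yz) _.
    have -> : be * (y * y + z * z) = be * y * y + be * (z * z) by ring.
    have : be * y * y <= E by rewrite lerDl.
    by move: bzM; set N2 := M ^+ 2; lra.
  apply: le_trans (ler_wpM2l (ltW mu0) H) _.
  by rewrite mulrA ler_wpM2r.
move: cross; rewrite ler_norml => /andP[c1 c2].
split.
- have R1 : kk * mu / 2 * (q * (y * y)) <= (kk * mu * q + mu * q') * y * y.
    have -> : (kk * mu * q + mu * q') * y * y = mu * (kk * q + q') * (y * y) by ring.
    have -> : kk * mu / 2 * (q * (y * y)) = mu * (kk / 2 * q) * (y * y) by field.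
    rewrite ler_wpM2r// ler_wpM2l ?(ltW mu0)//.
    have q'l : - K <= q' by move: q'K; rewrite ler_norml => /andP[].
    have : K / m ^+ 2 * m ^+ 2 <= K / m ^+ 2 * q.
      by rewrite ler_wpM2l// divr_ge0// ltW.
    rewrite divfK ?gt_eqF// => KK.
    have -> : kk / 2 * q = K / m ^+ 2 * q + q / 2 by rewrite kkE; field; rewrite gt_eqF.
    have -> : kk * q = 2 * (K / m ^+ 2 * q) + q by rewrite kkE; ring.
    lra.
  have R2 : kk * mu / 2 * (z * z) <= kk * mu * z * z.
    have kmz : 0 <= kk * mu * (z * z) by rewrite mulr_ge0// mulr_ge0// ?(ltW mu0)//; lra.
    by rewrite -[leRHS]mulrA; lra.
  have R3 : kk * mu / 2 * (q * (y * y)) + kk * mu / 2 * (z * z) = kk * mu / 2 * al * E.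
    by rewrite /E qE; field; rewrite gt_eqF.
  have R4 : kk * e * m / 2 * E <= kk * mu / 2 * al * E.
    rewrite ler_wpM2r//.
    have : e * m <= mu * al by apply: ler_pM => //; lra.
    move=> /(ler_wpM2l (_ : 0 <= kk / 2)) => /(_ _) H.
    have := H (ltac:(lra)); lra.
  have R5 : kk * e * m / 3 * (1 * be * y * y + 1 * al^-1 * z * z + 2 * mu * be * y * z) <=
     kk * e * m / 3 * (3 / 2 * E).
    rewrite ler_wpM2l ?divr_ge0 ?mulr_ge0//; try lra.
    by rewrite !mul1r -/E; lra.
  by move: R1 R2 R3 R4 R5; lra.
- by rewrite !mul1r -/E; lra.
- by rewrite !mul1r -/E; lra.
Qed.

(** For constant coefficients the system [n' = l g mu], [mu' = l n / g] makes the dissipated form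
    exactly proportional to the energy density, with a factor that grows with [l] without bound.
    Hence any rate is attainable off the core. *)
Lemma outer_form (a0 b0 g l n mu y z : R) : 0 < a0 -> 0 < b0 -> 0 < g -> g ^+ 2 = a0 * b0 ->
  let k := l * a0 / g in
  k * (n * b0 * y * y + n * a0^-1 * z * z + 2 * mu * b0 * y * z) =
  2 * (l * g * mu) * y * z + (l * n / g) * z * z + ((l * n / g) * g ^+ 2 + mu * 0) * y * y.
Proof.
move=> a00 b00 g0 gE k; have bE : b0 = g ^+ 2 / a0 by rewrite gE; field; rewrite gt_eqF.
by rewrite /k bE; field; rewrite !gt_eqF.
Qed.

(** In the characteristic variables [g y - z] and [g y + z] the density is diagonal, with weights
    [n - g mu] and [n + g mu]. *)
Lemma outer_bd (a0 b0 g n mu w0 W y z : R) : 0 < a0 -> 0 < b0 -> 0 < g -> g ^+ 2 = a0 * b0 ->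
  0 < w0 -> w0 <= n - g * mu <= W -> w0 <= n + g * mu <= W ->
  w0 * ((g ^+ 2 * (y * y) + z * z) / a0) <=
  n * b0 * y * y + n * a0^-1 * z * z + 2 * mu * b0 * y * z <=
  W * ((g ^+ 2 * (y * y) + z * z) / a0).
Proof.
move=> a00 b00 g0 gE w00 /andP[A1 A2] /andP[B1 B2].
set E := (_ / a0).
have bE : b0 = g ^+ 2 / a0 by rewrite gE; field; rewrite gt_eqF.
have -> : n * b0 * y * y + n * a0^-1 * z * z + 2 * mu * b0 * y * z =
  ((n - g * mu) * (g * y - z) ^+ 2 + (n + g * mu) * (g * y + z) ^+ 2) / (2 * a0).
  by rewrite bE; field; rewrite gt_eqF.
have EE w : w * E = (w * (g * y - z) ^+ 2 + w * (g * y + z) ^+ 2) / (2 * a0).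
  by rewrite /E; field; rewrite gt_eqF.
rewrite !EE; have i0 : 0 < (2 * a0)^-1 by rewrite invr_gt0 mulr_gt0.
by rewrite !ler_pM2r//; apply/andP; split; apply: lerD; apply: ler_wpM2r; rewrite ?sqr_ge0.
Qed.

End Weights.

(** * Exponential decay of the energy on a window *)

Section Decay.
Variable R : realType.
Implicit Types (a b t : R) (al be : R -> R).

Definition grow (K m : R) : R := 2 * K / m ^+ 2 + 1.
(** The value of [mu] at the left end of the core, such that at the right end, where [mu] is
    largest, it equals [(2 * (1 + M ^+ 2))^-1], the bound that [core_form] asks for. *)
Definition mu0 (K m M p r : R) : R := expR (- (grow K m * (r - p))) / (2 * (1 + M ^+ 2)).
Definition rate (K m M p r : R) : R := grow K m * mu0 K m M p r * m / 3.

Lemma mu0_gt0 K m M p r : 0 < mu0 K m M p r.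
Proof. by rewrite divr_gt0 ?expR_gt0// mulr_gt0// ltr_wpDr ?sqr_ge0. Qed.

Lemma rate_gt0 K m M p r : 0 <= K -> 0 < m -> 0 < rate K m M p r.
Proof.
move=> K0 m0; rewrite /rate divr_gt0// mulr_gt0// mulr_gt0 ?mu0_gt0//.
rewrite /grow ltr_wpDl//; apply: divr_ge0; [exact: mulr_ge0|exact: sqr_ge0].
Qed.

Definition core_mu (K m M p r : R) (x : R) : R :=
  mu0 K m M p r * expR (grow K m * (x - p)).

Lemma core_mu_bd K m M p r x : 0 <= K -> 0 < m -> p <= x <= r ->
  mu0 K m M p r <= core_mu K m M p r x /\ core_mu K m M p r x * (1 + M ^+ 2) <= 2^-1.
Proof.
move=> K0 m0 /andP[px xr].
have g0 : 0 <= grow K m.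
  rewrite /grow addr_ge0//; apply: divr_ge0; [exact: mulr_ge0|exact: sqr_ge0].
split.
  rewrite ler_peMr ?(ltW (mu0_gt0 _ _ _ _ _))// -expR0 ler_expR.
  by rewrite mulr_ge0// subr_ge0.
have MM : 0 < 1 + M ^+ 2 by rewrite ltr_wpDr ?sqr_ge0.
have -> : core_mu K m M p r x * (1 + M ^+ 2) =
   2^-1 * expR (grow K m * (x - p) - grow K m * (r - p)).
  rewrite expRD /core_mu /mu0; field; by rewrite gt_eqF.
rewrite ler_piMr ?invr_ge0// -[leRHS]expR0 ler_expR -mulrBr mulr_ge0_le0//.
by lra.
Qed.

Lemma wseg_core p r al be m M K q q' : 0 < M -> 0 <= K -> coefs p r al be m M ->
  prim p r q q' -> aeon p r (fun x => q x = al x * be x) ->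
  aeon p r (fun x => `|q' x| <= K) ->
  wseg p r al be (rate K m M p r) (fun=> 1) (fun=> 0)
    (core_mu K m M p r) (fun x => grow K m * core_mu K m M p r x) q q'
    (2^-1 * Num.min m M^-1) (3 / 2 * (M + m^-1)).
Proof.
move=> M0 K0 [mal mbe m0 [alm bem] HM] pq qE q'K; split => //.
- split; first exact: prim_cst.
  have := prim_exp p r (mu0 K m M p r) (grow K m) p; congr prim.
  by apply: funext => x; rewrite /core_mu mulrCA.
- apply: aeon2 (aeon2 (S := fun x => q x = al x * be x /\ `|q' x| <= K) _ qE q'K) HM => //.
  move=> x xi [qx q'x] [alM beM] y z.
  have [b1 b2] := core_mu_bd M K0 m0 xi.
  have al_ : m <= al x <= M by rewrite alm.
  have be_ : m <= be x <= M by rewrite bem.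
  by have [] := core_form y z m0 al_ be_ qx q'x (mu0_gt0 K m M p r) (erefl _) b1 b2.
- apply: aeon2 (aeon2 (S := fun x => q x = al x * be x /\ `|q' x| <= K) _ qE q'K) HM => //.
  move=> x xi [qx q'x] [alM beM] y z.
  have [b1 b2] := core_mu_bd M K0 m0 xi.
  have al_ : m <= al x <= M by rewrite alm.
  have be_ : m <= be x <= M by rewrite bem.
  have [_ H1 H2] := core_form y z m0 al_ be_ qx q'x (mu0_gt0 K m M p r) (erefl _) b1 b2.
  have al0 : 0 < al x by rewrite (lt_le_trans m0).
  have y2 : 0 <= y * y by rewrite -expr2 sqr_ge0.
  have z2 : 0 <= z * z by rewrite -expr2 sqr_ge0.
  have ai1 : M^-1 <= (al x)^-1 by rewrite lef_pV2.
  have ai2 : (al x)^-1 <= m^-1 by rewrite lef_pV2.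
  have mi0 : 0 < m^-1 by rewrite invr_gt0.
  have n1 : Num.min m M^-1 <= be x by rewrite ge_min bem.
  have n2 : Num.min m M^-1 <= (al x)^-1 by rewrite ge_min ai1 orbT.
  have d1 := ler_wpM2r y2 n1; have d2 := ler_wpM2r z2 n2.
  have d3 := ler_wpM2r y2 beM; have d4 := ler_wpM2r z2 ai2.
  have d5 : 0 <= m^-1 * (y * y) by rewrite mulr_ge0// ltW.
  have d6 : 0 <= M * (z * z) by rewrite mulr_ge0// ltW.
  apply/andP; split.
    by apply: le_trans H1; rewrite -!mulrA ler_wpM2l ?invr_ge0// mulrDr; lra.
  apply: le_trans H2 _; rewrite -!mulrA ler_wpM2l// ler_wpM2l ?invr_ge0//.
  by rewrite mulrDl !mulrDr; lra.
Qed.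

Section Outer.
Variables (a0 b0 g l c muc : R).

(* Off the core the coefficients are constant and n -+ g mu are exponentials; continuity
   with the core at c forces n c = 1 and mu c = muc. *)
Definition outA (x : R) : R := (1 - g * muc) * expR (- l * (x - c)).
Definition outB (x : R) : R := (1 + g * muc) * expR (l * (x - c)).
Definition out_n (x : R) : R := 2^-1 * (outA x + outB x).
Definition out_mu (x : R) : R := (2 * g)^-1 * (outB x - outA x).

Hypotheses (a00 : 0 < a0) (b00 : 0 < b0) (g0 : 0 < g) (gE : g ^+ 2 = a0 * b0) (l0 : 0 < l).
Hypothesis muc0 : 0 <= g * muc <= 2^-1.

Lemma out_nc : out_n c = 1.
Proof. by rewrite /out_n /outA /outB subrr !mulr0 expR0; field. Qed.

Lemma out_muc : out_mu c = muc.
Proof. by rewrite /out_mu /outA /outB subrr !mulr0 expR0; field; rewrite gt_eqF. Qed.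

Lemma out_subE x : out_n x - g * out_mu x = outA x.
Proof. by rewrite /out_n /out_mu; field; rewrite gt_eqF. Qed.

Lemma out_addE x : out_n x + g * out_mu x = outB x.
Proof. by rewrite /out_n /out_mu; field; rewrite gt_eqF. Qed.

Lemma outA_gt0 x : 0 < outA x.
Proof. by rewrite mulr_gt0 ?expR_gt0//; have /andP[] := muc0; lra. Qed.

Lemma outB_gt0 x : 0 < outB x.
Proof. by rewrite mulr_gt0 ?expR_gt0//; have /andP[] := muc0; lra. Qed.

(** The equivalence constants deteriorate exponentially with the distance [X] of the piece from [c];
    the rate [l * a0 / g] does not see it. The window therefore enters only the final multiplicative
    constant. *)
Lemma wseg_outer a b al be : a <= b ->
  aeon a b (fun x => al x = a0 /\ be x = b0) ->
  exists de D, [/\ 0 < de, 0 < D &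
  wseg a b al be (l * a0 / g) out_n (fun x => l * g * out_mu x)
   out_mu (fun x => l * out_n x / g) (fun=> g ^+ 2) (fun=> 0) de D].
Proof.
move=> ab HC; have /andP[mc1 mc2] := muc0.
pose X := `|a - c| + `|b - c|.
have gN : g != 0 by rewrite gt_eqF.
pose w0 := 2^-1 * expR (- (l * X)); pose W := 3 / 2 * expR (l * X).
have w00 : 0 < w0 by rewrite mulr_gt0 ?expR_gt0.
have W0 : 0 < W by rewrite mulr_gt0 ?expR_gt0.
have xX x : a <= x <= b -> `|x - c| <= X.
  move=> /andP[ax xb]; rewrite ler_norml; apply/andP; split.
    by have := ler_norm (- (a - c)); rewrite normrN; have := normr_ge0 (b - c); rewrite /X; lra.
  by have := ler_norm (b - c); have := normr_ge0 (a - c); rewrite /X; lra.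
have eb x : a <= x <= b -> expR (- (l * X)) <= expR (l * (x - c)) <= expR (l * X).
  move=> /xX; rewrite ler_norml => /andP[h1 h2]; rewrite !ler_expR -mulrN.
  by rewrite !ler_pM2l// h1.
have eb' x : a <= x <= b -> expR (- (l * X)) <= expR (- l * (x - c)) <= expR (l * X).
  move=> /xX; rewrite ler_norml => /andP[h1 h2]; rewrite !ler_expR -mulrN mulNr -mulrN.
  by rewrite !ler_pM2l// lerN2 h2 lerNl h1.
have pA : prim a b outA (fun x => - l * outA x).
  have := prim_exp a b (1 - g * muc) (- l) c; congr prim.
  by apply: funext => x; rewrite mulrCA.
have pB : prim a b outB (fun x => l * outB x).
  have := prim_exp a b (1 + g * muc) l c; congr prim.
  by apply: funext => x; rewrite mulrCA.
pose mg := Num.min (g ^+ 2) 1; pose Mg := g ^+ 2 + 1.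
have g20 : 0 < g ^+ 2 by rewrite exprn_gt0.
exists (w0 * (mg / a0)), (W * (Mg / a0)); split.
- by rewrite mulr_gt0// divr_gt0// lt_min g20 ltr01.
- by rewrite mulr_gt0// divr_gt0// addr_gt0.
split.
- split.
    have := primZ 2^-1 (primD pA pB); congr prim.
    by apply: funext => x; rewrite /out_mu; field.
  have := primZ (2 * g)^-1 (prim_sub pB pA); congr prim.
  by apply: funext => x; rewrite /out_n; field.
- exact: prim_cst.
- by apply: aeon1 HC => x _ [-> ->].
- apply: aeon1 HC => x _ [-> ->] y z.
  by rewrite (outer_form l (out_n x) (out_mu x) y z a00 b00 g0 gE).
- apply: aeon1 HC => x xi [-> ->] y z.
  have /andP[e1 e2] := eb x xi; have /andP[e3 e4] := eb' x xi.
  have eX : 0 < expR (- (l * X)) by exact: expR_gt0.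
  have ep : 0 < expR (l * (x - c)) by exact: expR_gt0.
  have ep' : 0 < expR (- l * (x - c)) by exact: expR_gt0.
  have A1 : w0 <= out_n x - g * out_mu x <= W.
    rewrite out_subE /w0 /W /outA; apply/andP; split; apply: ler_pM => //; lra.
  have B1 : w0 <= out_n x + g * out_mu x <= W.
    rewrite out_addE /w0 /W /outB; apply/andP; split; apply: ler_pM => //; lra.
  have /andP[H1 H2] := outer_bd y z a00 b00 g0 gE w00 A1 B1.
  have y2 : 0 <= y * y by rewrite -expr2 sqr_ge0.
  have z2 : 0 <= z * z by rewrite -expr2 sqr_ge0.
  apply/andP; split.
    apply: le_trans H1; rewrite -mulrA ler_wpM2l ?(ltW w00)//.
    rewrite mulrAC ler_wpM2r ?invr_ge0 ?(ltW a00)// mulrDr.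
    have m1 : mg <= g ^+ 2 by rewrite ge_min lexx.
    have m2 : mg <= 1 by rewrite ge_min lexx orbT.
    by have := ler_wpM2r y2 m1; have := ler_wpM2r z2 m2; lra.
  apply: le_trans H2 _; rewrite -[leRHS]mulrA ler_wpM2l ?(ltW W0)//.
  rewrite [leRHS]mulrAC ler_wpM2r ?invr_ge0 ?(ltW a00)// /Mg mulrDl !mulrDr.
  by have : 0 <= g ^+ 2 * (z * z) by [rewrite mulr_ge0// ltW]; lra.
Qed.

End Outer.

Definition N2 a b (y z : R -> R) : R := itg a b (fun x => y x * y x + z x * z x).

Lemma N2_intb a b y z : sq a b y -> sq a b z -> intb a b (fun x => y x * y x + z x * z x).
Proof. by move=> sy sz; apply: intbD; exact: sqM. Qed.

Lemma N2_ge0 a b y z : 0 <= N2 a b y z.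
Proof.
by apply: Rintegral_ge0 => x _; rewrite addr_ge0// -expr2 sqr_ge0.
Qed.

Lemma wseg_bd a b al be m M k n n' mu mu' q q' de D y z : a <= b -> coefs a b al be m M ->
  wseg a b al be k n n' mu mu' q q' de D -> sq a b y -> sq a b z ->
  de * N2 a b y z <= itg a b (lyap al be n mu y z) <= D * N2 a b y z.
Proof.
move=> ab Hc [[pn pmu] _ _ _ H] sy sz.
have i1 := N2_intb sy sz; have i2 := lyap_intb ab Hc pn pmu sy sz.
rewrite /N2 -!itgZ//; apply/andP; split; apply: itg_le => //; try exact: intbZ.
  by apply: aeon1 H => x _ /(_ (y x) (z x)) /andP[].
by apply: aeon1 H => x _ /(_ (y x) (z x)) /andP[].
Qed.

Lemma comb3 (d1 d2 d3 D1 D2 D3 n1 n2 n3 x1 x2 x3 : R) :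
  0 < D1 -> 0 < D2 -> 0 < D3 -> 0 <= n1 -> 0 <= n2 -> 0 <= n3 ->
  d1 * n1 <= x1 <= D1 * n1 -> d2 * n2 <= x2 <= D2 * n2 -> d3 * n3 <= x3 <= D3 * n3 ->
  Num.min d1 (Num.min d2 d3) * (n1 + n2 + n3) <= x1 + x2 + x3 <=
  (D1 + D2 + D3) * (n1 + n2 + n3).
Proof.
move=> D10 D20 D30 n10 n20 n30 /andP[a1 b1] /andP[a2 b2] /andP[a3 b3].
apply/andP; split; rewrite !mulrDr.
  have h1 : Num.min d1 (Num.min d2 d3) <= d1 by rewrite ge_min lexx.
  have h2 : Num.min d1 (Num.min d2 d3) <= d2 by rewrite !ge_min lexx orbT.
  have h3 : Num.min d1 (Num.min d2 d3) <= d3 by rewrite !ge_min lexx !orbT.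
  move: (Num.min _ _) h1 h2 h3 => d h1 h2 h3.
  by apply: lerD; [apply: lerD|]; [apply: le_trans a1|apply: le_trans a2|apply: le_trans a3];
    apply: ler_wpM2r.
have h1 : D1 <= D1 + D2 + D3 by lra.
have h2 : D2 <= D1 + D2 + D3 by lra.
have h3 : D3 <= D1 + D2 + D3 by lra.
move: (D1 + D2 + D3) h1 h2 h3 => d h1 h2 h3.
by apply: lerD; [apply: lerD|]; [apply: le_trans b1 _|apply: le_trans b2 _|apply: le_trans b3 _];
  apply: ler_wpM2r.
Qed.

(** The fluxes at the two interfaces cancel, and those at the ends of the window have the favourable
    sign. *)
Lemma tele3 (q1 q2 q3 x1 x2 x3 k fB fr fp fA : R) :
  q1 + k * x1 <= fp - fA -> q2 + k * x2 <= fr - fp -> q3 + k * x3 <= fB - fr ->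
  fB <= 0 -> 0 <= fA -> q1 + q2 + q3 + k * (x1 + x2 + x3) <= 0.
Proof. by rewrite !mulrDr => *; lra. Qed.

Lemma energy_decay A p r B al be m M K q q' a0 b0 g :
  A <= p -> p <= r -> r <= B -> 0 < M -> 0 <= K -> coefs A B al be m M ->
  prim p r q q' -> aeon p r (fun x => q x = al x * be x) -> aeon p r (fun x => `|q' x| <= K) ->
  0 < a0 -> 0 < b0 -> 0 < g -> g ^+ 2 = a0 * b0 -> q p = g ^+ 2 -> q r = g ^+ 2 -> g <= 1 + M ^+ 2 ->
  aeon A p (fun x => al x = a0 /\ be x = b0) -> aeon r B (fun x => al x = a0 /\ be x = b0) ->
  exists2 C, 0 < C & forall Y Z Yt Zt, pot_sol A B al be Y Z Yt Zt -> forall T, 0 <= T ->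
   (forall t, 0 < t -> t < T -> Z t B = - g * Y t B /\ Z t A = g * Y t A) ->
   N2 A B (Y T) (Z T) <= C * expR (- (rate K m M p r * T)) * N2 A B (Y 0) (Z 0).
Proof.
move=> Ap pr rB M0 K0 Hc pq qE q'K a00 b00 g0 gE qp qr gM HA HB.
have m0 : 0 < m by have [] := Hc.
have := rate_gt0 M p r K0 m0; have := wseg_core M0 K0 (coefsS Ap rB Hc) pq qE q'K.
move: (rate K m M p r) => k W2 k0.
(* With this growth the outer weights reproduce the rate [k] of the core. *)
pose l := k * g / a0.
have l0 : 0 < l by rewrite divr_gt0// mulr_gt0.
have kE : k = l * a0 / g by rewrite /l; field; rewrite !gt_eqF.
have Hc1 : coefs A p al be m M by apply: coefsS Hc => //; exact: le_trans pr rB.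
have Hc2 : coefs p r al be m M by apply: coefsS Hc.
have Hc3 : coefs r B al be m M by apply: coefsS Hc => //; exact: le_trans Ap pr.
pose mup := core_mu K m M p r p; pose mur := core_mu K m M p r r.
(* By [g <= 1 + M ^+ 2] the bound on [mu] in the core becomes [g * mu <= 1/2], which keeps both
   [n - g mu] and [n + g mu] positive on the outer pieces. *)
have gmu x : p <= x <= r -> 0 <= g * core_mu K m M p r x <= 2^-1.
  move=> /(core_mu_bd M K0 m0)[h1 h2]; have mp := mu0_gt0 K m M p r.
  have c0 : 0 <= core_mu K m M p r x by lra.
  apply/andP; split; first by rewrite mulr_ge0// ltW.
  by apply: le_trans h2; rewrite mulrC ler_wpM2l.
have gp : 0 <= g * mup <= 2^-1 by apply: gmu; rewrite lexx.
have gr : 0 <= g * mur <= 2^-1 by apply: gmu; rewrite lexx pr.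
have [d1 [D1 [d10 D10 W1]]] := wseg_outer p a00 b00 g0 gE l0 gp Ap HA.
have [d3 [D3 [d30 D30 W3]]] := wseg_outer r a00 b00 g0 gE l0 gr rB HB.
rewrite -kE in W1 W3.
set d2 := 2^-1 * _ in W2; set D2 := 3 / 2 * _ in W2.
have d20 : 0 < d2 by rewrite mulr_gt0// lt_min m0 invr_gt0.
have D20 : 0 < D2 by rewrite mulr_gt0// addr_gt0// invr_gt0.
pose d := Num.min d1 (Num.min d2 d3); pose D := D1 + D2 + D3.
have d0 : 0 < d by rewrite !lt_min d10 d20.
have D0 : 0 < D by rewrite !addr_gt0.
exists (D / d); first by rewrite divr_gt0.
move=> Y Z Yt Zt S T T0 bc.
have S1 : pot_sol A p al be Y Z Yt Zt by apply: pot_solS S => //; exact: le_trans pr rB.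
have S2 : pot_sol p r al be Y Z Yt Zt by apply: pot_solS S.
have S3 : pot_sol r B al be Y Z Yt Zt by apply: pot_solS S => //; exact: le_trans Ap pr.
have [[pn1 pmu1] pq1 qE1 F1 _] := W1; have [[pn2 pmu2] pq2 qE2 F2 _] := W2.
have [[pn3 pmu3] pq3 qE3 F3 _] := W3.
have [Q1 r1 E1] := segment_energy Ap Hc1 pn1 pmu1 pq1 qE1 F1 S1.
have [Q2 r2 E2] := segment_energy pr Hc2 pn2 pmu2 pq2 qE2 F2 S2.
have [Q3 r3 E3] := segment_energy rB Hc3 pn3 pmu3 pq3 qE3 F3 S3.
have RD := rdD (rdD r1 r2) r3; set L := (fun t => _ + _ + _) in RD.
have sY t : 0 <= t -> sq A B (Y t) by move=> t0; have [/(_ t t0)/prim_sq] := S.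
have sZ t : 0 <= t -> sq A B (Z t) by move=> t0; have [_ /(_ t t0)/prim_sq] := S.
have Lbd t : 0 <= t -> d * N2 A B (Y t) (Z t) <= L t <= D * N2 A B (Y t) (Z t).
  move=> t0; have sy := sY t t0; have sz := sZ t t0.
  have sub x y : A <= x -> y <= B -> sq x y (Y t) /\ sq x y (Z t).
    by move=> Ax yB; split; [exact: sqS sy|exact: sqS sz].
  have [sy1 sz1] := sub A p (lexx _) (le_trans pr rB).
  have [sy2 sz2] := sub p r Ap rB.
  have [sy3 sz3] := sub r B (le_trans Ap pr) (lexx _).
  have NE : N2 A B (Y t) (Z t) = N2 A p (Y t) (Z t) + N2 p r (Y t) (Z t) + N2 r B (Y t) (Z t).
    have i1 := N2_intb sy sz.
    rewrite /N2 (@itg_split _ A r B)//; last exact: le_trans Ap pr.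
    by rewrite (@itg_split _ A p r)//; exact: intbS i1.
  rewrite NE /L; apply: comb3 => //; try exact: N2_ge0.
  - exact: wseg_bd Ap Hc1 W1 sy1 sz1.
  - exact: wseg_bd pr Hc2 W2 sy2 sz2.
  - exact: wseg_bd rB Hc3 W3 sy3 sz3.
have G := gronwall (k := k) T0 RD _.
have {G} G : L T <= expR (- (k * T)) * L 0.
  apply: G => t t0 tT.
  have [zB zA] := bc t t0 tT.
  (* The flux is continuous at the interfaces: there [n = 1], the values of [mu] match and
     [q = g ^+ 2]. *)
  have fr : lflux (fun=> 1) (core_mu K m M p r) q (Y t) (Z t) r =
    lflux (out_n g l r mur) (out_mu g l r mur) (fun=> g ^+ 2) (Y t) (Z t) r.
    by rewrite /lflux out_nc out_muc// qr.
  have fp : lflux (fun=> 1) (core_mu K m M p r) q (Y t) (Z t) p =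
    lflux (out_n g l p mup) (out_mu g l p mup) (fun=> g ^+ 2) (Y t) (Z t) p.
    by rewrite /lflux out_nc out_muc// qp.
  (* Under [z = - g y] the flux collapses to [- 2 g y^2 (n - g mu)]; at the other end, under
     [z = g y], to [2 g y^2 (n + g mu)]. *)
  have fB : lflux (out_n g l r mur) (out_mu g l r mur) (fun=> g ^+ 2) (Y t) (Z t) B <= 0.
    rewrite /lflux zB.
    have -> : forall n mu y : R, 2 * (n * (y * (- g * y))) + mu * (- g * y * (- g * y)) +
      mu * g ^+ 2 * (y * y) = - (2 * g * (y * y) * (n - g * mu)) by move=> n mu y; ring.
    rewrite out_subE// oppr_le0 mulr_ge0 ?(ltW (outA_gt0 _ _ gr _))//.
    by apply: mulr_ge0; [apply: mulr_ge0 => //; exact: ltW|rewrite -expr2 sqr_ge0].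
  have fA : 0 <= lflux (out_n g l p mup) (out_mu g l p mup) (fun=> g ^+ 2) (Y t) (Z t) A.
    rewrite /lflux zA.
    have -> : forall n mu y : R, 2 * (n * (y * (g * y))) + mu * (g * y * (g * y)) +
      mu * g ^+ 2 * (y * y) = 2 * g * (y * y) * (n + g * mu) by move=> n mu y; ring.
    rewrite out_addE// mulr_ge0 ?(ltW (outB_gt0 _ _ gp _))//.
    by apply: mulr_ge0; [apply: mulr_ge0 => //; exact: ltW|rewrite -expr2 sqr_ge0].
  have e1 := E1 t (ltW t0); have e2 := E2 t (ltW t0); have e3 := E3 t (ltW t0).
  by rewrite fr in e2; rewrite fp in e2; exact (tele3 e1 e2 e3 fB fA).
have /andP[Lb _] := Lbd T T0; have /andP[_ Lc] := Lbd 0 (lexx _).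
have e0 : 0 <= expR (- (k * T)) by exact: expR_ge0.
have H1 : d * N2 A B (Y T) (Z T) <= expR (- (k * T)) * (D * N2 A B (Y 0) (Z 0)).
  by apply: le_trans Lb _; apply: le_trans G _; rewrite ler_wpM2l.
have -> : D / d * expR (- (k * T)) * N2 A B (Y 0) (Z 0) =
   (expR (- (k * T)) * (D * N2 A B (Y 0) (Z 0))) / d by field; rewrite gt_eqF.
by rewrite ler_pdivlMr// mulrC.
Qed.

End Decay.

(** * Decay of time derivatives, transport *)

Section DecayS.
Variable R : realType.
Implicit Types (a b t : R) (al be : R -> R).

Definition S2 a b (y z : R -> R) : R := nrm a b y + nrm a b z.

Lemma S2_ge0 a b y z : 0 <= S2 a b y z.
Proof. by rewrite addr_ge0 ?nrm_ge0. Qed.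

Lemma N2E a b y z : sq a b y -> sq a b z -> N2 a b y z = nrm a b y ^+ 2 + nrm a b z ^+ 2.
Proof.
move=> sy sz; rewrite !nrm_sqr -itgD; [|exact: sy.2|exact: sz.2].
by apply: itg_ext => x _; rewrite !expr2.
Qed.

Definition decay_for a b al be g C L : Prop :=
  forall Y Z Yt Zt, pot_sol a b al be Y Z Yt Zt -> forall T, 0 <= T ->
   (forall t, 0 < t -> t < T -> Z t b = - g * Y t b /\ Z t a = g * Y t a) ->
   S2 a b (Y T) (Z T) <= C * expR (- (L * T)) * S2 a b (Y 0) (Z 0).

(** Square roots are taken, which halves the rate; the factor 2 under the root comes from
    [(y + z)^2 <= 2 (y^2 + z^2)]. *)
Lemma decay_S a b al be g C k : 0 < C ->
  (forall Y Z Yt Zt, pot_sol a b al be Y Z Yt Zt -> forall T, 0 <= T ->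
   (forall t, 0 < t -> t < T -> Z t b = - g * Y t b /\ Z t a = g * Y t a) ->
   N2 a b (Y T) (Z T) <= C * expR (- (k * T)) * N2 a b (Y 0) (Z 0)) ->
  decay_for a b al be g (Num.sqrt (2 * C)) (k / 2).
Proof.
move=> C0 H Y Z Yt Zt S T T0 bc; have := H _ _ _ _ S T T0 bc.
have [pY pZ _ _ _] := S.
rewrite !N2E; [|exact: prim_sq (pY _ (lexx _))|exact: prim_sq (pZ _ (lexx _))|
  exact: prim_sq (pY _ T0)|exact: prim_sq (pZ _ T0)].
have E : expR (- (k * T)) = expR (- (k / 2 * T)) ^+ 2.
  by rewrite expr2 -expRD; congr expR; field.
rewrite E /S2; move: (nrm_ge0 a b (Y T)) (nrm_ge0 a b (Z T)) (nrm_ge0 a b (Y 0)) (nrm_ge0 a b (Z 0)).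
have e0 := expR_ge0 (- (k / 2 * T)).
move: (nrm a b (Y T)) (nrm a b (Z T)) (nrm a b (Y 0)) (nrm a b (Z 0)) (expR _) e0.
move=> y1 z1 y0 z0 e e0 hy1 hz1 hy0 hz0 HH.
have C2 : 0 <= 2 * C by rewrite mulr_ge0// ltW.
have s0 : 0 <= Num.sqrt (2 * C) by exact: sqrtr_ge0.
rewrite -ler_sqr ?nnegrE ?mulr_ge0 ?addr_ge0// !exprMn sqr_sqrtr//.
apply: (@le_trans _ _ (2 * (y1 ^+ 2 + z1 ^+ 2))); first by have := sqr_ge0 (y1 - z1); rewrite sqrrB sqrrD; move: (y1 ^+ 2) (z1 ^+ 2) (y1 * z1) => A B D; rewrite !mulr2n; lra.
apply: (@le_trans _ _ (2 * (C * e ^+ 2 * (y0 ^+ 2 + z0 ^+ 2)))); first by rewrite ler_pM2l.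
have -> : 2 * (C * e ^+ 2 * (y0 ^+ 2 + z0 ^+ 2)) = 2 * C * e ^+ 2 * (y0 ^+ 2 + z0 ^+ 2) by ring.
apply: ler_wpM2l; first by rewrite mulr_ge0 ?sqr_ge0.
by rewrite sqrrD -addrA lerD2l lerDr mulrn_wge0// mulr_ge0.
Qed.

Lemma nrm_quot a b f f' t h e : 0 < h -> (forall t, 0 <= t -> sq a b (f t)) ->
  (forall t, 0 <= t -> sq a b (f' t)) -> 0 <= t ->
  nrm a b (fun x => f (t + h) x - f t x - h * f' t x) <= e * h ->
  nrm a b (fun x => h^-1 * (f (t + h) x - f t x) - f' t x) <= e.
Proof.
move=> h0 sf sf' t0 H.
rewrite (@nrm_ext _ a b _ (fun x => h^-1 * (f (t + h) x - f t x - h * f' t x))); last first.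
  by move=> x _; field; rewrite gt_eqF.
rewrite nrmZ; last first.
  apply: sqB; [apply: sqB; apply: sf => //; exact: addr_ge0 t0 (ltW h0)|apply: sqZ; exact: sf'].
by rewrite ger0_norm ?invr_ge0 ?(ltW h0)// mulrC ler_pdivrMr.
Qed.

Lemma nrm_close a b (f g : R -> R) e : sq a b f -> sq a b g ->
  nrm a b (fun x => f x - g x) <= e -> nrm a b g <= nrm a b f + e /\ nrm a b f <= nrm a b g + e.
Proof.
move=> sf sg H; have sfg := sqB sf sg; split.
  rewrite (@nrm_ext _ a b g (fun x => f x + (-1) * (f x - g x))); last by move=> x _; ring.
  apply: le_trans (nrmD sf (sqZ _ sfg)) _.
  by rewrite nrmZ// normrN normr1 mul1r lerD2l.
rewrite (@nrm_ext _ a b f (fun x => g x + (f x - g x))); last by move=> x _; ring.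
by apply: le_trans (nrmD sg sfg) _; rewrite lerD2l.
Qed.

(* Passing to difference quotients in time turns the decay of Y, Z into that of Yt, Zt. *)
Lemma pot_sol_quot a b al be Y Z Yt Zt h : 0 < h -> pot_sol a b al be Y Z Yt Zt ->
  pot_sol a b al be (fun t x => h^-1 * (Y (t + h) x - Y t x))
    (fun t x => h^-1 * (Z (t + h) x - Z t x))
    (fun t x => h^-1 * (Yt (t + h) x - Yt t x))
    (fun t x => h^-1 * (Zt (t + h) x - Zt t x)).
Proof.
move=> h0 [pY pZ [sYt sZt] dY dZ].
have th t : 0 <= t -> 0 <= t + h by move=> t0; rewrite addr_ge0// ltW.
have sY t : 0 <= t -> sq a b (Y t) by move=> /pY/prim_sq.
have sZ t : 0 <= t -> sq a b (Z t) by move=> /pZ/prim_sq.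
have q (f : R -> R -> R) : (forall t, 0 <= t -> sq a b (f t)) ->
   forall t, 0 <= t -> sq a b (fun x => h^-1 * (f (t + h) x - f t x)).
  by move=> sf t t0; apply: sqZ; apply: sqB; apply: sf => //; exact: th.
have dq (f f' : R -> R -> R) : (forall t, 0 <= t -> sq a b (f t)) ->
   (forall t, 0 <= t -> sq a b (f' t)) -> L2d a b f f' ->
   L2d a b (fun t x => h^-1 * (f (t + h) x - f t x)) (fun t x => h^-1 * (f' (t + h) x - f' t x)).
  move=> sf sf' df t t0 e e0.
  have e20 : 0 < e * h / 2 by rewrite divr_gt0// mulr_gt0.
  have [d1 d10 d1P] := df t t0 _ e20; have [d2 d20 d2P] := df (t + h) (th t t0) _ e20.
  exists (Num.min d1 d2); first by rewrite lt_min d10.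
  move=> s s0; rewrite lt_min => /andP[sd1 sd2].
  have E : s + h - (t + h) = s - t by ring.
  have := d1P s s0 sd1; have := d2P (s + h) (th s s0); rewrite E => /(_ sd2) A2 A1.
  rewrite (@nrm_ext _ a b _ (fun x => h^-1 * ((f (s + h) x - f (t + h) x - (s - t) * f' (t + h) x)
    + (-1) * (f s x - f t x - (s - t) * f' t x)))); last by move=> x _; ring.
  have s1 : sq a b (fun x => f (s + h) x - f (t + h) x - (s - t) * f' (t + h) x).
    apply: sqB; [apply: sqB; apply: sf; exact: th|apply: sqZ; apply: sf'; exact: th].
  have s2 : sq a b (fun x => f s x - f t x - (s - t) * f' t x).
    by apply: sqB; [apply: sqB; exact: sf|apply: sqZ; exact: sf'].
  rewrite nrmZ; last by apply: sqD => //; exact: sqZ.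
  rewrite ger0_norm ?invr_ge0 ?(ltW h0)// mulrC ler_pdivrMr//.
  apply: le_trans (nrmD s1 (sqZ _ s2)) _; rewrite nrmZ// normrN normr1 mul1r.
  apply: le_trans (lerD A2 A1) _.
  by rewrite le_eqVlt; apply/orP; left; apply/eqP; field.
split.
- move=> t t0; have := primZ h^-1 (prim_sub (pY _ (th t t0)) (pY _ t0)); congr prim.
  by apply: funext => x; ring.
- move=> t t0; have := primZ h^-1 (prim_sub (pZ _ (th t t0)) (pZ _ t0)); congr prim.
  by apply: funext => x; ring.
- by split; exact: q.
- exact: dq.
- exact: dq.
Qed.

(** The system and the boundary relations do not depend on time, so difference quotients satisfy
    them too; then the step tends to zero. The relations are assumed beyond [T] to leave room for
    the shifted time [T + h]. *)
Lemma decay_deriv a b al be g C L Y Z Yt Zt T : 0 <= C -> decay_for a b al be g C L ->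
  pot_sol a b al be Y Z Yt Zt -> 0 <= T ->
  (forall t, 0 <= t -> t < T + 1 -> Z t b = - g * Y t b /\ Z t a = g * Y t a) ->
  S2 a b (Yt T) (Zt T) <= C * expR (- (L * T)) * S2 a b (Yt 0) (Zt 0).
Proof.
move=> C0 HD S T0 bc; have [pY pZ [sYt sZt] dY dZ] := S.
have sY t : 0 <= t -> sq a b (Y t) by move=> /pY/prim_sq.
have sZ t : 0 <= t -> sq a b (Z t) by move=> /pZ/prim_sq.
have c0 : 0 <= C * expR (- (L * T)) by rewrite mulr_ge0// expR_ge0.
apply/ler_addgt0Pr => e e0.
(* Replacing quotients by derivatives costs [e1] four times: twice at time [T], and twice at time
   zero, where the error is multiplied by [c]. *)
set c := C * expR _ in c0 *; pose e1 := e / (2 * c + 2).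
have K0 : 0 < 2 * c + 2 by rewrite ltr_wpDl ?mulr_ge0.
have e10 : 0 < e1 by rewrite divr_gt0.
have z0 : (0 : R) <= 0 by [].
have [d1 d10 d1P] := dY T T0 _ e10; have [d2 d20 d2P] := dZ T T0 _ e10.
have [d3 d30 d3P] := dY 0 z0 _ e10; have [d4 d40 d4P] := dZ 0 z0 _ e10.
pose h := Num.min (Num.min (Num.min d1 d2) (Num.min d3 d4)) 1 / 2.
have m0 : 0 < Num.min (Num.min (Num.min d1 d2) (Num.min d3 d4)) 1.
  by rewrite !lt_min d10 d20 d30 d40 ltr01.
have h0 : 0 < h by rewrite divr_gt0.
have hm : h < Num.min (Num.min (Num.min d1 d2) (Num.min d3 d4)) 1.
  by rewrite /h ltr_pdivrMr// ltr_pMr// ltr1n.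
move: (hm); rewrite !lt_min => /andP[/andP[/andP[h1 h2] /andP[h3 h4]] h5].
have nh t : t + h - t = h by rewrite addrC addKr.
have ah : `|h| = h by rewrite gtr0_norm.
have Th : 0 <= T + h by rewrite addr_ge0// ltW.
have oh : 0 <= 0 + h by rewrite add0r ltW.
have := d1P (T + h) Th; rewrite nh ah => /(_ h1)/(nrm_quot h0 sY sYt T0) A1.
have := d2P (T + h) Th; rewrite nh ah => /(_ h2)/(nrm_quot h0 sZ sZt T0) A2.
have := d3P (0 + h) oh; rewrite nh ah => /(_ h3)/(nrm_quot h0 sY sYt z0) A3.
have := d4P (0 + h) oh; rewrite nh ah => /(_ h4)/(nrm_quot h0 sZ sZt z0) A4.
have H := HD _ _ _ _ (pot_sol_quot h0 S) T T0.
rewrite -/c in H.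
pose Yh t x := h^-1 * (Y (t + h) x - Y t x); pose Zh t x := h^-1 * (Z (t + h) x - Z t x).
have {}H : S2 a b (Yh T) (Zh T) <= c * S2 a b (Yh 0) (Zh 0).
  apply: H => t t0 tT.
  have [-> ->] : Z (t + h) b = - g * Y (t + h) b /\ Z (t + h) a = g * Y (t + h) a.
    by apply: bc; [rewrite addr_ge0// ltW|exact: ltrD].
  have [-> ->] : Z t b = - g * Y t b /\ Z t a = g * Y t a.
    by apply: bc; [exact: ltW|rewrite (lt_trans tT)// ltrDl].
  by split; ring.
have sYh t : 0 <= t -> sq a b (Yh t).
  move=> t0; apply: sqZ; apply: sqB; apply: sY => //; exact: addr_ge0 t0 (ltW h0).
have sZh t : 0 <= t -> sq a b (Zh t).
  move=> t0; apply: sqZ; apply: sqB; apply: sZ => //; exact: addr_ge0 t0 (ltW h0).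
have [B1 _] := nrm_close (sYh T T0) (sYt T T0) A1.
have [B2 _] := nrm_close (sZh T T0) (sZt T T0) A2.
have [_ B3] := nrm_close (sYh 0 z0) (sYt 0 z0) A3.
have [_ B4] := nrm_close (sZh 0 z0) (sZt 0 z0) A4.
apply: (@le_trans _ _ (S2 a b (Yh T) (Zh T) + 2 * e1)).
  by rewrite /S2 mulr_natl mulr2n addrACA lerD.
apply: (@le_trans _ _ (c * (S2 a b (Yt 0) (Zt 0) + 2 * e1) + 2 * e1)).
  by rewrite lerD2r (le_trans H)// ler_wpM2l// /S2 [2 * e1]mulr_natl mulr2n addrACA lerD.
have -> : e = (2 * c + 2) * e1 by rewrite /e1; field; rewrite gt_eqF.
by rewrite le_eqVlt; apply/orP; left; apply/eqP; ring.
Qed.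

(** The square of [f] has density zero almost everywhere, so it is constant, and its integral
    vanishes. This turns almost-everywhere information into values at end points. *)
Lemma prim_ae0 a b (f f' : R -> R) : a < b -> prim a b f f' ->
  aeon a b (fun x => f x = 0) -> forall x, a <= x <= b -> f x = 0.
Proof.
move=> ab pf f0 x xi; have ab' := ltW ab.
have pff := primM pf pf.
have fc y : a <= y <= b -> f y * f y = f a * f a.
  move=> /andP[ay yb]; have := primB pff (lexx a) ay yb.
  have -> : itg a y (fun x => f' x * f x + f x * f' x) = itg a y (fun=> 0).
    apply: itg_ae; [exact: measS (intb_meas pff.1)|exact: meas_cst|].
    by apply: aeon1 (aeonS (lexx a) yb f0) => z _ ->; rewrite mulr0 mul0r addr0.
  by rewrite itg_cst// mul0r => /eqP; rewrite subr_eq0 => /eqP.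
have : itg a b (fun x => f x * f x) = 0.
  rewrite (@itg_ae _ a b _ (fun=> 0)) ?itg_cst ?mul0r//.
  - exact: prim_meas pff.
  - exact: meas_cst.
  - by apply: aeon1 f0 => z _ ->; rewrite mulr0.
rewrite (@itg_ext _ a b _ (fun=> f a * f a))// itg_cst// => /eqP.
rewrite mulf_eq0 subr_eq0 (gt_eqF ab) orbF => /eqP fa.
by have := fc x xi; rewrite fa => /eqP; rewrite mulf_eq0 orbb => /eqP.
Qed.

End DecayS.

(** * One-way transport and finite speed of propagation *)

Section Transport.
Variable R : realType.
Implicit Types (x y t : R).

(** A nonincreasing [C^1] weight vanishing for [y >= Y]. Its derivative is Lipschitz, so the Taylor
    error is quadratic uniformly in [y], which suffices to differentiate a weighted energy in
    time. *)
Definition ramp (Y y : R) : R := (Num.max 0 (Y - y)) ^+ 2.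
Definition ramp' (Y y : R) : R := - 2 * Num.max 0 (Y - y).

Lemma ramp_taylor Y y h : `|ramp Y (y + h) - ramp Y y - h * ramp' Y y| <= h ^+ 2.
Proof.
rewrite /ramp /ramp'; rewrite opprD addrA; set d := Y - y.
case: (leP 0 d) => d0; case: (leP 0 (d - h)) => dh.
- rewrite (_ : (d - h) ^+ 2 - d ^+ 2 - h * (- 2 * d) = h ^+ 2); last by ring.
  by rewrite ger0_norm ?sqr_ge0.
- rewrite (_ : 0 ^+ 2 - d ^+ 2 - h * (- 2 * d) = d * (2 * h - d)); last by ring.
  have h0 : d < h by lra.
  rewrite ger0_norm; last by rewrite mulr_ge0//; lra.
  rewrite -subr_ge0 (_ : h ^+ 2 - _ = (h - d) ^+ 2) ?sqr_ge0//; ring.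
- rewrite !mulr0 subr0 expr0n/= subr0 ger0_norm ?sqr_ge0//.
  by rewrite -[h ^+ 2]sqrrN ler_sqr ?nnegrE//; lra.
- by rewrite !mulr0 expr0n/= !subr0 normr0 sqr_ge0.
Qed.

Lemma ramp_bd Y y : `|ramp' Y y| <= 2 * `|Y - y| /\ `|ramp Y y| <= `|Y - y| ^+ 2.
Proof.
have H : 0 <= Num.max 0 (Y - y) <= `|Y - y|.
  by rewrite le_max lexx/= ge_max normr_ge0 ler_norm.
have /andP[H1 H2] := H; split.
  by rewrite /ramp' normrM normrN (ger0_norm H1) ger0_norm// ler_pM2l.
by rewrite /ramp normrX (ger0_norm H1) ler_sqr ?nnegrE.
Qed.

Lemma ramp'_cont Y : continuous (ramp' Y).
Proof.
move=> y; apply: cvgM; first exact: cvg_cst.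
apply: (@continuous_max _ _ (fun=> 0) (fun y => Y - y)); first exact: cvg_cst.
by apply: cvgB; [exact: cvg_cst|exact: cvg_id].
Qed.

Lemma ramp_derive Y sg k x : is_derive x 1 (fun x => ramp Y (sg * x + k)) (sg * ramp' Y (sg * x + k)).
Proof.
apply/is_derive_eps => e e0; pose K := sg ^+ 2 + 1.
have K0 : 0 < K by rewrite ltr_wpDl ?sqr_ge0.
exists (e / K); first by rewrite divr_gt0.
move=> y; rewrite ltr_pdivlMr// => yx.
have -> : sg * y + k = (sg * x + k) + sg * (y - x) by ring.
have := ramp_taylor Y (sg * x + k) (sg * (y - x)).
rewrite (mulrCA (y - x)) mulrA => /le_trans; apply.
rewrite exprMn -[X in _ * X]real_normK ?num_real// expr2 mulrA ler_wpM2r//.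
apply: le_trans (ltW yx); rewrite mulrC ler_wpM2l// /K; lra.
Qed.

Lemma prim_ramp a b Y sg k : prim a b (fun x => ramp Y (sg * x + k))
  (fun x => sg * ramp' Y (sg * x + k)).
Proof.
apply: prim_C1; first by move=> x; exact: ramp_derive.
move=> x; apply: cvgM; first exact: cvg_cst.
apply: (@continuous_comp _ _ _ (fun x => sg * x + k) (ramp' Y)); last exact: ramp'_cont.
by apply: cvgD; [apply: cvgM; [exact: cvg_cst|exact: cvg_id]|exact: cvg_cst].
Qed.

Lemma thM_arith (K h N N' e1 : R) : 0 <= K -> 0 <= h -> 0 <= N -> 0 <= N' -> h <= e1 ->
  K * h ^+ 2 * N + K * (e1 * h) + 2 * K * h * ((N' + 1) * h) <=
  (K * (N + 1 + 2 * (N' + 1)) + 1) * (e1 * h).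
Proof.
move=> K0 h0 N0 N0' he; have e0 := le_trans h0 he.
have H c : 0 <= c -> c * (h * h) <= c * (e1 * h).
  by move=> c0; rewrite ler_wpM2l// ler_wpM2r.
have H1 := H (K * N) (mulr_ge0 K0 N0).
have H2 : 2 * K * (N' + 1) * (h * h) <= 2 * K * (N' + 1) * (e1 * h).
  by apply: H; rewrite !mulr_ge0// addr_ge0.
have H3 : 0 <= e1 * h by rewrite mulr_ge0.
have -> : (K * (N + 1 + 2 * (N' + 1)) + 1) * (e1 * h) =
  K * N * (e1 * h) + K * (e1 * h) + 2 * K * (N' + 1) * (e1 * h) + e1 * h by ring.
have -> : K * h ^+ 2 * N + K * (e1 * h) + 2 * K * h * ((N' + 1) * h) =
  K * N * (h * h) + K * (e1 * h) + 2 * K * (N' + 1) * (h * h) by ring.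
lra.
Qed.

(** The product rule for a multiplier depending on [t] and [x]. The error of the multiplier has to
    be quadratic uniformly in [x]; [ramp_taylor] supplies such a bound. *)
Lemma L2d_thM a b (th th' f f' : R -> R -> R) :
  (forall t, 0 <= t -> meas a b (th t)) -> (forall t, 0 <= t -> meas a b (th' t)) ->
  (forall t, 0 <= t -> exists2 K, 0 <= K & forall x, a <= x <= b ->
     [/\ `|th t x| <= K, `|th' t x| <= K &
      forall s, `|th s x - th t x - (s - t) * th' t x| <= K * (s - t) ^+ 2]) ->
  (forall t, 0 <= t -> sq a b (f t)) -> (forall t, 0 <= t -> sq a b (f' t)) ->
  L2d a b f f' ->
  L2d a b (fun t x => th t x * f t x) (fun t x => th' t x * f t x + th t x * f' t x).
Proof.
move=> mth mth' HK sf sf' df t t0 e e0; have [K K0 KP] := HK t t0.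
have n0 g : 0 <= nrm a b g by exact: nrm_ge0.
pose P := K * (nrm a b (f t) + 1 + 2 * (nrm a b (f' t) + 1)) + 1.
have P0 : 0 < P by rewrite /P ltr_wpDl// mulr_ge0// !addr_ge0// mulr_ge0// addr_ge0.
pose e1 := e / P; have e10 : 0 < e1 by rewrite divr_gt0.
have [d1 d10 d1P] := df t t0 _ e10; have [d2 d20 d2P] := L2d_cont sf sf' df t0.
exists (Num.min (Num.min d1 d2) (Num.min e1 1)); first by rewrite !lt_min d10 d20 e10 ltr01.
move=> s s0; rewrite !lt_min => /andP[/andP[sd1 sd2] /andP[se1 s1]].
have := d1P s s0 sd1; have := d2P s s0 sd2.
have hE : (s - t) ^+ 2 = `|s - t| ^+ 2 by rewrite real_normK ?num_real.
set h := `|s - t| in se1 s1 hE * => A2 A1; have h0 : 0 <= h by exact: normr_ge0.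
have sft := sf t t0; have sft' := sf' t t0.
have r1 : sq a b (fun x => f s x - f t x - (s - t) * f' t x).
  by apply: sqB; [apply: sqB => //; exact: sf|exact: sqZ].
have r2 : sq a b (fun x => f s x - f t x) by apply: sqB => //; exact: sf.
pose D1 x := th s x - th t x - (s - t) * th' t x.
pose D2 x := th s x - th t x.
have mD1 : meas a b D1 by apply: measB; [apply: measB; exact: mth|apply: measZ; exact: mth'].
have mD2 : meas a b D2 by apply: measB; exact: mth.
have bD1 : aeon a b (fun x => `|D1 x| <= K * h ^+ 2).
  by apply: aeonW => x /KP[_ _ /(_ s)]; rewrite hE.
have bD2 : aeon a b (fun x => `|D2 x| <= 2 * K * h).
  apply: aeonW => x /KP[_ B /(_ s)]; rewrite hE => B'.
  have -> : D2 x = D1 x + (s - t) * th' t x by rewrite /D1 /D2; ring.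
  apply: le_trans (ler_normD _ _) _; rewrite normrM -/h.
  have hh : K * h ^+ 2 <= K * h by rewrite ler_wpM2l// expr2 ler_piMr// ltW.
  have := ler_wpM2l h0 B; rewrite -/(D1 x) in B'; lra.
have bth : aeon a b (fun x => `|th t x| <= K) by apply: aeonW => x /KP[].
have h20 : 0 <= K * h ^+ 2 by rewrite mulr_ge0 ?sqr_ge0.
have h10 : 0 <= 2 * K * h by rewrite !mulr_ge0.
have q1 := sq_bM mD1 bD1 sft; have q2 := sq_bM (mth t t0) bth r1; have q3 := sq_bM mD2 bD2 r2.
rewrite (@nrm_ext _ a b _ (fun x => D1 x * f t x + th t x * (f s x - f t x - (s - t) * f' t x)
   + D2 x * (f s x - f t x))); last by move=> x _; rewrite /D1 /D2; ring.
apply: le_trans (nrmD (sqD q1 q2) q3) _; apply: le_trans (lerD (nrmD q1 q2) (lexx _)) _.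
have B1 := nrm_bM h20 mD1 bD1 sft.
have B2 := le_trans (nrm_bM K0 (mth t t0) bth r1) (ler_wpM2l K0 A1).
have B3 := le_trans (nrm_bM h10 mD2 bD2 r2) (ler_wpM2l h10 A2).
apply: le_trans (lerD (lerD B1 B2) B3) _.
apply: le_trans (thM_arith K0 h0 (n0 (f t)) (n0 (f' t)) (ltW se1)) _.
by rewrite -/P /e1 mulrA mulrCA divff ?gt_eqF// mulr1.
Qed.

Lemma prim_lin a b (sg k : R) : prim a b (fun x => sg * x + k) (fun=> sg).
Proof.
apply: prim_C1 => [x|]; last by move=> x; exact: cvg_cst.
have dx : is_derive x 1 (fun y : R => sg * y) (sg *: 1) by exact: is_deriveZ.
have := @is_deriveD _ _ _ _ _ _ _ _ _ dx (is_derive_cst k x 1).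
by rewrite /GRing.scale/= mulr1 addr0.
Qed.

(* The energy with weight (sg x - p) ramp Yb (sg x + c t) is nonincreasing, and the weight
   kills both boundary terms. *)
Lemma transport_zero u v sg c p Yb (S St Sx : R -> R -> R) : u < v -> 0 < c -> sg * sg = 1 ->
  (forall x, u <= x <= v -> 0 <= sg * x - p) ->
  (forall t, 0 <= t -> (sg * u - p) * ramp Yb (sg * u + c * t) = 0) ->
  (forall t, 0 <= t -> (sg * v - p) * ramp Yb (sg * v + c * t) = 0) ->
  (forall t, 0 <= t -> sq u v (St t)) -> L2d u v S St ->
  (forall t, 0 <= t -> prim u v (S t) (Sx t)) ->
  (forall t, 0 <= t -> aeon u v (fun x => St t x = sg * c * Sx t x)) ->
  aeon u v (fun x => S 0 x = 0) ->
  forall t, 0 <= t -> aeon u v (fun x => 0 < sg * x - p -> sg * x + c * t < Yb -> S t x = 0).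
Proof.
move=> uv c0 sg2 rho0 bu bv sSt dS pS SE S0 T T0; have uv' := ltW uv.
have sS t : 0 <= t -> sq u v (S t) by move=> /pS/prim_sq.
pose th t x := (sg * x - p) * ramp Yb (sg * x + c * t).
pose th' t x := (sg * x - p) * (c * ramp' Yb (sg * x + c * t)).
have pr t : prim u v (fun x => sg * x - p) (fun=> sg) by exact: prim_lin.
have pth t := primM (pr t) (prim_ramp u v Yb sg (c * t)).
have mth t : 0 <= t -> meas u v (th t) by move=> _; exact: prim_meas (pth t).
have mth' t : 0 <= t -> meas u v (th' t).
  move=> _; apply: measM; first exact: prim_meas (pr t).
  apply: measZ; apply: meas_T; apply: continuous_measurable_fun => x.
  apply: (@continuous_comp _ _ _ (fun x => sg * x + c * t) (ramp' Yb)); last exact: ramp'_cont.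
  by apply: cvgD; [apply: cvgM; [exact: cvg_cst|exact: cvg_id]|exact: cvg_cst].
have HK t : 0 <= t -> exists2 K, 0 <= K & forall x, u <= x <= v ->
     [/\ `|th t x| <= K, `|th' t x| <= K &
      forall s, `|th s x - th t x - (s - t) * th' t x| <= K * (s - t) ^+ 2].
  move=> t0; pose W := `|sg| * (`|u| + `|v|) + `|p| + `|Yb| + c * t.
  have ct0 : 0 <= c * t by rewrite mulr_ge0// ltW.
  have sguv : 0 <= `|sg| * (`|u| + `|v|) by rewrite mulr_ge0// addr_ge0.
  have W0 : 0 <= W by rewrite /W !addr_ge0.
  have xuv x : u <= x <= v -> `|sg * x| <= `|sg| * (`|u| + `|v|).
    move=> /andP[ux xv]; rewrite normrM ler_wpM2l// ler_norml; apply/andP; split.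
      by have := ler_norm (- u); rewrite normrN; have := normr_ge0 v; lra.
    by have := ler_norm v; have := normr_ge0 u; lra.
  have b1 x : u <= x <= v -> `|sg * x - p| <= W.
    move=> /xuv H; apply: le_trans (ler_normB _ _) _; rewrite /W.
    by have := normr_ge0 Yb; lra.
  have b2 x : u <= x <= v -> `|Yb - (sg * x + c * t)| <= W.
    move=> /xuv H; apply: le_trans (ler_normB _ _) _.
    have := ler_normD (sg * x) (c * t); rewrite (ger0_norm ct0) /W.
    by have := normr_ge0 p; lra.
  exists (W * W ^+ 2 + W * (c * (2 * W)) + W * c ^+ 2).
    by rewrite !addr_ge0 ?mulr_ge0 ?sqr_ge0// ?(ltW c0)// mulr_ge0.
  have k1 : 0 <= W * W ^+ 2 by rewrite mulr_ge0 ?sqr_ge0.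
  have k2 : 0 <= W * (c * (2 * W)) by rewrite !mulr_ge0// ltW.
  have k3 : 0 <= W * c ^+ 2 by rewrite mulr_ge0 ?sqr_ge0.
  move=> x xi; have [r1 r2] := ramp_bd Yb (sg * x + c * t).
  have B1 := b1 x xi; have B2 := b2 x xi; split.
  - rewrite /th normrM; apply: (@le_trans _ _ (W * W ^+ 2)); last lra.
    apply: ler_pM => //; apply: le_trans r2 _.
    by rewrite ler_sqr ?nnegrE.
  - rewrite /th' normrM; apply: (@le_trans _ _ (W * (c * (2 * W)))); last lra.
    apply: ler_pM => //; rewrite normrM (gtr0_norm c0) ler_wpM2l ?(ltW c0)//.
    by apply: le_trans r1 _; rewrite ler_wpM2l.
  - move=> s; have := ramp_taylor Yb (sg * x + c * t) (c * (s - t)).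
    have -> : sg * x + c * t + c * (s - t) = sg * x + c * s by ring.
    move=> H.
    have -> : th s x - th t x - (s - t) * th' t x = (sg * x - p) *
      (ramp Yb (sg * x + c * s) - ramp Yb (sg * x + c * t) - c * (s - t) * ramp' Yb (sg * x + c * t)).
      by rewrite /th /th'; ring.
    rewrite normrM; apply: (@le_trans _ _ (W * (c * (s - t)) ^+ 2)); first exact: ler_pM.
    rewrite exprMn mulrA ler_wpM2r ?sqr_ge0//; lra.
have bK t : 0 <= t -> exists2 K, 0 <= K & aeon u v (fun x => `|th t x| <= K) /\ aeon u v (fun x => `|th' t x| <= K).
  move=> /HK [K K0 KP]; exists K => //.
  by split; apply: aeonW => x /KP [].
have sW t : 0 <= t -> sq u v (fun x => th t x * S t x).
  by move=> t0; have [K K0 [B1 B2]] := bK t t0; apply: sq_bM B1 (sS t t0); exact: mth.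
have sW' t : 0 <= t -> sq u v (fun x => th' t x * S t x + th t x * St t x).
  move=> t0; have [K K0 [B1 B2]] := bK t t0; apply: sqD.
    by apply: sq_bM B2 (sS t t0); exact: mth'.
  by apply: sq_bM B1 (sSt t t0); exact: mth.
have dW := L2d_thM mth mth' HK sS sSt dS.
have RD := L2d_rd sW sW' sS sSt dW dS.
have := gronwall (k := 0) T0 RD; rewrite mul0r oppr0 expR0 mul1r.
set Q := (fun t => itg u v (fun x => th t x * S t x * S t x)) => H.
have Q0 : Q 0 = 0.
  rewrite /Q (@itg_ae _ u v _ (fun=> 0)) ?itg_cst ?mul0r//.
  - by apply: intb_meas; apply: sqM; [exact: sW|exact: sS].
  - exact: meas_cst.
  - by apply: aeon1 S0 => x _ ->; rewrite mulr0.
have QT : Q T <= 0.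
  rewrite -Q0; apply: H => t t0 _; rewrite mul0r addr0.
  have t0' := ltW t0.
  (* The flux [sg * c * th * S^2] is zero at both ends, so its density integrates to zero and may be
     compared pointwise with the integrand of the time derivative. *)
  have pP := primZ (sg * c) (primM (pth t) (primM (pS t t0') (pS t t0'))).
  have := primB pP (lexx u) uv' (lexx v); rewrite bu// bv// mul0r mul0r mulr0 subr0 => E.
  rewrite [leRHS]E; apply: itg_le.
  - by apply: intbD; apply: sqM; [exact: sW'|exact: sS|exact: sW|exact: sSt].
  - exact: pP.1.
  - apply: aeon1 (SE t t0') => x xi ->.
    have r0 : 0 <= ramp Yb (sg * x + c * t) by exact: sqr_ge0.
    rewrite /th /th'; move: (ramp _ _) (ramp' _ _) (S t x) (Sx t x) r0 => r r' w wx r0.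
    have E1 : sg * sg * (c * r * w * w) = c * r * w * w by rewrite sg2 mul1r.
    have E2 : sg * sg * (c * (sg * x - p) * r' * w * w) = c * (sg * x - p) * r' * w * w.
      by rewrite sg2 mul1r.
    have E3 : 0 <= c * r * w * w by rewrite -mulrA; apply: mulr_ge0; [apply: mulr_ge0 => //; exact: ltW|rewrite -expr2 sqr_ge0].
    (* The ramp is constant along characteristics, so the terms with [r'] cancel by [sg * sg = 1].
       The slope of the factor [sg * x - p] leaves the nonnegative term [c * r * w * w]. *)
    rewrite -subr_ge0.
    have -> : sg * c * ((sg * r + (sg * x - p) * (sg * r')) * (w * w) +
       (sg * x - p) * r * (wx * w + w * wx)) -
      (((sg * x - p) * (c * r') * w + (sg * x - p) * r * (sg * c * wx)) * w +
       (sg * x - p) * r * w * (sg * c * wx)) =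
      sg * sg * (c * r * w * w) + (sg * sg * (c * (sg * x - p) * r' * w * w) -
        c * (sg * x - p) * r' * w * w) by ring.
    by rewrite E1 E2 subrr addr0.
have thS x : u <= x <= v -> 0 <= th T x * S T x * S T x.
  by move=> xi; rewrite -mulrA -expr2 mulr_ge0 ?sqr_ge0// mulr_ge0 ?rho0// sqr_ge0.
have iQ : intb u v (fun x => th T x * S T x * S T x) by apply: sqM; [exact: sW|exact: sS].
have Q0' : Q T = 0.
  by apply/eqP; rewrite eq_le QT/=; apply: itg_ge0 => //; exact: aeonW.
have := itg_eq0 iQ (aeonW thS) Q0'; apply: aeon1 => x xi /eqP Hx rx sx.
have rp : ramp Yb (sg * x + c * T) != 0.
  by rewrite expf_eq0/= gt_eqF// lt_max subr_gt0 sx orbT.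
move: Hx; rewrite mulf_eq0 => /orP[|/eqP//]; rewrite mulf_eq0 => /orP[|/eqP//].
by rewrite /th mulf_eq0 (gt_eqF rx) (negbTE rp).
Qed.

End Transport.

(** * Potentials of weak solutions *)

Section FluxPotential.
Variable R : realType.
Implicit Types (a b t s : R) (al : R -> R).

Lemma antider (k : R -> R) :
  (forall t, 0 <= t -> forall e, 0 < e -> exists2 d, 0 < d &
    forall s, 0 <= s -> `|s - t| < d -> `|k s - k t| <= e) ->
  exists2 K : R -> R, K 0 = 0 & rd K k.
Proof.
(* Continuity at zero is only one-sided; freezing [k] at its initial value for negative times gives
   a continuous function on the line. *)
move=> kc; pose k1 t := k (Num.max t 0).
have m0 (t : R) : 0 <= Num.max t 0 by rewrite le_max lexx orbT.
have mle (s t : R) : `|Num.max s 0 - Num.max t 0| <= `|s - t|.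
  by case: (leP s 0) => s0; case: (leP t 0) => t0; rewrite ?subrr ?normr0// ?subr0 ?sub0r ?normrN;
    rewrite ?(gtr0_norm t0) ?(gtr0_norm s0); [have := ler_norm (- (s - t))|
      have := ler_norm (s - t)]; rewrite ?normrN; lra.
have ck1 : continuous k1.
  move=> t; apply/cvgrPdist_le => e e0.
  have [d d0 dP] := kc _ (m0 t) e e0.
  exists d => //= s /= sd; rewrite distrC; apply: dP; first exact: m0.
  by apply: le_lt_trans (mle s t) _; rewrite distrC.
have ki a b : intb a b k1.
  apply: continuous_compact_integrable; first exact: segment_compact.
  exact: continuous_subspaceT.
have pK := sint_prim ki; exists (sint k1); first by rewrite /sint lexx itg_pt.
move=> t t0 e e0; have [d d0 dP] := kc t t0 e e0; exists d => // s s0 sd.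
have kE r : 0 <= r -> k1 r = k r by move=> r0; rewrite /k1 max_l.
have main x y : 0 <= x -> x <= y -> (forall r, x <= r <= y -> `|k r - k t| <= e) ->
    `|sint k1 y - sint k1 x - (y - x) * k t| <= e * (y - x).
  move=> x0 xy He; rewrite (primB (pK x y))// mulrC -itg_cst//.
  rewrite -itgB//; last exact: intb_cst.
  have ic : intb x y (fun r => k1 r - k t) by apply: intbB => //; exact: intb_cst.
  apply: le_trans (itg_abs ic) _; rewrite -itg_cst//; apply: itg_le.
  - exact: intb_abs.
  - exact: intb_cst.
  - by apply: aeonW => r ri; rewrite kE; [exact: He|case/andP: ri => /(le_trans x0)].
have [st|ts] := leP s t.
- rewrite ler0_norm ?subr_le0// in sd *.
  rewrite -normrN (_ : - (_ - _ - _) = sint k1 t - sint k1 s - (t - s) * k t); last by ring.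
  rewrite (_ : - (s - t) = t - s); last by ring.
  apply: main => // r /andP[sr rt]; apply: dP; first exact: le_trans sr.
  by rewrite ler0_norm ?subr_le0//; lra.
- rewrite gtr0_norm ?subr_gt0// in sd *.
  apply: main => //; first exact: ltW.
  move=> r /andP[tr rs]; apply: dP; first exact: le_trans tr.
  by rewrite ger0_norm ?subr_ge0//; lra.
Qed.

(** By the mean value theorem the first-order error is controlled by the oscillation of the
    derivative. At time zero only continuity of [th] is assumed, because the weak equation is
    imposed at positive times. *)
Lemma mvt_bound (th th' : R -> R) t s e : 0 <= t -> 0 <= s ->
  (forall r : R, 0 < r -> is_derive r 1 th (th' r)) ->
  (forall r, 0 <= r -> forall e, 0 < e -> exists2 d, 0 < d &
    forall s, 0 <= s -> `|s - r| < d -> `|th s - th r| <= e) ->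
  (forall r, 0 < r -> `|r - t| <= `|s - t| -> `|th' r - th' t| <= e) ->
  `|th s - th t - (s - t) * th' t| <= e * `|s - t|.
Proof.
move=> t0 s0 dth cth He.
have cont x y : 0 <= x -> {within `[x, y], continuous th}.
  move=> x0; apply/subspace_continuousP => r; rewrite /= in_itv/= => /andP[xr ry].
  apply/cvgrPdist_le => e1 e10; have [d d0 dP] := cth r (le_trans x0 xr) e1 e10.
  exists d => //= z /= zd; rewrite in_itv/= => /andP[xz _]; rewrite distrC.
  by apply: dP; [exact: le_trans x0 xz|rewrite distrC].
have [->|st] := eqVneq s t; first by rewrite !subrr mul0r subr0 normr0 mulr0.
have [st'|ts'] := ltP s t.
- have [|r] := @MVT R th th' s t st' _ (cont s t s0).
    by move=> x; rewrite in_itv/= => /andP[sx _]; apply: dth; exact: le_lt_trans sx.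
  rewrite in_itv/= => /andP[sr rt] E.
  have r0 : 0 < r by exact: le_lt_trans sr.
  have -> : th s - th t - (s - t) * th' t = (s - t) * (th' r - th' t).
    have E' : th s - th t = - (th' r * (t - s)) by rewrite -E opprB.
    by rewrite E'; ring.
  rewrite normrM mulrC ler_wpM2r//; apply: He => //.
  by rewrite !ltr0_norm ?subr_lt0// lerN2 lerD2r ltW.
- have ts : t < s by rewrite lt_neqAle eq_sym st.
  have [|r] := @MVT R th th' t s ts _ (cont t s t0).
    by move=> x; rewrite in_itv/= => /andP[sx _]; apply: dth; exact: le_lt_trans sx.
  rewrite in_itv/= => /andP[tr rs] E.
  have r0 : 0 < r by exact: le_lt_trans tr.
  have -> : th s - th t - (s - t) * th' t = (s - t) * (th' r - th' t).
    by rewrite E; ring.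
  rewrite normrM mulrC ler_wpM2r//; apply: He => //.
  by rewrite !gtr0_norm ?subr_gt0// lerD2r ltW.
Qed.

Lemma itg_abs_nrm a b (f : R -> R) : a <= b -> sq a b f ->
  `|itg a b f| <= nrm a b f * Num.sqrt (b - a).
Proof.
move=> ab sf; have := itg_CS sf (sq_cst a b 1).
rewrite (@itg_ext _ a b (fun x => f x * 1) f); last by move=> x _; rewrite mulr1.
rewrite /nrm (@itg_ext _ a b (fun=> 1 ^+ 2) (fun=> 1)); last by move=> x _; rewrite expr1n.
by rewrite itg_cst// mul1r.
Qed.

Variables (A B : R) (al : R -> R) (M : R) (ux D : R -> R -> R).
Hypothesis AB : A < B.
Hypothesis mal : meas A B al.
Hypothesis alM : aeon A B (fun x => `|al x| <= M).
Hypothesis M0 : 0 <= M.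
Hypothesis sD : forall t, 0 <= t -> sq A B (D t).
Hypothesis sux : forall t, 0 <= t -> sq A B (ux t).
Hypothesis cD : L2c A B D.
Hypothesis cux : L2c A B ux.
Hypothesis D0 : aeon A B (fun x => D 0 x = 0).
Hypothesis Hweak : forall v vx, prim A B v vx -> sq A B vx -> v A = 0 -> v B = 0 ->
  forall t : R, 0 < t -> is_derive t 1 (fun s => itg A B (fun x => D s x * v x))
    (- itg A B (fun x => al x * ux t x * vx x)).

(* The mean of Zu over [A, B] is made to evolve by the mean of al ux.  The rest of the
   difference quotient is controlled by testing the weak form with a primitive of its
   mean-free part, which vanishes at A and B. *)
Lemma flux_potential : exists Zu, [/\ forall t, 0 <= t -> prim A B (Zu t) (D t),
  L2d A B Zu (fun t x => al x * ux t x) & forall x, A <= x <= B -> Zu 0 x = 0].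
Proof.
have AB' := ltW AB; have BA : B - A != 0 by rewrite subr_eq0 gt_eqF.
have sau t : 0 <= t -> sq A B (fun x => al x * ux t x) by move=> t0; apply: sq_bM alM _ => //; exact: sux.
have caux t s : 0 <= t -> 0 <= s ->
    nrm A B (fun x => al x * ux s x - al x * ux t x) <= M * nrm A B (fun x => ux s x - ux t x).
  move=> t0 s0; rewrite (@nrm_ext _ A B _ (fun x => al x * (ux s x - ux t x))); last first.
    by move=> x _; ring.
  by apply: nrm_bM => //; apply: sqB; exact: sux.
(* [K t] will be the integral of the potential over [[A, B]]. Its derivative is continuous because
   [ux] is continuous in [L^2]. *)
have [K K00 rK] : exists2 K : R -> R, K 0 = 0 & rd K (fun t => itg A B (fun x => al x * ux t x)).
  apply: antider => t t0 e e0; pose c := M * Num.sqrt (B - A) + 1.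
  have c0 : 0 < c by rewrite ltr_wpDl// mulr_ge0// sqrtr_ge0.
  have ec : 0 < e / c by rewrite divr_gt0.
  have [d d0 dP] := cux t0 ec; exists d => // s s0 sd.
  have i1 := sq_intb (sau s s0); have i2 := sq_intb (sau t t0).
  rewrite -itgB//; apply: le_trans (itg_abs_nrm AB' _) _; first by apply: sqB; exact: sau.
  apply: le_trans (ler_wpM2r (sqrtr_ge0 _) (caux t s t0 s0)) _.
  apply: le_trans (ler_wpM2r (sqrtr_ge0 _) (ler_wpM2l M0 (dP s s0 sd))) _.
  rewrite mulrAC mulrC -mulrA ler_piMr ?(ltW e0)// mulrC ltW//.
  by rewrite ltr_pdivrMr// mul1r ltrDl.
pose P t x := itg A x (D t).
have pP t : 0 <= t -> prim A B (P t) (D t) by move=> t0; apply: prim_itg; exact: sq_intb (sD t0).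
pose kap t := (K t - itg A B (P t)) / (B - A).
pose Zu t x := P t x + kap t.
have pZ t : 0 <= t -> prim A B (Zu t) (D t).
  move=> t0; have := primD (pP t t0) (prim_cst A B (kap t)); congr prim.
  by apply: funext => x; rewrite addr0.
have mZ t : 0 <= t -> itg A B (Zu t) = K t.
  move=> t0; rewrite itgD; [|exact: prim_intb (pP t t0)|exact: intb_cst].
  by rewrite itg_cst// /kap divfK// addrC subrK.
exists Zu; split => //; last first.
  have P0 x : A <= x <= B -> P 0 x = 0.
    move=> /andP[Ax xB]; rewrite /P (@itg_ae _ A x _ (fun=> 0)) ?itg_cst ?mul0r//.
    - by apply: measS (sD (lexx _)).1.
    - exact: meas_cst.
    - exact: aeonS D0.
  move=> x xi; rewrite /Zu P0// /kap K00 (@itg_ext _ A B (P 0) (fun=> 0))//.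
  by rewrite itg_cst// mul0r subrr mul0r addr0.
move=> t t0 e e0.
pose q := Num.sqrt (B - A); have q0 : 0 <= q by exact: sqrtr_ge0.
have BA0 : 0 < B - A by rewrite subr_gt0.
(* Half of [e] is spent on the mean-free part of the defect, through [e1], and half on its mean,
   through [e2]. *)
pose e1 := e / 2 / (M + 1); have M1 : 0 < M + 1 by rewrite ltr_wpDl.
have e10 : 0 < e1 by rewrite !divr_gt0.
pose e2 := e / 2 * (B - A) / (q + 1); have q1 : 0 < q + 1 by rewrite ltr_wpDl.
have e20 : 0 < e2 by rewrite divr_gt0// mulr_gt0// divr_gt0.
have [d1 d10 d1P] := cux t0 e10; have [d2 d20 d2P] := rK t t0 _ e20.
exists (Num.min d1 d2); first by rewrite lt_min d10.
move=> s s0; rewrite lt_min => /andP[sd1 sd2].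
pose E x := Zu s x - Zu t x - (s - t) * (al x * ux t x).
have sZ r : 0 <= r -> sq A B (Zu r) by move=> r0; exact: prim_sq (pZ r r0).
have sE : sq A B E by apply: sqB; [apply: sqB; exact: sZ|apply: sqZ; exact: sau].
have iE : itg A B E = K s - K t - (s - t) * itg A B (fun x => al x * ux t x).
  have i0 := sq_intb (sau t t0).
  rewrite /E itgB; [|by apply: intbB; exact: sq_intb (sZ _ _)|exact: intbZ].
  rewrite itgB; [|exact: sq_intb (sZ _ s0)|exact: sq_intb (sZ _ t0)].
  by rewrite itgZ// !mZ.
pose Eb := itg A B E / (B - A).
pose vx x := E x - Eb.
have svx : sq A B vx by apply: sqB => //; exact: sq_cst.
have ivx : itg A B vx = 0.
  rewrite itgB; [|exact: sq_intb sE|exact: intb_cst].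
  by rewrite itg_cst// /Eb divfK// subrr.
pose v x := itg A x vx.
have pv : prim A B v vx by apply: prim_itg; exact: sq_intb svx.
have vA : v A = 0 by rewrite /v itg_pt.
have vB : v B = 0 by [].
have sv := prim_sq pv.
pose th r := itg A B (fun x => D r x * v x).
pose th' r := - itg A B (fun x => al x * ux r x * vx x).
have dth (r : R) : 0 < r -> is_derive r 1 th (th' r) by exact: Hweak pv svx vA vB r.
have B1 : `|th s - th t - (s - t) * th' t| <= (M * e1 * nrm A B vx) * `|s - t|.
  apply: mvt_bound => //.
  - move=> r r0 e' e'0; have nv : 0 < nrm A B v + 1 by rewrite ltr_wpDl ?nrm_ge0.
    have ee : 0 < e' / (nrm A B v + 1) by rewrite divr_gt0.
    have [d d0 dP] := cD r0 ee; exists d => // z z0 zd.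
    have i1 := sqM (sD z0) sv; have i2 := sqM (sD r0) sv.
    have sDD : sq A B (fun x => D z x - D r x) by apply: sqB; exact: sD.
    rewrite /th -itgB// (@itg_ext _ A B _ (fun x => (D z x - D r x) * v x)); last first.
      by move=> x _; ring.
    apply: le_trans (itg_CS sDD sv) _.
    apply: le_trans (ler_wpM2r (nrm_ge0 _ _ _) (dP z z0 zd)) _.
    by rewrite mulrAC ler_pdivrMr// ler_wpM2l ?(ltW e'0)// lerDl.
  - move=> r r0 rt; have i1 := sqM (sau r (ltW r0)) svx; have i2 := sqM (sau t t0) svx.
    rewrite /th' opprK addrC -itgB//.
    rewrite (@itg_ext _ A B _ (fun x => (al x * ux t x - al x * ux r x) * vx x)); last first.
      by move=> x _; ring.
    have sdd : sq A B (fun x => al x * ux t x - al x * ux r x).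
      by apply: sqB; [exact: sau|apply: sau; exact: ltW].
    apply: le_trans (itg_CS sdd svx) _; rewrite ler_wpM2r ?nrm_ge0//.
    apply: le_trans (caux r t (ltW r0) t0) _; rewrite ler_wpM2l//.
    have := d1P r (ltW r0) (le_lt_trans rt sd1).
    rewrite (@nrm_ext _ A B (fun x => ux t x - ux r x) (fun x => (-1) * (ux r x - ux t x))).
      rewrite nrmZ; last by apply: sqB; apply: sux => //; exact: ltW.
      by rewrite normrN normr1 mul1r.
    by move=> x _; ring.
(* Integration by parts moves the derivative from [v] to the potential. The pairing of the defect
   with [vx] thereby becomes the first-order error of [th], which [B1] bounds. *)
have E2 : itg A B (fun x => E x * vx x) = - (th s - th t - (s - t) * th' t).
  have i1 := sqM (sD s0) sv; have i2 := sqM (sD t0) sv.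
  have j1 := sqM (sau t t0) svx.
  have j2 := sqM (sZ s s0) svx; have j3 := sqM (sZ t t0) svx.
  have ib r : 0 <= r -> itg A B (fun x => Zu r x * vx x) = - th r.
    move=> r0; have := itg_by_parts AB' (pZ r r0) pv.
    rewrite vA vB !mulr0 subr0 itgD; [|exact: sqM (sD r0) sv|exact: sqM (sZ r r0) svx].
    by rewrite addrC => /eqP; rewrite addr_eq0 => /eqP.
  rewrite (@itg_ext _ A B _ (fun x => (Zu s x * vx x - Zu t x * vx x) -
     (s - t) * (al x * ux t x * vx x))); last first.
    by move=> x _; rewrite /E; move: (Zu s x) (Zu t x) (vx x) (al x * ux t x) => *; ring.
  rewrite itgB; [|exact: intbB|exact: intbZ].
  rewrite itgB// itgZ// (ib s s0) (ib t t0) /th'; move: (th s) (th t) (itg _ _ _) => u1 u2 u3; ring.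
have E3 : nrm A B vx ^+ 2 = itg A B (fun x => E x * vx x).
  rewrite nrm_sqr (@itg_ext _ A B _ (fun x => E x * vx x - Eb * vx x)); last first.
    by move=> x _; rewrite /vx; ring.
  have j1 := sqM sE svx; have j2 := sq_intb svx.
  by rewrite itgB//; [rewrite itgZ// ivx mulr0 subr0|exact: intbZ].
(* The square of this norm is at most [M * e1 * |s - t|] times the norm itself, which is divided
   out. *)
have nvx : nrm A B vx <= M * e1 * `|s - t|.
  have [->|n0] := eqVneq (nrm A B vx) 0; first by apply: mulr_ge0 => //; apply: mulr_ge0 => //; exact: ltW.
  have np : 0 < nrm A B vx by rewrite lt_def n0 nrm_ge0.
  rewrite -(ler_pM2r np) -expr2 E3 E2.
  apply: le_trans (ler_norm _) _; rewrite normrN; apply: le_trans B1 _.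
  by rewrite mulrAC.
have nEb : `|Eb| <= e2 / (B - A) * `|s - t|.
  rewrite /Eb iE normrM normfV (gtr0_norm BA0) ler_pdivrMr//.
  apply: le_trans (d2P s s0 sd2) _.
  by rewrite [leRHS]mulrAC divfK.
rewrite (@nrm_ext _ A B _ (fun x => vx x + Eb)); last first.
  by move=> x _; rewrite /vx /E subrK.
apply: le_trans (nrmD svx (sq_cst A B Eb)) _.
have nc : nrm A B (fun=> Eb) <= `|Eb| * q.
  by apply: nrm_sup => //; [exact: meas_cst|exact: aeonW].
have h0 : 0 <= `|s - t| by exact: normr_ge0.
have T1 : M * e1 * `|s - t| <= e / 2 * `|s - t|.
  rewrite ler_wpM2r// /e1 mulrCA ler_piMr ?divr_ge0 ?(ltW e0)// ltW//.
  by rewrite ltr_pdivrMr// mul1r ltrDl.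
have T2 : `|Eb| * q <= e / 2 * `|s - t|.
  apply: le_trans (ler_wpM2r q0 nEb) _; rewrite mulrAC ler_wpM2r//.
  have -> : e2 / (B - A) * q = e / 2 * (q / (q + 1)).
    by rewrite /e2; field; rewrite BA gt_eqF.
  rewrite ler_piMr ?divr_ge0 ?(ltW e0)// ltW//.
  by rewrite ltr_pdivrMr// mul1r ltrDl.
have -> : e * `|s - t| = e / 2 * `|s - t| + e / 2 * `|s - t| by field.
by apply: lerD; [exact: le_trans nvx T1|exact: le_trans nc T2].
Qed.

End FluxPotential.

(** * Real components of the two equations, and the potential of the wave *)

Section RealDecay.
Variable R : realType.
Implicit Types (a b t s A B : R) (al be F : R -> R).

(* One real component: (F1, F2) is (Re F, Im F) for the real part of the wave equation and
   (Im F, - Re F) for the imaginary part. *)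
Definition wave_re al be (om : R) F1 F2 (u ux y : R -> R -> R) : Prop :=
  [/\ forall t, 0 <= t -> forall a b, [/\ prim a b (u t) (ux t), sq a b (ux t) & sq a b (y t)],
    forall a b, [/\ L2c a b ux, L2c a b y & L2d a b u y],
    (forall x, u 0 x = 0) /\ (forall a b, aeon a b (fun x => y 0 x = 0)) &
    forall A B v vx, prim A B v vx -> sq A B vx -> v A = 0 -> v B = 0 ->
     forall t : R, 0 < t -> is_derive t 1 (fun s => itg A B (fun x => be x * y s x * v x))
      (cos (om * t) * itg A B (fun x => be x * F1 x * v x) +
       sin (om * t) * itg A B (fun x => be x * F2 x * v x) -
       itg A B (fun x => al x * ux t x * vx x))].

(* Real and imaginary parts of the Helmholtz solution and of its flux J = al U'; the last two
   clauses are the radiation condition J = +- i g om U, exact outside the source region. *)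
Definition helm_re al be (om g a b : R) F1 F2 (U1 U2 J1 J2 : R -> R) : Prop :=
  [/\ forall A B, prim A B U1 (fun x => (al x)^-1 * J1 x) /\
        prim A B U2 (fun x => (al x)^-1 * J2 x),
      forall A B, prim A B J1 (fun x => - (be x * (om ^+ 2 * U1 x + F1 x))) /\
        prim A B J2 (fun x => - (be x * (om ^+ 2 * U2 x + F2 x))),
      forall x, b <= x -> J1 x = - (g * om * U2 x) /\ J2 x = g * om * U1 x &
      forall x, x <= a -> J1 x = g * om * U2 x /\ J2 x = - (g * om * U1 x)].

Lemma rd_is_derive (f f' : R -> R) : (forall t : R, is_derive t 1 f (f' t)) -> rd f f'.
Proof.
move=> df t t0 e e0; have /is_derive_eps/(_ e e0)[d d0 dP] := df t.
by exists d => // s _; exact: dP.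
Qed.

Lemma is_derive_scale (om t : R) : is_derive t 1 (fun s : R => om * s) om.
Proof.
have dk : is_derive t 1 (fun s : R => om * s) (om *: 1) by exact: is_deriveZ.
by move: dk; rewrite /GRing.scale/= mulr1.
Qed.

Lemma is_derive_cos (om t : R) : is_derive t 1 (fun s : R => cos (om * s)) (- om * sin (om * t)).
Proof.
have := @is_derive1_comp R cos (fun s : R => om * s) t _ _ (trigo.is_derive_cos _) (is_derive_scale om t).
by rewrite /GRing.scale/= mulrC mulrN mulNr.
Qed.

Lemma is_derive_sin (om t : R) : is_derive t 1 (fun s : R => sin (om * s)) (om * cos (om * t)).
Proof.
have := @is_derive1_comp R sin (fun s : R => om * s) t _ _ (trigo.is_derive_sin _) (is_derive_scale om t).
by rewrite /GRing.scale/= mulrC.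
Qed.

Lemma rd_cos (om : R) : rd (fun t => cos (om * t)) (fun t => - om * sin (om * t)).
Proof. by apply: rd_is_derive => t; exact: is_derive_cos. Qed.

Lemma rd_sin (om : R) : rd (fun t => sin (om * t)) (fun t => om * cos (om * t)).
Proof. by apply: rd_is_derive => t; exact: is_derive_sin. Qed.

Lemma L2c_rdM a b (th th' f : R -> R) : sq a b f -> rd th th' -> L2c a b (fun t x => th t * f x).
Proof.
move=> sf H t t0 e e0; have n0 : 0 <= nrm a b f by exact: nrm_ge0.
have ee : 0 < e / (nrm a b f + 1) by rewrite divr_gt0// ltr_wpDl.
have [d d0 dP] := rd_cont H t0 ee; exists d => // s s0 sd.
rewrite (@nrm_ext _ a b _ (fun x => (th s - th t) * f x)); last by move=> x _; ring.
rewrite nrmZ//; apply: le_trans (ler_wpM2r n0 (dP s s0 sd)) _.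
by rewrite mulrAC ler_pdivrMr ?ltr_wpDl// ler_wpM2l ?(ltW e0)// lerDl.
Qed.

Lemma L2cD a b (f g : R -> R -> R) : (forall t, 0 <= t -> sq a b (f t)) ->
  (forall t, 0 <= t -> sq a b (g t)) -> L2c a b f -> L2c a b g ->
  L2c a b (fun t x => f t x + g t x).
Proof.
move=> sf sg H1 H2 t t0 e e0; have e20 : 0 < e / 2 by rewrite divr_gt0.
have [d1 d10 d1P] := H1 t t0 _ e20; have [d2 d20 d2P] := H2 t t0 _ e20.
exists (Num.min d1 d2); first by rewrite lt_min d10.
move=> s s0; rewrite lt_min => /andP[sd1 sd2].
rewrite (@nrm_ext _ a b _ (fun x => (f s x - f t x) + (g s x - g t x))); last by move=> x _; ring.
apply: le_trans (nrmD _ _) _; [by apply: sqB; exact: sf|by apply: sqB; exact: sg|].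
rewrite [leRHS](_ : _ = e / 2 + e / 2); last by field.
by apply: lerD; [exact: d1P|exact: d2P].
Qed.

Lemma L2c_bM a b (f : R -> R -> R) m k : meas a b m -> aeon a b (fun x => `|m x| <= k) -> 0 <= k ->
  (forall t, 0 <= t -> sq a b (f t)) -> L2c a b f -> L2c a b (fun t x => m x * f t x).
Proof.
move=> mm mk k0 sf H t t0 e e0.
have ee : 0 < e / (k + 1) by rewrite divr_gt0// ltr_wpDl.
have [d d0 dP] := H t t0 _ ee; exists d => // s s0 sd.
rewrite (@nrm_ext _ a b _ (fun x => m x * (f s x - f t x))); last by move=> x _; ring.
apply: le_trans (nrm_bM k0 mm mk _) _; first by apply: sqB; exact: sf.
apply: le_trans (ler_wpM2l k0 (dP s s0 sd)) _.
by rewrite mulrCA ler_piMr ?(ltW e0)// ler_pdivrMr ?ltr_wpDl// mul1r lerDl.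
Qed.

Lemma coefs_abs a b al be (m M : R) : coefs a b al be m M ->
  aeon a b (fun x => `|al x| <= M) /\ aeon a b (fun x => `|be x| <= M).
Proof.
move=> [_ _ m0 [alm bem] H]; split; apply: aeon1 H => x _ [h1 h2];
  by rewrite ger0_norm// (le_trans (ltW m0)).
Qed.

Section Potential.
Variables (al be : R -> R) (m M om : R) (F1 F2 : R -> R) (u ux y : R -> R -> R).
Hypothesis M0 : 0 <= M.
Hypothesis Hc : forall A B, coefs A B al be m M.
Hypothesis sF : forall A B, sq A B F1 /\ sq A B F2.
Hypothesis om0 : om != 0.
Hypothesis Hw : wave_re al be om F1 F2 u ux y.

(* Time primitive of the source cos (om t) F1 + sin (om t) F2. *)
Definition srcG t x : R := sin (om * t) / om * F1 x + (1 - cos (om * t)) / om * F2 x.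

(** Subtracting the time primitive of the source from the velocity makes the weak equation
    homogeneous, as [flux_potential] requires. [srcG] vanishes at time zero, so the initial datum
    stays zero. *)
Lemma wave_potential A B : A < B -> exists Zu,
  [/\ forall t, 0 <= t -> prim A B (Zu t) (fun x => be x * (y t x - srcG t x)),
    L2d A B Zu (fun t x => al x * ux t x) & forall x, A <= x <= B -> Zu 0 x = 0].
Proof.
move=> AB; have [Hs Hl [u0 y0] Hweak] := Hw; have [mal mbe m0 _ _] := Hc A B.
have [aM bM] := coefs_abs (Hc A B); have [sF1 sF2] := sF A B.
have sG t : sq A B (srcG t) by apply: sqD; exact: sqZ.
have sy t : 0 <= t -> sq A B (y t) by move=> t0; have [] := Hs t t0 A B.
have rdG1 : rd (fun t => sin (om * t) / om) (fun t => cos (om * t)).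
  apply: rd_ext (rdZ om^-1 (rd_sin om)) => t _; first by rewrite mulrC.
  by rewrite mulrA mulVf// mul1r.
have rdG2 : rd (fun t => (1 - cos (om * t)) / om) (fun t => sin (om * t)).
  apply: rd_is_derive => t.
  have d1 := @is_deriveB _ _ _ _ _ _ _ _ _ (is_derive_cst (1 : R) t 1) (is_derive_cos om t).
  have := @is_deriveZ _ _ _ _ om^-1 _ _ _ d1.
  rewrite /GRing.scale/= sub0r mulNr opprK mulrA mulVf// mul1r.
  congr is_derive; apply: funext => s.
  by change (om^-1 * (1 - cos (om * s)) = (1 - cos (om * s)) / om); exact: mulrC.
pose D t x := be x * (y t x - srcG t x).
have sD t : 0 <= t -> sq A B (D t).
  by move=> t0; apply: sq_bM mbe bM _; apply: sqB; [exact: sy|exact: sG].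
have sux t : 0 <= t -> sq A B (ux t) by move=> t0; have [] := Hs t t0 A B.
have cD : L2c A B D.
  apply: (L2c_bM mbe bM M0); first by move=> t t0; apply: sqB; [exact: sy|exact: sG].
  apply: L2cD; [exact: sy|by move=> t _; apply: sqN; exact: sG| |].
    by have [_] := Hl A B.
  have -> : (fun t x => - srcG t x) = (fun t x => (sin (om * t) / om) * (- F1 x) +
     ((1 - cos (om * t)) / om) * (- F2 x)).
    by apply: funext => t; apply: funext => x; rewrite /srcG; ring.
  apply: L2cD; try by move=> t _; apply: sqZ; exact: sqN.
    exact: L2c_rdM (sqN sF1) rdG1.
  exact: L2c_rdM (sqN sF2) rdG2.
have cux : L2c A B ux by have [] := Hl A B.
have D0 : aeon A B (fun x => D 0 x = 0).
  apply: aeon1 (y0 A B) => x _ yx; rewrite /D yx /srcG mulr0 sin0 cos0 subrr !mul0r.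
  by rewrite addr0 subr0 mulr0.
have Hwk v vx : prim A B v vx -> sq A B vx -> v A = 0 -> v B = 0 ->
    forall t : R, 0 < t -> is_derive t 1 (fun s => itg A B (fun x => D s x * v x))
    (- itg A B (fun x => al x * ux t x * vx x)).
  move=> pv svx vA vB t t0.
  have sv := prim_sq pv.
  have sb f : sq A B f -> sq A B (fun x => be x * f x) by move=> sf; exact: sq_bM mbe bM sf.
  pose I1 := itg A B (fun x => be x * F1 x * v x); pose I2 := itg A B (fun x => be x * F2 x * v x).
  have E s : 0 < s -> itg A B (fun x => be x * (y s x - srcG s x) * v x) =
     itg A B (fun x => be x * y s x * v x) - (sin (om * s) / om * I1 + (1 - cos (om * s)) / om * I2).
    move=> s0; have i0 := sqM (sb _ (sy s (ltW s0))) sv.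
    have i1 := sqM (sb _ sF1) sv; have i2 := sqM (sb _ sF2) sv.
    rewrite -(itgZ _ i1) -(itgZ _ i2) -itgD; [|exact: intbZ|exact: intbZ].
    rewrite -itgB//; last by apply: intbD; exact: intbZ.
    by apply: itg_ext => x _; rewrite /srcG; ring.
  apply: (@near_eq_is_derive _ _ _ (fun s => itg A B (fun x => be x * y s x * v x) -
     (sin (om * s) / om * I1 + (1 - cos (om * s)) / om * I2))).
    have : \forall s \near t, 0 < s by exact: lt_nbhsr.
    by apply: filterS => s s0; rewrite E.
  have d0 := Hweak A B v vx pv svx vA vB t t0.
  have d1 := rd_derive rdG1 t0; have d2 := rd_derive rdG2 t0.
  have d1' := @is_deriveZ _ _ _ _ I1 _ _ _ d1; have d2' := @is_deriveZ _ _ _ _ I2 _ _ _ d2.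
  have d3 := @is_deriveB _ _ _ _ _ _ _ _ _ d0 (@is_deriveD _ _ _ _ _ _ _ _ _ d1' d2').
  have : is_derive t 1 (fun s => itg A B (fun x => be x * y s x * v x) -
     (sin (om * s) / om * I1 + (1 - cos (om * s)) / om * I2)) 
    (cos (om * t) * I1 + sin (om * t) * I2 - itg A B (fun x => al x * ux t x * vx x) -
      (I1 *: cos (om * t) + I2 *: sin (om * t))).
    move: d3; congr is_derive; apply: funext => s.
    change (itg A B (fun x => be x * y s x * v x) -
      (I1 * (sin (om * s) / om) + I2 * ((1 - cos (om * s)) / om)) =
      itg A B (fun x => be x * y s x * v x) -
      (sin (om * s) / om * I1 + (1 - cos (om * s)) / om * I2)).
    by congr (_ - (_ + _)); exact: mulrC.
  rewrite /GRing.scale/= [I1 * _]mulrC [I2 * _]mulrC.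
  by rewrite addrAC subrr add0r.
have [Zu [h1 h2 h3]] := flux_potential AB mal aM M0 sD sux cD cux D0 Hwk.
by exists Zu.
Qed.

End Potential.

End RealDecay.

(** * Decay for one real component *)

Section Assembly.
Variable R : realType.
Implicit Types (a b t s A B : R) (al be : R -> R).

Lemma itg_zero a b (f : R -> R) : meas a b f -> aeon a b (fun x => f x = 0) -> itg a b f = 0.
Proof.
move=> mf f0; have [ab|ba] := leP a b; last first.
  by rewrite /itg set_itv_ge -?ltNge// Rintegral_set0.
rewrite (@itg_ae _ a b _ (fun=> 0)) ?itg_cst ?mul0r//; exact: meas_cst.
Qed.

Section Outgoing.
Variables (al be : R -> R) (m M om : R) (F1 F2 : R -> R) (u ux y : R -> R -> R).
Variables (a0 b0 g a b : R).
Hypothesis M0 : 0 <= M.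
Hypothesis Hc : forall A B, coefs A B al be m M.
Hypothesis sF : forall A B, sq A B F1 /\ sq A B F2.
Hypothesis om0 : om != 0.
Hypothesis Hw : wave_re al be om F1 F2 u ux y.
Hypotheses (a00 : 0 < a0) (b00 : 0 < b0) (g0 : 0 < g) (gE : g ^+ 2 = a0 * b0).
Hypothesis out : forall x, x <= a \/ b <= x -> al x = a0 /\ be x = b0.
Hypothesis F0 : forall X X', X' <= a \/ b <= X -> aeon X X' (fun x => F1 x = 0 /\ F2 x = 0).

(** [c = a0 / g] is the wave speed outside the source. The potential is built on an interval
    exceeding the window by [c * T + 1] on each side, so nothing from its artificial ends reaches
    the window before time [T]. The invariant then vanishes almost everywhere next to [A] and [B],
    hence at these points by absolute continuity. *)
Lemma wave_outgoing A B T : A < a -> a <= b -> b < B -> 0 <= T -> exists Zu,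
  [/\ forall t, 0 <= t -> prim A B (Zu t) (fun x => be x * (y t x - srcG om F1 F2 t x)),
    L2d A B Zu (fun t x => al x * ux t x), forall x, A <= x <= B -> Zu 0 x = 0 &
    forall t, 0 <= t -> t <= T -> Zu t B = - g * u t B /\ Zu t A = g * u t A].
Proof.
move=> Aa ab bB T0; pose c := a0 / g.
have c0 : 0 < c by rewrite divr_gt0.
have cg : c * g = a0 by rewrite /c divfK// gt_eqF.
have cb : c * b0 = g.
  have : g * g = a0 * b0 by rewrite -expr2.
  rewrite /c mulrAC => <-; by rewrite mulfK// gt_eqF.
pose Xl := A - c * T - 1; pose Xr := B + c * T + 1.
have cT : 0 <= c * T by rewrite mulr_ge0// ltW.
have XlA : Xl < A by rewrite /Xl; lra.
have BXr : B < Xr by rewrite /Xr; lra.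
have XlXr : Xl < Xr by lra.
have [Zu [pZ dZ Z0]] := wave_potential M0 Hc sF om0 Hw XlXr.
have [Hs Hl [u0 _] _] := Hw.
have sy t X X' : 0 <= t -> sq X X' (y t) by move=> t0; have [] := Hs t t0 X X'.
have sux t X X' : 0 <= t -> sq X X' (ux t) by move=> t0; have [] := Hs t t0 X X'.
have su t X X' : 0 <= t -> sq X X' (u t).
  by move=> t0; have [/prim_sq] := Hs t t0 X X'.
have pu t X X' : 0 <= t -> prim X X' (u t) (ux t) by move=> t0; have [] := Hs t t0 X X'.
have du X X' : L2d X X' u y by have [] := Hl X X'.
have sau t X X' : 0 <= t -> sq X X' (fun x => al x * ux t x).
  move=> t0; have [mal _ _ _ _] := Hc X X'; have [aM _] := coefs_abs (Hc X X').
  by apply: sq_bM mal aM _; exact: sux.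
have sZ t : 0 <= t -> sq Xl Xr (Zu t) by move=> /pZ/prim_sq.
have G0 X X' t : X' <= a \/ b <= X -> aeon X X' (fun x => srcG om F1 F2 t x = 0).
  by move=> /F0; apply: aeon1 => x _ [f1 f2]; rewrite /srcG f1 f2 !mulr0 addr0.
(* The two one-sided Riemann invariants s (Zu + k u), k = s g, vanish outside
   the source region because they only carry incoming information. *)
have key (sg v w p Yb : R) : Xl <= v -> w <= Xr -> v < w -> sg * sg = 1 ->
    (w <= a \/ b <= v) ->
    (forall x, v <= x <= w -> 0 <= sg * x - p) ->
    (forall t, 0 <= t -> (sg * v - p) * ramp Yb (sg * v + c * t) = 0) ->
    (forall t, 0 <= t -> (sg * w - p) * ramp Yb (sg * w + c * t) = 0) ->
    forall t, 0 <= t -> aeon v w (fun x => 0 < sg * x - p -> sg * x + c * t < Yb ->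
      Zu t x + sg * g * u t x = 0).
  move=> Xv wX vw sg2 vab rho0 bv bw t t0.
  have [sgb sgm] : aeon v w (fun x => `|(fun=> sg * g) x| <= `|sg * g|) /\ meas v w (fun=> sg * g).
    by split; [exact: aeonW|exact: meas_cst].
  pose S t x := Zu t x + sg * g * u t x.
  pose St t x := al x * ux t x + sg * g * y t x.
  pose Sx t x := be x * (y t x - srcG om F1 F2 t x) + sg * g * ux t x.
  have dZ' : L2d v w Zu (fun t x => al x * ux t x).
    by exact: (@L2dS R Xl Xr v w Zu (fun t x => al x * ux t x) Xv wX sZ (fun s hs => @sau s _ _ hs) dZ).
  have sZ' s : 0 <= s -> sq v w (Zu s) by move=> s0; exact: (sqS Xv wX (sZ s s0)).
  have sSt s : 0 <= s -> sq v w (St s).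
    by move=> s0; apply: sqD; [exact: sau|apply: sqZ; exact: sy].
  have dgu : L2d v w (fun t x => sg * g * u t x) (fun t x => sg * g * y t x).
    have su' s : 0 <= s -> sq v w (u s) by move=> s0; exact: su.
    have sy' s : 0 <= s -> sq v w (y s) by move=> s0; exact: sy.
    exact: (L2d_bM sgm sgb (normr_ge0 _) su' sy' (du v w)).
  have dS : L2d v w S St.
    exact: (@L2dD R v w Zu (fun t x => al x * ux t x) (fun t x => sg * g * u t x)
      (fun t x => sg * g * y t x) sZ' (fun s hs => @sau s _ _ hs) (fun s hs => sqZ (sg * g) (@su s _ _ hs))
      (fun s hs => sqZ (sg * g) (@sy s _ _ hs)) dZ' dgu).
  have pS s : 0 <= s -> prim v w (S s) (Sx s).
    move=> s0; apply: primD; first by exact: (primS Xv wX (pZ s s0)).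
    by apply: primZ; exact: pu.
  have SE s : 0 <= s -> aeon v w (fun x => St s x = sg * c * Sx s x).
    move=> s0; apply: aeon1 (G0 v w s vab) => x /andP[vx xw] Gx.
    have [ax bx] : al x = a0 /\ be x = b0.
      by apply: out; case: vab => [wa|bv']; [left; exact: le_trans xw wa|right; exact: le_trans bv' vx].
    rewrite /St /Sx Gx ax bx subr0.
    have -> : sg * c * (b0 * y s x + sg * g * ux s x) =
      sg * (c * b0) * y s x + sg * sg * (c * g) * ux s x by ring.
    by rewrite cb cg sg2 mul1r addrC.
  have S0 : aeon v w (fun x => S 0 x = 0).
    apply: aeonW => x /andP[vx xw]; rewrite /S u0 mulr0 addr0 Z0//.
    by rewrite (le_trans Xv vx) (le_trans xw wX).
  exact: (transport_zero vw c0 sg2 rho0 bv bw sSt dS pS SE S0 t0).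
exists Zu; split.
- by move=> t t0; apply: primS (pZ t t0); exact: ltW.
- by exact: (@L2dS R Xl Xr A B Zu (fun t x => al x * ux t x) (ltW XlA) (ltW BXr) sZ (fun s hs => @sau s _ _ hs) dZ).
- move=> x /andP[Ax xB]; apply: Z0.
  by rewrite (le_trans (ltW XlA) Ax) (le_trans xB (ltW BXr)).
move=> t t0 tT; have ct : c * t <= c * T by rewrite ler_pM2l.
have ct0 : 0 <= c * t by rewrite mulr_ge0// ltW.
split.
- have H : aeon b Xr (fun x => 0 < 1 * x - b -> 1 * x + c * t < Xr -> Zu t x + 1 * g * u t x = 0).
    apply: key => //.
    + lra.
    + lra.
    + by rewrite mulr1.
    + by right.
    + by move=> x /andP[bx _]; lra.
    + by move=> s s0; rewrite mul1r subrr mul0r.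
    + move=> s s0; rewrite /ramp max_l ?expr0n/= ?mulr0// mul1r opprD addrA subrr sub0r.
      by rewrite oppr_le0 mulr_ge0// ltW.
  (* The weight of the transport estimate vanishes at [b], so its conclusion is used on an interval
     starting strictly to the right of [b]. *)
  pose b1 := (b + B) / 2.
  have bb1 : b < b1 by rewrite /b1; lra.
  have b1B : b1 < B by rewrite /b1; lra.
  have H1 : aeon b1 B (fun x => Zu t x + g * u t x = 0).
    have := aeonS (ltW bb1) (ltW BXr) H; apply: aeon1 => x /andP[b1x xB].
    rewrite !mul1r; apply; first lra.
    by rewrite /Xr; lra.
  have pS : prim b1 B (fun x => Zu t x + g * u t x)
     (fun x => be x * (y t x - srcG om F1 F2 t x) + g * ux t x).
    by apply: primD; [apply: primS (pZ t t0); lra|apply: primZ; exact: pu].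
  have := prim_ae0 b1B pS H1; move=> /(_ B); rewrite (ltW b1B) lexx => /(_ isT)/eqP.
  by rewrite addr_eq0 mulNr => /eqP.
- have H : aeon Xl a (fun x => 0 < -1 * x - (- a) -> -1 * x + c * t < - Xl ->
      Zu t x + (-1) * g * u t x = 0).
    apply: key => //.
    + lra.
    + lra.
    + by rewrite mulrNN mulr1.
    + by left.
    + by move=> x /andP[_ xa]; lra.
    + move=> s s0; rewrite /ramp max_l ?expr0n/= ?mulr0// mulN1r.
      by have : 0 <= c * s by [rewrite mulr_ge0// ltW]; lra.
    + by move=> s s0; rewrite mulN1r subrr mul0r.
  pose a1 := (A + a) / 2.
  have a1a : a1 < a by rewrite /a1; lra.
  have Aa1 : A < a1 by rewrite /a1; lra.
  have H1 : aeon A a1 (fun x => Zu t x - g * u t x = 0).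
    have := aeonS (ltW XlA) (ltW a1a) H; apply: aeon1 => x /andP[Ax xa1].
    rewrite !mulN1r mulNr; apply; first lra.
    by rewrite /Xl; lra.
  have pS : prim A a1 (fun x => Zu t x - g * u t x)
     (fun x => be x * (y t x - srcG om F1 F2 t x) - g * ux t x).
    by apply: prim_sub; [apply: primS (pZ t t0); lra|apply: primZ; exact: pu].
  have := prim_ae0 Aa1 pS H1; move=> /(_ A); rewrite (ltW Aa1) lexx => /(_ isT)/eqP.
  by rewrite subr_eq0 => /eqP.
Qed.

End Outgoing.

Lemma real_decay al be (m M K : R) (q q' : R -> R) (p r a0 b0 g a b A B om : R) (F1 F2 : R -> R) :
  0 < M -> 0 <= K -> (forall X X', coefs X X' al be m M) -> p <= r ->
  prim p r q q' -> aeon p r (fun x => q x = al x * be x) -> aeon p r (fun x => `|q' x| <= K) ->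
  0 < a0 -> 0 < b0 -> 0 < g -> g ^+ 2 = a0 * b0 -> q p = g ^+ 2 -> q r = g ^+ 2 -> g <= 1 + M ^+ 2 ->
  A < a -> a <= p -> r <= b -> b < B ->
  (forall x, x <= p \/ r <= x -> al x = a0 /\ be x = b0) ->
  om != 0 -> (forall X X', sq X X' F1 /\ sq X X' F2) ->
  (forall X X', X' <= a \/ b <= X -> aeon X X' (fun x => F1 x = 0 /\ F2 x = 0)) ->
  forall U1 U2 J1 J2 c1, helm_re al be om g a b F1 F2 U1 U2 J1 J2 ->
  c1 = itg a b (fun x => be x * F2 x) / (2 * om * g) ->
  exists2 C, 0 < C & forall u ux y, wave_re al be om F1 F2 u ux y -> forall T, 0 <= T ->
   let E := C * expR (- (rate K m M p r / 2 * T)) in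
   [/\ nrm A B (fun x => u T x - (cos (om * T) * U1 x + sin (om * T) * U2 x) - c1) <= E,
     nrm A B (fun x => y T x + om * (sin (om * T) * U1 x - cos (om * T) * U2 x)) <= E &
     nrm A B (fun x => al x * ux T x - (sin (om * T) * J2 x + cos (om * T) * J1 x)) <= E].
Proof.
move=> M0 K0 Hc pr pq qE q'K a00 b00 g0 gE qp qr gM Aa ap rb bB out om0 sF F0 U1 U2 J1 J2 c1.
move=> [pU pJ oB oA] c1E.
have Ap : A <= p by lra.
have rB : r <= B by lra.
have AB : A <= B by lra.
have ab : a <= b by lra.
have HA : aeon A p (fun x => al x = a0 /\ be x = b0).
  by apply: aeonW => x /andP[_ xp]; apply: out; left.
have HB : aeon r B (fun x => al x = a0 /\ be x = b0).
  by apply: aeonW => x /andP[rx _]; apply: out; right.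
have [C1 C10 Hdec] := energy_decay Ap pr rB M0 K0 (Hc A B) pq qE q'K a00 b00 g0 gE qp qr gM HA HB.
have HD := decay_S C10 Hdec.
have [mal mbe m0 [alm bem] _] := Hc A B.
have [aM bM] := coefs_abs (Hc A B); have [sF1 sF2] := sF A B.
have [[pU1 pU2] [pJ1 pJ2]] := (pU A B, pJ A B).
have [sU1 sU2] := (prim_sq pU1, prim_sq pU2); have [sJ1 sJ2] := (prim_sq pJ1, prim_sq pJ2).
have sbF2 X X' : sq X X' (fun x => be x * F2 x).
  have [_ mb _ _ _] := Hc X X'; have [_ bM'] := coefs_abs (Hc X X').
  by apply: sq_bM mb bM' _; have [] := sF X X'.
(* [z0] removes the constant-in-time term [F2 / om] of [srcG]. It equals [- g * c1] at [A] and, by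
   the value of [c1], [g * c1] at [B]: exactly what shifting [Y] by [- c1] requires in the two
   outgoing relations. *)
pose z0 x := om^-1 * itg A x (fun x => be x * F2 x) - g * c1.
have pz0 : prim A B z0 (fun x => om^-1 * (be x * F2 x)).
  have := prim_sub (primZ om^-1 (prim_itg (sq_intb (sbF2 A B)))) (prim_cst A B (g * c1)).
  by congr prim; apply: funext => x; rewrite subr0.
have sz0 := prim_sq pz0.
pose Cc := Num.sqrt (2 * C1).
have Cc0 : 0 < Cc by rewrite sqrtr_gt0 mulr_gt0.
(* [N1] and [N2] are the sizes of [(Y, Z)] and [(Yt, Zt)] at time zero. The wave starts from rest,
   so they involve only the Helmholtz solution and [c1], and the constant can be chosen before
   [u]. *)
pose N1 := S2 A B (fun x => - U1 x - c1) (fun x => om^-1 * J2 x + z0 x).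
pose N2 := S2 A B (fun x => - om * U2 x) (fun x => - J1 x).
have [N10 N20] : 0 <= N1 /\ 0 <= N2 by split; exact: S2_ge0.
exists (Cc * (N1 + N2 + 1)); first by rewrite mulr_gt0// ltr_wpDl// addr_ge0.
move=> u ux y Hw T T0 E.
(* The unit of extra time is the room that [decay_deriv] needs for difference quotients. *)
have T10 : 0 <= T + 1 by rewrite addr_ge0.
have out' x : x <= a \/ b <= x -> al x = a0 /\ be x = b0.
  by case=> h; apply: out; [left; exact: le_trans h ap|right; exact: le_trans rb h].
have [Zu [pZu dZu Zu0 Zub]] := wave_outgoing (ltW M0) Hc sF om0 Hw a00 g0 gE out' F0 Aa ab bB T10.
have [Hs Hl [u0 y0] _] := Hw.
pose co t := cos (om * t); pose si t := sin (om * t).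
have rco : rd co (fun t => - om * si t) := rd_cos om.
have rsi : rd si (fun t => om * co t) := rd_sin om.
pose Y t x := u t x - (co t * U1 x + si t * U2 x) - c1.
pose Yt t x := y t x + om * (si t * U1 x - co t * U2 x).
(* The oscillating term is minus a time primitive of the flux [co * J1 + si * J2] of the
   time-harmonic wave. *)
pose Z t x := Zu t x + om^-1 * (co t * J2 x - si t * J1 x) + z0 x.
pose Zt t x := al x * ux t x - (si t * J2 x + co t * J1 x).
have sy t : 0 <= t -> sq A B (y t) by move=> t0; have [] := Hs t t0 A B.
have sux t : 0 <= t -> sq A B (ux t) by move=> t0; have [] := Hs t t0 A B.
have pu t : 0 <= t -> prim A B (u t) (ux t) by move=> t0; have [] := Hs t t0 A B.
have su t : 0 <= t -> sq A B (u t) by move=> /pu/prim_sq.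
have sau t : 0 <= t -> sq A B (fun x => al x * ux t x).
  by move=> t0; apply: sq_bM mal aM _; exact: sux.
have sZu t : 0 <= t -> sq A B (Zu t) by move=> /pZu/prim_sq.
have sYt t : 0 <= t -> sq A B (Yt t).
  by move=> t0; apply: sqD; [exact: sy|apply: sqZ; apply: sqB; exact: sqZ].
have sZt t : 0 <= t -> sq A B (Zt t).
  by move=> t0; apply: sqB; [exact: sau|apply: sqD; exact: sqZ].
have alN0 x : al x != 0 by rewrite gt_eqF// (lt_le_trans m0).
have S : pot_sol A B al be Y Z Yt Zt.
  split.
  - move=> t t0; have := prim_sub (prim_sub (pu t t0) (primD (primZ (co t) pU1) (primZ (si t) pU2)))
      (prim_cst A B c1).
    congr prim; apply: funext => x; rewrite /Zt; field; exact: alN0.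
  - move=> t t0; have := primD (primD (pZu t t0) (primZ om^-1 (prim_sub (primZ (co t) pJ2)
      (primZ (si t) pJ1)))) pz0.
    congr prim; apply: funext => x; rewrite /Yt /srcG -/(co t) -/(si t).
    by move: (y t x) (co t) (si t) (be x) (F1 x) (F2 x) (U1 x) (U2 x) => *; field.
  - by split.
  - have d1 := L2d_rdM sU1 rco; have d2 := L2d_rdM sU2 rsi; have d3 := L2d_cst A B (fun=> - c1).
    have [_ _ du] := Hl A B.
    have d1' := L2d_rdM (sqN sU1) rco; have d2' := L2d_rdM (sqN sU2) rsi.
    have s1 (th : R -> R) t : 0 <= t -> sq A B (fun x => th t * - U1 x) by move=> _; exact: sqZ (sqN _).
    have s2 (th : R -> R) t : 0 <= t -> sq A B (fun x => th t * - U2 x) by move=> _; exact: sqZ (sqN _).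
    have sc (k : R) t : 0 <= t -> sq A B (fun _ : R => k) by move=> _; exact: sq_cst.
    have e1 := L2dD su sy (s1 co) (s1 (fun t => - om * si t)) du d1'.
    have s3 t : 0 <= t -> sq A B (fun x => u t x + co t * - U1 x).
      by move=> t0; apply: sqD; [exact: su|exact: s1].
    have s4 t : 0 <= t -> sq A B (fun x => y t x + (- om * si t) * - U1 x).
      by move=> t0; apply: sqD; [exact: sy|exact: (s1 (fun t => - om * si t))].
    have e2 := L2dD s3 s4 (s2 si) (s2 (fun t => om * co t)) e1 d2'.
    have s5 t : 0 <= t -> sq A B (fun x => u t x + co t * - U1 x + si t * - U2 x).
      by move=> t0; apply: sqD; [exact: s3|exact: s2].
    have s6 t : 0 <= t -> sq A B (fun x => y t x + (- om * si t) * - U1 x + (om * co t) * - U2 x).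
      by move=> t0; apply: sqD; [exact: s4|exact: (s2 (fun t => om * co t))].
    apply: (L2d_eq _ _ (L2dD s5 s6 (sc (- c1)) (sc 0) e2 d3)) => t x; rewrite /Y /Yt.
      by move: (u t x) (co t) (si t) (U1 x) (U2 x) => *; ring.
    by move: (y t x) (co t) (si t) (U1 x) (U2 x) => *; ring.
  - have d3 := L2d_cst A B z0.
    have soJ2 := sqZ om^-1 sJ2; have soJ1 := sqZ (- om^-1) sJ1.
    have d1' := L2d_rdM soJ2 rco; have d2' := L2d_rdM soJ1 rsi.
    have s1 (th : R -> R) t : 0 <= t -> sq A B (fun x => th t * (om^-1 * J2 x)) by move=> _; exact: sqZ.
    have s2 (th : R -> R) t : 0 <= t -> sq A B (fun x => th t * (- om^-1 * J1 x)) by move=> _; exact: sqZ.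
    have sc (k : R) t : 0 <= t -> sq A B (fun _ : R => k) by move=> _; exact: sq_cst.
    have e1 := L2dD sZu sau (s1 co) (s1 (fun t => - om * si t)) dZu d1'.
    have s3 t : 0 <= t -> sq A B (fun x => Zu t x + co t * (om^-1 * J2 x)).
      by move=> t0; apply: sqD; [exact: sZu|exact: s1].
    have s4 t : 0 <= t -> sq A B (fun x => al x * ux t x + (- om * si t) * (om^-1 * J2 x)).
      by move=> t0; apply: sqD; [exact: sau|exact: (s1 (fun t => - om * si t))].
    have e2 := L2dD s3 s4 (s2 si) (s2 (fun t => om * co t)) e1 d2'.
    have s5 t : 0 <= t -> sq A B (fun x => Zu t x + co t * (om^-1 * J2 x) + si t * (- om^-1 * J1 x)).
      by move=> t0; apply: sqD; [exact: s3|exact: s2].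
    have s6 t : 0 <= t -> sq A B (fun x => al x * ux t x + (- om * si t) * (om^-1 * J2 x) +
        (om * co t) * (- om^-1 * J1 x)).
      by move=> t0; apply: sqD; [exact: s4|exact: (s2 (fun t => om * co t))].
    have sz t : 0 <= t -> sq A B z0 by [].
    apply: (L2d_eq _ _ (L2dD s5 s6 sz (sc 0) e2 d3)) => t x; rewrite /Z /Zt.
      by move: (Zu t x) (co t) (si t) (J1 x) (J2 x) (z0 x) => *; ring.
    by move: (ux t x) (co t) (si t) (J1 x) (J2 x) (al x) => *; field.
have ItgF : itg A B (fun x => be x * F2 x) = 2 * om * g * c1.
  have -> : itg A B (fun x => be x * F2 x) = itg a b (fun x => be x * F2 x).
    have i1 := sq_intb (sbF2 A B).
    rewrite (@itg_split _ A a B)//; [|exact: ltW|lra].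
    rewrite (@itg_split _ a b B)//; [|exact: ltW|by apply: intbS i1 => //; exact: ltW].
    rewrite (itg_zero (sbF2 A a).1) ?add0r; last first.
      by apply: aeon1 (F0 A a (or_introl (lexx _))) => x _ [_ ->]; rewrite mulr0.
    rewrite (itg_zero (sbF2 b B).1) ?addr0//.
    by apply: aeon1 (F0 b B (or_intror (lexx _))) => x _ [_ ->]; rewrite mulr0.
  by rewrite c1E; field; rewrite om0 gt_eqF.
have bc t : 0 <= t -> t < T + 1 -> Z t B = - g * Y t B /\ Z t A = g * Y t A.
  move=> t0 /ltW tT; have [ZB ZA] := Zub t t0 tT.
  have [j1B j2B] := oB B (ltW bB); have [j1A j2A] := oA A (ltW Aa).
  split; rewrite /Z /Y.
  - rewrite ZB j1B j2B /z0 ItgF.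
    by move: (u t B) (co t) (si t) (U1 B) (U2 B) => *; field.
  - rewrite ZA j1A j2A /z0 itg_pt.
    by move: (u t A) (co t) (si t) (U1 A) (U2 A) => *; field.
have bc' t : 0 < t -> t < T -> Z t B = - g * Y t B /\ Z t A = g * Y t A.
  by move=> t0 tT; apply: bc; [exact: ltW|apply: lt_trans tT _; rewrite ltrDl].
have D1 := HD _ _ _ _ S T T0 bc'.
have D2 := decay_deriv (ltW Cc0) HD S T0 bc.
have co0 : co 0 = 1 by rewrite /co mulr0 cos0.
have si0 : si 0 = 0 by rewrite /si mulr0 sin0.
have z00 : (0 : R) <= 0 by [].
have E1 : S2 A B (Y 0) (Z 0) = N1.
  congr (_ + _); apply: nrm_ext => x xi; rewrite /Y /Z co0 si0.
    by rewrite u0; ring.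
  by rewrite Zu0//; ring.
have ux0 : aeon A B (fun x => ux 0 x = 0).
  apply: (prim_unique (pu 0 z00)); apply: prim_ext (prim_cst A B 0) => x _.
  by rewrite u0.
have E2 : S2 A B (Yt 0) (Zt 0) = N2.
  congr (_ + _); apply: nrm_ae.
  - exact: (sYt 0 z00).1.
  - exact: measZ sU2.1.
  - by apply: aeon1 (y0 A B) => x _; rewrite /Yt co0 si0 => ->; ring.
  - exact: (sZt 0 z00).1.
  - exact: measN sJ1.1.
  - by apply: aeon1 ux0 => x _; rewrite /Zt co0 si0 => ->; ring.
rewrite -/Cc E1 in D1; rewrite -/Cc E2 in D2.
have e0 := expR_ge0 (- (rate K m M p r / 2 * T)).
have fin n : 0 <= n -> n <= N1 + N2 + 1 -> Cc * expR (- (rate K m M p r / 2 * T)) * n <= E.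
  by move=> n0 nN; rewrite /E mulrAC ler_wpM2r// ler_wpM2l// ltW.
have [N1le N2le] : N1 <= N1 + N2 + 1 /\ N2 <= N1 + N2 + 1.
  by split; [rewrite -addrA lerDl|rewrite [N1 + N2]addrC -addrA lerDl]; exact: addr_ge0.
have F1' := le_trans D1 (fin N1 N10 N1le).
have F2' := le_trans D2 (fin N2 N20 N2le).
have l1 (x x' z : R) : 0 <= x' -> x + x' <= z -> x <= z.
  by move=> x0; apply: le_trans; rewrite lerDl.
have l2 (x x' z : R) : 0 <= x -> x + x' <= z -> x' <= z.
  by move=> x0; apply: le_trans; rewrite lerDr.
split.
- exact: l1 (nrm_ge0 _ _ _) F1'.
- exact: l1 (nrm_ge0 _ _ _) F2'.
- exact: l2 (nrm_ge0 _ _ _) F2'.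
Qed.

End Assembly.

(** * Coefficients *)

Section Coefficients.
Variable R : realType.
Local Notation mu := (@lebesgue_measure R).
Implicit Types (a b p r : R) (f al be : R -> R).

Lemma Lfuny_bdd f : f \in Lfun mu +oo%E ->
  measurable_fun setT f /\ exists2 M, 0 < M & {ae mu, forall x : R, `|f x| <= M}.
Proof.
rewrite inE => /andP[/[!inE]/= mf]; rewrite /finite_norm unlock /Lnorm.
have mu0 : (0 < mu [set: R])%E.
  apply: (@lt_le_trans _ _ (mu `[0%R, 1%R])); last by apply: le_measure; rewrite ?inE.
  by rewrite lebesgue_measure_itv/= lte_fin ltr01 sube0.
rewrite mu0 => /ess_sup_inf.ess_supr_bounded[M HM]; split=> //.
exists (`|M| + 1); first by rewrite ltr_wpDl.
apply: (ae_sub HM) => x /= xM; apply: le_trans xM _.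
by rewrite (le_trans (ler_norm M))// lerDl.
Qed.

Definition admissible al be (amin bmin a0 b0 a b : R) : Prop :=
  [/\ 0 < amin /\ 0 < bmin, 0 < a0 /\ 0 < b0, a < b,
    (forall x, amin <= al x) /\ (forall x, bmin <= be x) &
    forall x, x <= a \/ b <= x -> al x = a0 /\ be x = b0].

(** [q] is the product of the absolutely continuous representatives of the coefficients, which agree
    with the coefficients themselves only almost everywhere; [K] is the product-rule bound for its
    density. *)
Lemma coef_data al be amin bmin a0 b0 p r : W1inf al -> W1inf be ->
  admissible al be amin bmin a0 b0 p r -> exists m M K q q',
  [/\ 0 < M /\ 0 <= K, forall X X', coefs X X' al be m M,
    [/\ prim p r q q', aeon p r (fun x => q x = al x * be x) & aeon p r (fun x => `|q' x| <= K)],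
    q p = a0 * b0 /\ q r = a0 * b0 & Num.sqrt (a0 * b0) <= 1 + M ^+ 2].
Proof.
move=> [/Lfuny_bdd[mal [Ma Ma0 alM]] [al' wal /Lfuny_bdd[mal' [Ka Ka0 al'K]]]].
move=> [/Lfuny_bdd[mbe [Mb Mb0 beM]] [be' wbe /Lfuny_bdd[mbe' [Kb Kb0 be'K]]]].
move=> [[am0 bm0] [a00 b00] pr [alm bem] out].
have [qa [pa aE]] := weak_prim wal; have [qb [pb bE]] := weak_prim wbe.
have pM X X' := primM (pa X X') (pb X X').
pose M := Ma + Mb; have M0 : 0 < M by rewrite addr_gt0.
exists (Num.min amin bmin), M, (Ka * Mb + Ma * Kb), (fun x => qa x * qb x),
  (fun x => al' x * qb x + qa x * be' x).
have coM X X' : aeon X X' (fun x => al x <= M /\ be x <= M).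
  apply: ae_aeon; apply: (ae_sub2 alM beM) => x h1 h2; rewrite /M; split.
    by rewrite (le_trans (ler_norm _))// (le_trans h1)// lerDl ltW.
  by rewrite (le_trans (ler_norm _))// (le_trans h2)// lerDr ltW.
(* On an interval off the core the product is almost everywhere [a0 * b0], hence everywhere,
   including the end point shared with the core. *)
have ends X X' c : X < X' -> X <= c <= X' -> (X' <= p \/ r <= X) -> qa c * qb c = a0 * b0.
  move=> XX' cX oX; apply/eqP; rewrite -subr_eq0; apply/eqP.
  have pD := prim_sub (pM X X') (prim_cst X X' (a0 * b0)).
  apply: (prim_ae0 XX' pD _ cX).
  apply: aeon2 (ae_aeon aE X X') (ae_aeon bE X X') => x /andP[Xx xX'] <- <-.
  suff [-> ->] : al x = a0 /\ be x = b0 by rewrite subrr.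
  by apply: out; case: oX => h; [left; exact: le_trans xX' h|right; exact: le_trans h Xx].
split.
- by split=> //; rewrite addr_ge0// mulr_ge0// ltW.
- move=> X X'; split => //; [exact: meas_T|exact: meas_T|by rewrite lt_min am0|].
  by split=> x; rewrite (le_trans _ (alm x), le_trans _ (bem x)) ?ge_min ?lexx ?orbT//.
- split=> //; first by apply: ae_aeon; apply: (ae_sub2 aE bE) => x -> ->.
  apply: ae_aeon; have h1 := ae_sub2 aE bE (fun x h1 h2 => conj h1 h2).
  have h2 := ae_sub2 alM beM (fun x h1 h2 => conj h1 h2).
  have h3 := ae_sub2 al'K be'K (fun x h1 h2 => conj h1 h2).
  apply: (ae_sub2 (ae_sub2 h1 h2 (fun x u v => conj u v)) h3) => x [[<- <-] [k1 k2]] [k3 k4].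
  by rewrite (le_trans (ler_normD _ _))// !normrM lerD// ler_pM.
- split.
    by apply: (ends (p - 1) p); rewrite ?lexx ?andbT; [lra|lra|left].
  by apply: (ends r (r + 1)); rewrite ?lexx; [lra|lra|right].
(* The essential bounds are compared with the constants on a unit interval left of [p]. Integrating
   the resulting constant inequality frees it from the quantifier, so that
   [Num.sqrt (a0 * b0) <= M]. *)
- have a0M : aeon (p - 1) p (fun x => (a0 * b0 - M ^+ 2 : R) <= 0).
    apply: aeon1 (coM (p - 1) p) => x /andP[_ xp] [h1 h2].
    have [E1 E2] := out x (or_introl xp); rewrite E1 in h1; rewrite E2 in h2.
    by rewrite subr_le0 expr2 ler_pM// ltW.
  have := itg_le (intb_cst (p - 1) p _) (intb_cst (p - 1) p 0) a0M.
  rewrite !itg_cst ?mul0r; [|lra|lra].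
  have -> : p - (p - 1) = 1 :> R by ring.
  rewrite mulr1 subr_le0 => h; apply: (@le_trans _ _ M).
    by have := ler_wsqrtr h; rewrite sqrtr_sqr ger0_norm// ltW.
  by have := sqr_ge0 (M - 1); rewrite !expr2; nra.
Qed.

End Coefficients.

(** * Pointwise values and essential support *)

Section PointwiseValues.
Variable R : realType.
Local Notation mu := (@lebesgue_measure R).
Implicit Types (a b p r x : R) (f g : R -> R).

Lemma aeon_ex a b (P : R -> Prop) : a < b -> aeon a b P -> exists2 x, a <= x <= b & P x.
Proof.
move=> ab H; apply: contrapT => nP.
have H0 : aeon a b (fun x => (1 : R) <= 0).
  by apply: aeon1 H => x xi Px; case: nP; exists x.
have := itg_le (intb_cst a b 1) (intb_cst a b 0) H0.
by rewrite !itg_cst ?(ltW ab)// mul0r mul1r subr_le0 leNgt ab.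
Qed.

Lemma prim_eps a b f f' x : a < x -> x < b -> prim a b f f' ->
  forall e, 0 < e -> exists2 d, 0 < d & forall y, `|y - x| < d -> `|f y - f x| <= e.
Proof.
move=> ax xb pf e e0; have ab := lt_trans ax xb.
have /continuous_within_itvP - /(_ ab)[cf _ _] := prim_cont (ltW ab) pf.
have xab : x \in `]a, b[ by rewrite in_itv/= ax.
have /cvgrPdist_le/(_ e e0)[d /= d0 dP] := cf x xab.
by exists d => // y yd; rewrite distrC; apply: dP; rewrite /= distrC.
Qed.

Lemma derive_eps f (l x : R) : is_derive x 1 f l ->
  forall e, 0 < e -> exists2 d, 0 < d & forall y, `|y - x| < d -> `|f y - f x| <= e.
Proof.
move=> df e e0; have /is_derive_eps/(_ 1 ltr01)[d d0 dP] := df.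
pose k := 1 + `|l|; have k0 : 0 < k by rewrite ltr_pwDl.
exists (Num.min d (e / k)); first by rewrite lt_min d0 divr_gt0.
move=> y; rewrite lt_min => /andP[yd]; rewrite ltr_pdivlMr// => ye.
have := dP y yd; rewrite mul1r => H; apply: le_trans (ltW ye); rewrite /k mulrDr mulr1.
have -> : f y - f x = f y - f x - (y - x) * l + (y - x) * l by ring.
by rewrite (le_trans (ler_normD _ _))// lerD// normrM.
Qed.

Lemma eps_ae0 a b f x : a < x -> x < b ->
  (forall e, 0 < e -> exists2 d, 0 < d & forall y, `|y - x| < d -> `|f y - f x| <= e) ->
  aeon a b (fun x => f x = 0) -> f x = 0.
Proof.
move=> ax xb cf f0; apply/eqP; apply: contraT => fx0.
have e0 : 0 < `|f x| / 2 by rewrite divr_gt0// normr_gt0.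
have [d d0 dP] := cf _ e0.
pose w := Num.min b (x + d / 2).
have xw : x < w by rewrite lt_min xb ltrDl divr_gt0.
have wb : w <= b by rewrite ge_min lexx.
have [y /andP[xy yw] fy] := aeon_ex xw (aeonS (ltW ax) wb f0).
have yd : `|y - x| < d.
  rewrite ger0_norm ?subr_ge0// ltrBlDl (le_lt_trans yw)//.
  by rewrite gt_min; apply/orP; right; rewrite ltrD2l ltr_pdivrMr// mulr_natr mulr2n ltrDl.
have := dP y yd; rewrite fy sub0r normrN ler_pdivlMr// mulr_natr mulr2n.
by rewrite gerDl leNgt normr_gt0 fx0.
Qed.

Lemma prim_derive a b f f' x : a < x -> x < b -> prim a b f f' ->
  (forall e, 0 < e -> exists2 d, 0 < d & forall y, `|y - x| < d -> `|f' y - f' x| <= e) ->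
  is_derive x 1 f (f' x).
Proof.
move=> ax xb pf cf; apply/is_derive_eps => e e0; have [d d0 dP] := cf e e0.
exists (Num.min d (Num.min (x - a) (b - x))).
  by rewrite !lt_min d0 !subr_gt0 ax xb.
have [if' _] := pf.
have main v w : v <= w -> a <= v -> w <= b -> `|v - x| < d -> `|w - x| < d ->
    v <= x <= w -> `|f w - f v - (w - v) * f' x| <= e * (w - v).
  move=> vw av wb vd wd /andP[vx xw].
  have ivw : intb v w f' by exact: intbS if'.
  rewrite (primB pf av vw wb) [_ * f' x]mulrC -itg_cst// -itgB//; last exact: intb_cst.
  have iB : intb v w (fun y => f' y - f' x) by apply: intbB => //; exact: intb_cst.
  apply: le_trans (itg_abs iB) _; rewrite -itg_cst//.
  apply: itg_le; [exact: intb_abs|exact: intb_cst|].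
  apply: aeonW => y /andP[vy yw]; apply: dP.
  by move: vd wd; rewrite !ltr_norml => /andP[? ?] /andP[? ?]; apply/andP; split; lra.
move=> y; rewrite !lt_min => /and3P[yd ya yb].
have [xy|yx] := leP x y.
- rewrite [`|y - x|]ger0_norm ?subr_ge0//; apply: main => //.
  + exact: ltW.
  + by move: yb; rewrite ltr_norml => /andP[_ h]; lra.
  + by rewrite subrr normr0.
  + by rewrite lexx.
- rewrite [`|y - x|]ler0_norm ?subr_le0 ?(ltW yx)//.
  rewrite (_ : f y - f x - (y - x) * f' x = - (f x - f y - (x - y) * f' x)); last by ring.
  rewrite normrN opprB; apply: main => //.
  + exact: ltW.
  + by move: ya; rewrite ltr_norml => /andP[h _]; lra.
  + exact: ltW.
  + by rewrite subrr normr0.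
  + by rewrite lexx andbT ltW.
Qed.

(** A Lindelof argument: off the essential support every point lies in an interval with rational
    ends on which [F] vanishes almost everywhere, and there are countably many of these, enumerated
    by [unpickle]. *)
Lemma ess_support_ae (F : R -> R[i]) a b : ess_support F `<=` `]a, b[%classic ->
  {ae mu, forall x : R, x <= a \/ b <= x -> F x = 0}.
Proof.
move=> sF.
pose P (n : nat) (x : R) := forall q : rat * rat, unpickle n = Some q ->
  {ae mu, forall y : R, ratr q.1 < y < ratr q.2 -> F y = 0} ->
  ratr q.1 < x < ratr q.2 -> F x = 0.
have HP n : {ae mu, forall x : R, P n x}.
  case E : (unpickle n) => [q|]; last first.
    by apply: (ae_sub (aeonW (a := 0) (b := 0) (P := fun=> True) (fun _ _ => I))) => x _ q; rewrite E.
  have [H|nH] := pselect {ae mu, forall y : R, ratr q.1 < y < ratr q.2 -> F y = 0}.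
    by apply: (ae_sub H) => x /= Hx q'; rewrite E => -[<-] _.
  by apply: (ae_sub (aeonW (a := 0) (b := 0) (P := fun=> True) (fun _ _ => I))) => x _ q'; rewrite E => -[<-].
have /ae_foralln H := HP; apply: (ae_sub H) => x Hx xo.
have : ~ ess_support F x.
  move=> /sF; rewrite /= in_itv/= => /andP[ax xb].
  by case: xo => [xa|bx]; [move: ax; rewrite ltNge xa|move: xb; rewrite ltNge bx].
rewrite /ess_support /= => /existsNP[V] /not_implyP[[d /= d0 dV]] /contrapT VF.
have [q1 q1P] := @rat_in_itvoo R (x - d) x (ltac:(by rewrite ltrBlDr ltrDl)).
have [q2 q2P] := @rat_in_itvoo R x (x + d) (ltac:(by rewrite ltrDl)).
move: q1P q2P; rewrite !in_itv/= => /andP[l1 u1] /andP[l2 u2].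
apply: (Hx (pickle (q1, q2)) (q1, q2)); first by rewrite pickleK.
- apply: (ae_sub VF) => y /= Vy /andP[y1 y2]; apply: Vy; apply: dV => /=.
  by rewrite ltr_norml; apply/andP; split; lra.
- by rewrite /= u1 l2.
Qed.

End PointwiseValues.

(** * The Helmholtz equation *)

Section ComplexParts.
Local Open Scope complex_scope.
Variable R : realType.
Implicit Types (c : R) (z : R[i]).

Lemma Re_rM c z : complex.Re (c%:C * z) = c * complex.Re z.
Proof. by case: z => u v /=; rewrite mul0r subr0. Qed.

Lemma Im_rM c z : complex.Im (c%:C * z) = c * complex.Im z.
Proof. by case: z => u v /=; rewrite mul0r addr0. Qed.

Lemma ReB z1 z2 : complex.Re (z1 - z2) = complex.Re z1 - complex.Re z2.
Proof. by case: z1 z2 => ? ? []. Qed.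

Lemma ImB z1 z2 : complex.Im (z1 - z2) = complex.Im z1 - complex.Im z2.
Proof. by case: z1 z2 => ? ? []. Qed.

End ComplexParts.

Section Helmholtz.
Local Open Scope complex_scope.
Variable R : realType.
Local Notation mu := (@lebesgue_measure R).
Implicit Types (a b v w x y s k : R) (P Q V dV : R -> R).

(* Outside the source region the radiation defect J -+ i g om U has constant modulus. *)
Lemma rotation_norm v w k P Q : v <= w -> prim v w P (fun x => k * Q x) ->
  prim v w Q (fun x => - k * P x) -> P w ^+ 2 + Q w ^+ 2 = P v ^+ 2 + Q v ^+ 2.
Proof.
move=> vw pP pQ; have [_ H] := primD (primM pP pP) (primM pQ pQ).
rewrite !expr2 (H w) ?vw ?lexx//.
rewrite (@itg_ext _ v w _ (fun=> 0)) ?itg_cst// ?mul0r ?addr0//.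
by move=> x _; ring.
Qed.

(** Identifies the classical representative of the radiation condition with the absolutely
    continuous one, together with the derivatives. Both are continuous and agree almost everywhere,
    and [U] is differentiable at [y] because its density is continuous there. *)
Lemma classical_rep v w y V dV U h : v < y -> y < w ->
  (forall x, v < x < w -> is_derive x 1 V (dV x)) ->
  aeon v w (fun x => V x = U x) -> prim v w U h ->
  (forall e, 0 < e -> exists2 d, 0 < d & forall x, `|x - y| < d -> `|h x - h y| <= e) ->
  V y = U y /\ dV y = h y.
Proof.
move=> vy yw dVx VU pU ch.
have E x : v < x -> x < w -> V x = U x.
  move=> vx xw; apply/eqP; rewrite -subr_eq0; apply/eqP.
  apply: (@eps_ae0 _ v w (fun x => V x - U x) x vx xw); last first.
    by apply: aeon1 VU => z _ ->; rewrite subrr.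
  move=> e e0; have e20 : 0 < e / 2 by rewrite divr_gt0.
  have dx : is_derive x 1 V (dV x) by apply: dVx; rewrite vx.
  have [d1 d10 d1P] := derive_eps dx e20.
  have [d2 d20 d2P] := prim_eps vx xw pU e20.
  exists (Num.min d1 d2); first by rewrite lt_min d10.
  move=> z; rewrite lt_min => /andP[z1 z2].
  rewrite (_ : V z - U z - (V x - U x) = (V z - V x) - (U z - U x)); last by ring.
  rewrite (le_trans (ler_normB _ _))// [leRHS](_ : e = e / 2 + e / 2); last by field.
  by rewrite lerD ?d1P ?d2P.
split; first exact: E.
have d1 : is_derive y 1 V (dV y) by apply: dVx; rewrite vy.
have d2 : is_derive y 1 V (h y).
  apply: near_eq_is_derive (prim_derive vy yw pU ch).
  have : \forall x \near y, v < x /\ x < w.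
    by apply: filterI; [exact: lt_nbhsr|exact: lt_nbhsl].
  by apply: filterS => x [vx xw]; rewrite E.
by rewrite -(@derive_val _ _ _ _ _ _ _ d1) (@derive_val _ _ _ _ _ _ _ d2).
Qed.

(** In complex form, with [J = a0 dV] and [U = V]: [J - i s a0 k U] is [s * a0] times the radiation
    expression, since [s * s = 1]. *)
Lemma rad_sqr (s k a0 : R) (V dV : R[i]) U1 U2 (J1 J2 : R) : s * s = 1 -> a0 != 0 ->
  complex.Re V = U1 -> complex.Im V = U2 -> complex.Re dV = a0^-1 * J1 ->
  complex.Im dV = a0^-1 * J2 ->
  (J1 + s * (a0 * k) * U2) ^+ 2 + (J2 - s * (a0 * k) * U1) ^+ 2 =
  a0 ^+ 2 * Normc.normc (s%:C * dV - 'i%C * k%:C * V) ^+ 2.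
Proof.
move=> ss a0N; case: V dV => [v1 v2] [d1 d2] /= -> -> -> ->.
rewrite sqr_sqrtr ?addr_ge0 ?sqr_ge0//.
have -> : (J1 + s * (a0 * k) * U2) ^+ 2 + (J2 - s * (a0 * k) * U1) ^+ 2 =
  (s * s) * ((J1 + s * (a0 * k) * U2) ^+ 2 + (J2 - s * (a0 * k) * U1) ^+ 2) by rewrite ss mul1r.
have -> : (s * s) * ((J1 + s * (a0 * k) * U2) ^+ 2 + (J2 - s * (a0 * k) * U1) ^+ 2) =
  (s * J1 + (s * s) * (a0 * k) * U2) ^+ 2 + (s * J2 - (s * s) * (a0 * k) * U1) ^+ 2 by ring.
by rewrite ss; field.
Qed.

Lemma sqr_sum0 (p q : R) : p ^+ 2 + q ^+ 2 = 0 -> p = 0 /\ q = 0.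
Proof.
move=> /eqP; rewrite paddr_eq0 ?sqr_ge0// !sqrf_eq0 => /andP[/eqP -> /eqP ->].
by [].
Qed.

(** On each side of the source the modulus of the outgoing defect is constant ([rot]), and it is
    [a0] times the radiation expression ([value]), which tends to zero at infinity. So the radiation
    condition, an asymptotic statement, holds exactly at every point outside the source. *)
Lemma helm_extract al be (m M a0 b0 g a b om : R) (F U : R -> R[i]) :
  (forall X X', coefs X X' al be m M) -> 0 < a0 -> 0 < b0 -> 0 < g -> g ^+ 2 = a0 * b0 ->
  (forall x, x <= a \/ b <= x -> al x = a0 /\ be x = b0) ->
  (forall X X', sq X X' (re F) /\ sq X X' (im F)) ->
  {ae mu, forall x : R, x <= a \/ b <= x -> F x = 0} ->
  helmholtz_sol al be a0 b0 `]a, b[%classic om F U ->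
  exists U1 U2 J1 J2, helm_re al be om g a b (re F) (im F) U1 U2 J1 J2 /\
    {ae mu, forall x : R, re U x = U1 x /\ im U x = U2 x}.
Proof.
move=> Hc a00 b00 g0 gE out sF F0 [[_ wU _ _ _] wJ eqn rad].
have [wU1 wU2] := wderivP wU; have [wJ1 wJ2] := wderivP wJ.
have [U1 [pU1 U1E]] := weak_prim wU1; have [U2 [pU2 U2E]] := weak_prim wU2.
have [J1 [pJ1 J1E]] := weak_prim wJ1; have [J2 [pJ2 J2E]] := weak_prim wJ2.
set W := wderiv setT U in wU1 wU2 pU1 pU2 wJ1 wJ2 pJ1 pJ2 J1E J2E eqn.
set flux := (fun x => _ * W x) in wJ1 wJ2 pJ1 pJ2 J1E J2E eqn.
set W' := wderiv setT flux in wJ1 wJ2 pJ1 pJ2 eqn.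
have [_ _ m0 [alm bem] _] := Hc 0 0.
have al0 x : 0 < al x := lt_le_trans m0 (alm x).
have be0 x : 0 < be x := lt_le_trans m0 (bem x).
have mai X X' : meas X X' (fun x => (al x)^-1) by have [? _ _ _ _] := Hc X X'; exact: meas_inv m0 alm _.
have mbe X X' : meas X X' be by have [_ ? _ _ _] := Hc X X'.
have sU1 X X' := prim_sq (pU1 X X'); have sU2 X X' := prim_sq (pU2 X X').
have sJ1 X X' := prim_sq (pJ1 X X'); have sJ2 X X' := prim_sq (pJ2 X X').
have pU X X' : prim X X' U1 (fun x => (al x)^-1 * J1 x) /\ prim X X' U2 (fun x => (al x)^-1 * J2 x).
  split; [apply: prim_ae (pU1 X X')|apply: prim_ae (pU2 X X')];
    try (by apply: measM; [exact: mai|exact: (sJ1 X X').1 || exact: (sJ2 X X').1]).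
  - apply: aeon1 (ae_aeon J1E X X') => x _ <-.
    by rewrite /re /flux Re_rM mulrA mulVf ?mul1r// gt_eqF.
  - apply: aeon1 (ae_aeon J2E X X') => x _ <-.
    by rewrite /im /flux Im_rM mulrA mulVf ?mul1r// gt_eqF.
have eqR : {ae mu, forall x : R, complex.Re (W' x) = - (be x * (om ^+ 2 * U1 x + re F x)) /\
    complex.Im (W' x) = - (be x * (om ^+ 2 * U2 x + im F x))}.
  apply: (ae_sub2 (ae_sub2 U1E U2E (fun x h1 h2 => conj h1 h2)) eqn) => x [<- <-] E.
  have bN : be x != 0 by rewrite gt_eqF.
  split.
  - have := congr1 (@complex.Re R) E; rewrite ReB mulNr raddfN/= !Re_rM /re => <-.
    by field.
  - have := congr1 (@complex.Im R) E; rewrite ImB mulNr raddfN/= !Im_rM /im => <-.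
    by field.
have pJ X X' : prim X X' J1 (fun x => - (be x * (om ^+ 2 * U1 x + re F x))) /\
    prim X X' J2 (fun x => - (be x * (om ^+ 2 * U2 x + im F x))).
  have [[mF1 _] [mF2 _]] := sF X X'.
  split; [apply: prim_ae (pJ1 X X')|apply: prim_ae (pJ2 X X')].
  - exact: (measN (measM (mbe X X') (measD (measZ _ (sU1 X X').1) mF1))).
  - apply: ae_aeon; exact: (ae_sub eqR (fun x h => h.1)).
  - exact: (measN (measM (mbe X X') (measD (measZ _ (sU2 X X').1) mF2))).
  - apply: ae_aeon; exact: (ae_sub eqR (fun x h => h.2)).
have [V [dV [UV dVP Vp Vm]]] := rad.
pose k := om * Num.sqrt (b0 / a0); rewrite -/k in Vp Vm.
(* The impedance [g] is [a0] times the slowness [sqrt (b0 / a0)]; this matches the wave number [k]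
   of the radiation condition with the factor [g * om] of [helm_re]. *)
have gs : g = a0 * Num.sqrt (b0 / a0).
  apply/eqP; rewrite -(@eqrXn2 _ 2)//; [|exact: ltW|by rewrite mulr_ge0 ?sqrtr_ge0// ltW].
  rewrite gE exprMn sqr_sqrtr; last by rewrite divr_ge0// ltW.
  by apply/eqP; field; rewrite gt_eqF.
have ak : a0 * k = g * om by rewrite gs /k; ring.
have akk : a0 * (k * k) = b0 * om ^+ 2.
  apply: (mulfI (lt0r_neq0 a00)); rewrite (_ : a0 * (a0 * (k * k)) = (a0 * k) ^+ 2); last by ring.
  by rewrite ak exprMn gE; ring.
pose PQ s x := (J1 x + s * (a0 * k) * U2 x) ^+ 2 + (J2 x - s * (a0 * k) * U1 x) ^+ 2.
pose L x := Normc.normc ((Num.sg x)%:C * dV x - 'i%C * k%:C * V x).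
have value s v w y : s * s = 1 -> v < y -> y < w -> (w <= a \/ b <= v) -> Num.sg y = s ->
    PQ s y = a0 ^+ 2 * L y ^+ 2.
  move=> ss vy yw vab sy.
  have oc x : v < x < w -> ~ closure `]a, b[%classic x.
    move=> /andP[vx xw] /itv_closure; rewrite /= in_itv/= => /andP[ax xb].
    case: vab => h; [have := lt_le_trans xw h|have := le_lt_trans h vx].
      by rewrite ltNge ax.
    by rewrite ltNge xb.
  have pp (X J : R -> R) : prim v w X (fun x => (al x)^-1 * J x) -> meas v w J ->
      prim v w X (fun x => a0^-1 * J x).
    move=> pX mJ; apply: prim_ae pX; first exact: measZ.
    apply: aeonW => x /andP[vx xw].
    suff [-> _] : al x = a0 /\ be x = b0 by [].
    by apply: out; case: vab => h; [left; exact: le_trans xw h|right; exact: le_trans h vx].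
  have ceps (J J' : R -> R) : prim v w J J' -> forall e, 0 < e -> exists2 d, 0 < d &
      forall x, `|x - y| < d -> `|a0^-1 * J x - a0^-1 * J y| <= e.
    move=> pj e e0; have [d d0 dP] := prim_eps vy yw pj (mulr_gt0 a00 e0).
    exists d => // x xd; rewrite -mulrBr normrM gtr0_norm ?invr_gt0//.
    by rewrite ler_pdivrMl// dP.
  have [E1 D1] := @classical_rep v w y (re V) (fun x => complex.Re (dV x)) U1 _ vy yw
    (fun x xi => (dVP x (oc x xi)).1) (ae_aeon (ae_sub2 UV U1E (fun x (h1 : U x = V x) h2 =>
      etrans (esym (congr1 (@complex.Re R) h1)) h2)) v w) (pp _ _ (pU v w).1 (sJ1 v w).1)
      (ceps _ _ (pJ v w).1).
  have [E2 D2] := @classical_rep v w y (im V) (fun x => complex.Im (dV x)) U2 _ vy yw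
    (fun x xi => (dVP x (oc x xi)).2) (ae_aeon (ae_sub2 UV U2E (fun x (h1 : U x = V x) h2 =>
      etrans (esym (congr1 (@complex.Im R) h1)) h2)) v w) (pp _ _ (pU v w).2 (sJ2 v w).1)
      (ceps _ _ (pJ v w).2).
  by rewrite /PQ /L sy; apply: (rad_sqr _ ss _ E1 E2 D1 D2); rewrite gt_eqF.
have rot s v w : s * s = 1 -> v <= w -> (w <= a \/ b <= v) -> PQ s w = PQ s v.
  move=> ss vw vab.
  have aeo : aeon v w (fun x => [/\ al x = a0, be x = b0, re F x = 0 & im F x = 0]).
    apply: aeon1 (ae_aeon F0 v w) => x /andP[vx xw] Fx.
    have xo : x <= a \/ b <= x.
      by case: vab => h; [left; exact: le_trans xw h|right; exact: le_trans h vx].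
    by have [-> ->] := out x xo; rewrite /re /im (Fx xo).
  have mP := (primD (pJ1 v w) (primZ (s * (a0 * k)) (pU2 v w))).
  have mQ := (prim_sub (pJ2 v w) (primZ (s * (a0 * k)) (pU1 v w))).
  apply: (@rotation_norm v w (s * k) (fun x => J1 x + s * (a0 * k) * U2 x)
    (fun x => J2 x - s * (a0 * k) * U1 x)) => //.
  - apply: prim_ae (primD (pJ v w).1 (primZ (s * (a0 * k)) (pU v w).2)).
      by apply: measZ; exact: prim_meas mQ.
    apply: aeon1 aeo => x _ [-> -> -> _].
    have -> : s * k * (J2 x - s * (a0 * k) * U1 x) = s * k * J2 x - (s * s) * (a0 * (k * k)) * U1 x by ring.
    by rewrite ss akk; field; rewrite gt_eqF.
  - apply: prim_ae (prim_sub (pJ v w).2 (primZ (s * (a0 * k)) (pU v w).1)).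
      by apply: measZ; exact: prim_meas mP.
    apply: aeon1 aeo => x _ [-> -> _ ->].
    have -> : - (s * k) * (J1 x + s * (a0 * k) * U2 x) =
       - (s * k * J1 x) - (s * s) * (a0 * (k * k)) * U2 x by ring.
    by rewrite ss akk; field; rewrite gt_eqF.
have small z : 0 <= z -> (forall e, 0 < e -> z <= a0 ^+ 2 * e ^+ 2) -> z = 0.
  move=> z0 H; apply/eqP; rewrite eq_le z0 andbT leNgt; apply/negP => zp.
  pose e := Num.sqrt (z / 2) / a0.
  have e0 : 0 < e by rewrite divr_gt0// sqrtr_gt0 divr_gt0.
  have := H e e0; rewrite /e expr_div_n sqr_sqrtr ?divr_ge0// mulrC divfK; last first.
    by rewrite expf_neq0// gt_eqF.
  by rewrite leNgt ltr_pdivrMr// mulr_natr mulr2n ltrDl zp.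
have PQ0 s x : 0 <= PQ s x by rewrite addr_ge0 ?sqr_ge0.
have Lge0 x : 0 <= L x by rewrite /L; case: (_ - _) => p q /=; rewrite sqrtr_ge0.
have Lsmall x e : 0 < e -> `|0 - L x| < e -> a0 ^+ 2 * L x ^+ 2 <= a0 ^+ 2 * e ^+ 2.
  move=> e0; rewrite sub0r normrN ger0_norm// => /ltW Le.
  by rewrite ler_wpM2l ?sqr_ge0// ler_sqr ?nnegrE// ltW.
have right x : b <= x -> PQ 1 x = 0.
  move=> bx; apply: small => // e e0.
  have /cvgrPdist_lt/(_ e e0)[N [_ HN]] := Vp.
  pose y := `|x| + `|N| + 1.
  have [xy Ny y0] : [/\ x < y, N < y & 0 < y].
    have := ler_norm x; have := ler_norm N; have := normr_ge0 x; have := normr_ge0 N.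
    by rewrite /y => *; split; lra.
  rewrite -(rot 1 x y) ?mulr1 ?(ltW xy)//; last by right.
  rewrite (value 1 x (y + 1) y) ?mulr1//; [|by rewrite ltrDl|by right|by rewrite gtr0_sg].
  by apply: Lsmall => //; exact: HN.
have left x : x <= a -> PQ (-1) x = 0.
  move=> xa; apply: small => // e e0.
  have /cvgrPdist_lt/(_ e e0)[N [_ HN]] := Vm.
  pose y := - (`|x| + `|N| + 1).
  have [yx yN y0] : [/\ y < x, y < N & y < 0].
    have := ler_norm (- x); have := ler_norm (- N); rewrite !normrN; have := normr_ge0 x; have := normr_ge0 N.
    by rewrite /y => *; split; lra.
  rewrite (rot (-1) y x) ?mulrNN ?mulr1 ?(ltW yx)//; last by left.
  rewrite (value (-1) (y - 1) x y) ?mulrNN ?mulr1//; [|by rewrite ltrBlDr ltrDl|by left|by rewrite ltr0_sg].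
  by apply: Lsmall => //; exact: HN.
exists U1, U2, J1, J2; split; last exact: (ae_sub2 U1E U2E).
split => // x hx.
- have /sqr_sum0[] := right x hx; rewrite mul1r ak => h1 h2; split; lra.
- have /sqr_sum0[] := left x hx; rewrite mulN1r ak => h1 h2; split; lra.
Qed.

End Helmholtz.

(** * The weak wave equation *)

Section Extension.
Local Open Scope complex_scope.
Variable R : realType.
Local Notation mu := (@lebesgue_measure R).
Implicit Types (a b c A B X x : R) (f g v vx : R -> R).

Lemma Lfun2_intro f : measurable_fun setT f ->
  mu.-integrable setT (EFin \o (fun x => f x ^+ 2)) -> f \in Lfun mu 2%:E.
Proof.
move=> mf if2; rewrite inE; apply/andP; split; rewrite inE//=.
rewrite /finite_norm unlock /Lnorm poweR_lty//.
have /integrable_lty : mu.-integrable setT (EFin \o (fun x => f x ^+ 2)) by [].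
move=> /(_ (@measurableT _ _)); congr (_ < _)%E; apply: eq_integral => x _ /=.
by rewrite powR_mulrn ?normr_ge0// real_normK// num_real.
Qed.

Lemma integrable_ae_eq f g : measurable_fun setT g -> mu.-integrable setT (EFin \o f) ->
  {ae mu, forall x : R, f x = g x} -> mu.-integrable setT (EFin \o g).
Proof.
move=> mg /integrableP[mf fi] fg; apply/integrableP; split; first exact/measurable_EFinP.
apply: le_lt_trans fi; apply: ae_ge0_le_integral => //.
- by apply: measurableT_comp => //; exact/measurable_EFinP.
- exact: measurableT_comp.
- by apply: (ae_sub fg) => x /= <- _.
Qed.

Lemma aeon_neq c a b : aeon a b (fun x => x != c).
Proof.
exists [set c]; split => //; first exact: lebesgue_measure_set1.
move=> x /= /not_implyP[_]; by case: eqVneq.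
Qed.

Lemma prim_glue a c b f f' : a <= c -> c <= b -> intb a b f' ->
  prim a c f f' -> prim c b f f' -> prim a b f f'.
Proof.
move=> ac cb i [i1 H1] [i2 H2]; split => // x /andP[ax xb].
have [xc|cx] := leP x c; first by apply: H1; rewrite ax.
rewrite (H2 x) ?(ltW cx)// (H1 c) ?ac ?lexx// -addrA -itg_split ?(ltW cx)//.
exact: intbS i.
Qed.

Definition restr A B v x : R := if A <= x <= B then v x else 0.

Lemma restrE A B v : restr A B v = v \_ `[A, B]%classic.
Proof.
apply: funext => x; rewrite /restr patchE; case: ifPn => xi; case: ifPn => //.
  by rewrite notin_setE /= in_itv/= xi.
by rewrite inE /= in_itv/= (negbTE xi).
Qed.

Lemma restr_meas A B v : meas A B v -> measurable_fun setT (restr A B v).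
Proof. by move=> mv; rewrite restrE; apply/(measurable_restrictT _ (mitv A B)). Qed.

Lemma restr_int A B v : intb A B v -> mu.-integrable setT (EFin \o restr A B v).
Proof. by move=> /intb_restrict; rewrite restrE. Qed.

Lemma restr_Lfun A B v : sq A B v -> restr A B v \in Lfun mu 2%:E.
Proof.
move=> [mv iv]; apply: Lfun2_intro; first exact: restr_meas.
have -> : (fun x => restr A B v x ^+ 2) = restr A B (fun x => v x ^+ 2).
  by apply: funext => x; rewrite /restr; case: ifP => //; rewrite expr0n.
exact: restr_int.
Qed.

(** Vanishing end values make the extension by zero absolutely continuous across [A] and [B]; the
    three pieces are glued. At [A] and [B] themselves the restricted density may be nonzero, which
    is harmless on a null set. *)
Lemma prim_restr A B v vx : A <= B -> prim A B v vx -> v A = 0 -> v B = 0 ->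
  forall a b, prim a b (restr A B v) (restr A B vx).
Proof.
move=> AB pv vA vB a b.
have ivx c d : intb c d (restr A B vx).
  by have [/restr_int i _] := pv; apply: integrableS i.
pose L := Num.min a A; pose H := Num.max b B.
have LA : L <= A by rewrite ge_min lexx orbT.
have BH : B <= H by rewrite le_max lexx orbT.
have zero c d : (d <= A \/ B <= c) -> prim c d (restr A B v) (restr A B vx).
  move=> cd; apply: (@prim_ae _ c d _ (fun=> 0)); first exact: intb_meas.
    apply: (aeon2 _ (aeon_neq A c d) (aeon_neq B c d)) => x /andP[cx xd] xA xB.
    rewrite /restr; case: ifP => // /andP[Ax xB']; case: cd => h.
      by move: xA; rewrite eq_le Ax (le_trans xd h).
    by move: xB; rewrite eq_le xB' (le_trans h cx).
  apply: (prim_ext _ (prim_cst c d 0)) => x /andP[cx xd].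
  rewrite /restr; case: ifP => // /andP[Ax xB]; case: cd => h.
    by rewrite (_ : x = A)//; apply/eqP; rewrite eq_le Ax (le_trans xd h).
  by rewrite (_ : x = B)//; apply/eqP; rewrite eq_le xB (le_trans h cx).
have mid : prim A B (restr A B v) (restr A B vx).
  apply: (@prim_ae _ A B _ vx); first exact: intb_meas.
    by apply: aeonW => x xi; rewrite /restr xi.
  by apply: prim_ext pv => x xi; rewrite /restr xi.
have pLH : prim L H (restr A B v) (restr A B vx).
  apply: (@prim_glue L B H) => //; [exact: le_trans LA AB| |by apply: zero; right].
  by apply: (@prim_glue L A B) => //; apply: zero; left.
by apply: primS pLH; rewrite ?ge_min ?le_max lexx.
Qed.

Lemma weak_meas Om f g : is_weak_deriv Om f g -> measurable_fun Om f /\ measurable_fun Om g.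
Proof. by move=> [[? _ _] [? _ _] _]. Qed.

(** This makes the test functions of [wave_re] admissible in the complex weak equation. [wderiv] is
    a chosen representative, so it is known only almost everywhere. *)
Lemma H1_restr A B v vx : A <= B -> prim A B v vx -> sq A B vx -> v A = 0 -> v B = 0 ->
  let V := fun x => (restr A B v x)%:C in
  H1 setT V /\ {ae mu, forall x : R, wderiv setT V x = (restr A B vx x)%:C}.
Proof.
move=> AB pv svx vA vB V.
have wd1 := prim_weak (prim_restr AB pv vA vB).
have wd2 : is_weak_deriv setT (fun=> 0 : R) (fun=> 0).
  by apply: prim_weak => a b; exact: prim_cst.
have wd : is_cweak_deriv setT V (fun x => (restr A B vx x)%:C) by split.
have wV : weakly_derivable setT V by exists (fun x => (restr A B vx x)%:C).
have [w1 w2] := wderivP wV.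
have ae1 : {ae mu, forall x : R, wderiv setT V x = (restr A B vx x)%:C}.
  have h1 : {ae mu, forall x : R, re (wderiv setT V) x = restr A B vx x}.
    by apply: aeon_ae => a b; apply: (wd_unique (@subsetT _ _) w1 wd1); exact: aeonW.
  have h2 : {ae mu, forall x : R, im (wderiv setT V) x = 0}.
    by apply: aeon_ae => a b; apply: (wd_unique (@subsetT _ _) w2 wd2); exact: aeonW.
  apply: (ae_sub2 h1 h2) => x; rewrite /re /im; case: (wderiv setT V x) => p q /= -> ->.
  by [].
split=> //; split=> //.
- split; rewrite patch_setT; first exact: restr_Lfun (prim_sq pv).
  apply: Lfun2_intro; first exact: measurable_cst.
  have -> : (fun x => im V x ^+ 2) = cst 0 by apply: funext => x; rewrite /im /= expr0n.
  exact: integrable0.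
- have [mr _] := weak_meas w1; have [_ mr'] := weak_meas w1; have [_ mi'] := weak_meas w2.
  split; rewrite patch_setT; apply: Lfun2_intro => //.
    apply: integrable_ae_eq (Lfun2_integrable_sqr (restr_Lfun svx)) _.
      exact: measurable_funX.
    by apply: (ae_sub ae1) => x; rewrite /re /= => ->.
  have : mu.-integrable setT (EFin \o (fun _ : R => 0 : R)) by exact: integrable0.
  move=> h; apply: integrable_ae_eq h _; first exact: measurable_funX.
  by apply: (ae_sub ae1) => x; rewrite /im /= => -> /=; rewrite expr0n.
Qed.

End Extension.

(** * From the complex weak solution to its real components *)

Section WaveExtract.
Local Open Scope complex_scope.
Variable R : realType.
Local Notation mu := (@lebesgue_measure R).
Implicit Types (a b c A B X x : R) (f g h : R -> R[i]) (w u ut : R -> R -> R[i]).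

Lemma L2T_sq f a b : L2 setT f -> sq a b (re f) /\ sq a b (im f).
Proof. by move=> Lf; exact: L2_sq Lf (@subsetT _ _). Qed.

Lemma cweak_unique f g1 g2 : is_cweak_deriv setT f g1 -> is_cweak_deriv setT f g2 ->
  {ae mu, forall x : R, re g1 x = re g2 x /\ im g1 x = im g2 x}.
Proof.
move=> [h1 h2] [k1 k2].
have e1 : {ae mu, forall x : R, re g1 x = re g2 x}.
  by apply: aeon_ae => a b; apply: (wd_unique (@subsetT _ _) h1 k1); exact: aeonW.
have e2 : {ae mu, forall x : R, im g1 x = im g2 x}.
  by apply: aeon_ae => a b; apply: (wd_unique (@subsetT _ _) h2 k2); exact: aeonW.
exact: (ae_sub2 e1 e2).
Qed.

Lemma weak_rep f g : is_cweak_deriv setT f g -> exists f1 f2 : R -> R,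
  [/\ forall a b, prim a b f1 (re g), forall a b, prim a b f2 (im g) &
   {ae mu, forall x : R, re f x = f1 x /\ im f x = f2 x}].
Proof.
move=> [/weak_prim[f1 [p1 e1]] /weak_prim[f2 [p2 e2]]]; exists f1, f2; split => //.
exact: (ae_sub2 e1 e2).
Qed.

Lemma cweakB f1 f2 g1 g2 : is_cweak_deriv setT f1 g1 -> is_cweak_deriv setT f2 g2 ->
  is_cweak_deriv setT (f1 \- f2) (g1 \- g2).
Proof.
move=> H1 H2; have [p1 [q1 [pp1 pq1 e1]]] := weak_rep H1.
have [p2 [q2 [pp2 pq2 e2]]] := weak_rep H2.
have [[/weak_meas[m1 _] /weak_meas[n1 _]] [/weak_meas[m2 _] /weak_meas[n2 _]]] := (H1, H2).
have reE (k1 k2 : R -> R[i]) : re (k1 \- k2) = fun x => re k1 x - re k2 x.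
  by apply: funext => x; rewrite /re /= ReB.
have imE (k1 k2 : R -> R[i]) : im (k1 \- k2) = fun x => im k1 x - im k2 x.
  by apply: funext => x; rewrite /im /= ImB.
split; rewrite ?reE ?imE.
- apply: (@prim_weak_ae _ _ (fun x => p1 x - p2 x)).
  + by move=> a b; exact: prim_sub.
  + exact: measurable_funB.
  + by apply: (ae_sub2 e1 e2) => x [-> _] [-> _].
- apply: (@prim_weak_ae _ _ (fun x => q1 x - q2 x)).
  + by move=> a b; exact: prim_sub.
  + exact: measurable_funB.
  + by apply: (ae_sub2 e1 e2) => x [_ ->] [_ ->].
Qed.

Lemma continuous_L2_L2c w a b : continuous_L2 w ->
  L2c a b (fun t => re (w t)) /\ L2c a b (fun t => im (w t)).
Proof.
move=> [Lw cw]; have H t : 0 <= t -> forall e, 0 < e -> exists2 d, 0 < d &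
    forall s, 0 <= s -> `|s - t| < d ->
    nrm a b (fun x => re (w s) x - re (w t) x) <= e /\
    nrm a b (fun x => im (w s) x - im (w t) x) <= e.
  move=> t0 e e0.
  have [d d0 dP] := cvg0_eps t0 (fun s => L2norm_ge0 _ _) (cw t t0) e0.
  exists d => // s s0 sd; have := dP s s0 sd.
  have reE : re (w s \- w t) = fun x => re (w s) x - re (w t) x.
    by apply: funext => x; rewrite /re /= ReB.
  have imE : im (w s \- w t) = fun x => im (w s) x - im (w t) x.
    by apply: funext => x; rewrite /im /= ImB.
  have [s1 s2] := L2T_sq a b (Lw s s0); have [t1 t2] := L2T_sq a b (Lw t t0).
  have [ms1 ms2] := L2T_meas (Lw s s0); have [mt1 mt2] := L2T_meas (Lw t t0).
  have [] := @nrm_le_L2norm _ (w s \- w t) a b.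
  - by rewrite reE; exact: sqB.
  - by rewrite imE; exact: sqB.
  - by rewrite reE; exact: measurable_funB.
  - by rewrite imE; exact: measurable_funB.
  rewrite reE imE => n1 n2 Ln; split; rewrite -lee_fin; first exact: le_trans n1 Ln.
  exact: le_trans n2 Ln.
by split=> t t0 e e0; have [d d0 dP] := H t t0 e e0; exists d => // s s0 sd;
  have [] := dP s s0 sd.
Qed.

(** The weak derivative chosen for a difference agrees almost everywhere with the difference of the
    chosen ones, so its [L^2] norm is at most the [H^1] norm of the difference. *)
Lemma continuous_H1_wderiv u : continuous_H1 u -> continuous_L2 (fun t => wderiv setT (u t)).
Proof.
move=> [Hu cu]; split=> [t t0|t t0]; first by have [] := Hu t t0.
apply: (@squeeze_cvge _ _ _ _ (fun=> 0%E) _ (fun s => H1norm setT (u s \- u t))); last first.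
- exact: cu.
- exact: cvg_cst.
rewrite near_withinE; apply: nearW => s; rewrite /= in_itv/= andbT => s0.
rewrite L2norm_ge0 /=; have [_ ws _] := Hu s s0; have [_ wt _] := Hu t t0.
have D := cweakB (wderivP ws) (wderivP wt).
have wB : weakly_derivable setT (u s \- u t) by exists (wderiv setT (u s) \- wderiv setT (u t)).
apply: le_trans (L2norm_le_H1norm setT (u s \- u t)).2.
rewrite !L2normE le_eqVlt; apply/orP; left; apply/eqP; congr (_ `^ _)%E.
have [/weak_meas[_ m1] /weak_meas[_ m2]] := D.
have [/weak_meas[_ m1'] /weak_meas[_ m2']] := wderivP wB.
apply: ae_eq_integral => //.
- by apply/measurable_EFinP; apply: measurable_funD; exact: measurable_funX.
- by apply/measurable_EFinP; apply: measurable_funD; exact: measurable_funX.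
- by apply: (ae_sub (cweak_unique D (wderivP wB))) => x /= [-> ->] _.
Qed.

Lemma deriv_L2_L2d u ut a b : (forall t, 0 <= t -> L2 setT (u t)) ->
  (forall t, 0 <= t -> L2 setT (ut t)) -> deriv_L2 u ut ->
  L2d a b (fun t => re (u t)) (fun t => re (ut t)) /\
  L2d a b (fun t => im (u t)) (fun t => im (ut t)).
Proof.
move=> Lu Lut du; have H t : 0 <= t -> forall e, 0 < e -> exists2 d, 0 < d &
    forall s, 0 <= s -> `|s - t| < d ->
    nrm a b (fun x => re (u s) x - re (u t) x - (s - t) * re (ut t) x) <= e * `|s - t| /\
    nrm a b (fun x => im (u s) x - im (u t) x - (s - t) * im (ut t) x) <= e * `|s - t|.
  move=> t0 e e0.
  have [d d0 dP] := cvg0_eps' t0 (fun s => L2norm_ge0 _ _) (du t t0) e0.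
  (* The hypothesis is a limit along [s] different from [t]; at [s = t] both sides are zero. *)
  exists d => // s s0 sd; have [->|st] := eqVneq s t.
    have [r1 r2] := L2T_sq a b (Lut t t0); rewrite !subrr normr0 mulr0.
    split; [rewrite (@nrm_ext _ a b _ (fun x => 0 * re (ut t) x))|
            rewrite (@nrm_ext _ a b _ (fun x => 0 * im (ut t) x))];
      by [rewrite nrmZ// normr0 mul0r|move=> x _; rewrite subrr sub0r mul0r oppr0].
  have := dP s s0 st sd.
  set q := fun x => _ - _.
  have reE : re q = fun x => (s - t)^-1 * (re (u s) x - re (u t) x) - re (ut t) x.
    by apply: funext => x; rewrite /re /q ReB Re_rM ReB.
  have imE : im q = fun x => (s - t)^-1 * (im (u s) x - im (u t) x) - im (ut t) x.
    by apply: funext => x; rewrite /im /q ImB Im_rM ImB.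
  have [s1 s2] := L2T_sq a b (Lu s s0); have [t1 t2] := L2T_sq a b (Lu t t0).
  have [r1 r2] := L2T_sq a b (Lut t t0).
  have [ms1 ms2] := L2T_meas (Lu s s0); have [mt1 mt2] := L2T_meas (Lu t t0).
  have [mr1 mr2] := L2T_meas (Lut t t0).
  have st0 : s - t != 0 by rewrite subr_eq0.
  have sqr : sq a b (re q) by rewrite reE; apply: sqB => //; apply: sqZ; exact: sqB.
  have sqi : sq a b (im q) by rewrite imE; apply: sqB => //; apply: sqZ; exact: sqB.
  have [] := @nrm_le_L2norm _ q a b sqr sqi.
  - by rewrite reE; apply: measurable_funB => //; apply: measurable_funM => //; exact: measurable_funB.
  - by rewrite imE; apply: measurable_funB => //; apply: measurable_funM => //; exact: measurable_funB.
  move=> n1 n2 Ln; split.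
  - rewrite (@nrm_ext _ a b _ (fun x => (s - t) * re q x)); last first.
      by move=> x _; rewrite reE; field.
    rewrite nrmZ// mulrC ler_wpM2r// -lee_fin; exact: le_trans n1 Ln.
  - rewrite (@nrm_ext _ a b _ (fun x => (s - t) * im q x)); last first.
      by move=> x _; rewrite imE; field.
    rewrite nrmZ// mulrC ler_wpM2r// -lee_fin; exact: le_trans n2 Ln.
by split=> t t0 e e0; have [d d0 dP] := H t t0 e e0; exists d => // s s0 sd;
  have [] := dP s s0 sd.
Qed.

Lemma Rintegral_ae (f g : R -> R) : measurable_fun setT f -> measurable_fun setT g ->
  {ae mu, forall x : R, f x = g x} -> Rintegral mu setT f = Rintegral mu setT g.
Proof.
move=> mf mg fg; rewrite /Rintegral; congr fine; apply: ae_eq_integral => //.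
- exact/measurable_EFinP.
- exact/measurable_EFinP.
- by apply: (ae_sub fg) => x /= -> _.
Qed.

Lemma cintegral_restr (c : R -> R) (z : R -> R[i]) A B v :
  cintegral setT (fun x => (c x)%:C * z x * conjc (restr A B v x)%:C) =
  itg A B (fun x => c x * re z x * v x) +i* itg A B (fun x => c x * im z x * v x).
Proof.
rewrite /cintegral; congr (_ +i* _).
- rewrite (@Rintegral_supp _ setT _ A B)//.
    apply: itg_ext => x xi; rewrite /re /restr xi; case: (z x) => p q /=; ring.
  by move=> x /negP/negbTE xi; rewrite /re /restr xi; case: (z x) => p q /=; ring.
- rewrite (@Rintegral_supp _ setT _ A B)//.
    apply: itg_ext => x xi; rewrite /im /restr xi; case: (z x) => p q /=; ring.
  by move=> x /negP/negbTE xi; rewrite /im /restr xi; case: (z x) => p q /=; ring.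
Qed.

(** With a real test function the equation splits. Since the source factor is [cos - i sin], the
    data pair is [(Re F, Im F)] for the real part and [(Im F, - Re F)] for the imaginary part. *)
Lemma weak_form al be m M om F u ut A B v vx (t : R) :
  (forall X X', coefs X X' al be m M) -> (forall X X', sq X X' (re F) /\ sq X X' (im F)) ->
  wave_sol al be om F u ut -> prim A B v vx -> sq A B vx -> v A = 0 -> v B = 0 -> 0 < t ->
  is_derive t 1 (fun s => itg A B (fun x => be x * re (ut s) x * v x))
    (cos (om * t) * itg A B (fun x => be x * re F x * v x) +
     sin (om * t) * itg A B (fun x => be x * im F x * v x) -
     itg A B (fun x => al x * re (wderiv setT (u t)) x * vx x)) /\
  is_derive t 1 (fun s => itg A B (fun x => be x * im (ut s) x * v x))
    (cos (om * t) * itg A B (fun x => be x * im F x * v x) +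
     sin (om * t) * itg A B (fun x => be x * - re F x * v x) -
     itg A B (fun x => al x * im (wderiv setT (u t)) x * vx x)).
Proof.
move=> Hc sF [[Hu _] _ _ _ Hweak] pv svx vA vB t0.
(* For [B < A] all interval integrals are zero, and the claim concerns constant functions. *)
have [AB|BA] := leP A B; last first.
  have z (k : R -> R) : itg A B k = 0 by rewrite /itg set_itv_ge -?ltNge// Rintegral_set0.
  rewrite !z !mulr0 !addr0 subr0; split; under eq_fun do rewrite z; exact: is_derive_cst.
have [HV wV] := H1_restr AB pv svx vA vB.
have := Hweak _ HV t t0; set V := (fun x => (restr A B v x)%:C) in HV wV *.
have [_ wdV _] := HV; have [/weak_meas[_ mV1] /weak_meas[_ mV2]] := wderivP wdV.
have [_ wdu _] := Hu t (ltW t0); have [/weak_meas[_ mW1] /weak_meas[_ mW2]] := wderivP wdu.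
have mal : measurable_fun setT al by apply: measT => a b; have [] := Hc a b.
have -> : cintegral setT (fun x => (al x)%:C * wderiv setT (u t) x * conjc (wderiv setT V x)) =
    cintegral setT (fun x => (al x)%:C * wderiv setT (u t) x * conjc (restr A B vx x)%:C).
  have mr : measurable_fun setT (restr A B vx) by apply: restr_meas; exact: svx.1.
  rewrite /cintegral; congr (_ +i* _); apply: Rintegral_ae.
  - have -> : re (fun x => (al x)%:C * wderiv setT (u t) x * conjc (wderiv setT V x)) =
      fun x => al x * (re (wderiv setT (u t)) x * re (wderiv setT V) x +
                       im (wderiv setT (u t)) x * im (wderiv setT V) x).
      apply: funext => x; rewrite /re /im; case: (wderiv setT V x) => p q.
      by case: (wderiv setT (u t) x) => p' q' /=; ring.
    by apply: measurable_funM => //; apply: measurable_funD; exact: measurable_funM.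
  - have -> : re (fun x => (al x)%:C * wderiv setT (u t) x * conjc (restr A B vx x)%:C) =
      fun x => al x * re (wderiv setT (u t)) x * restr A B vx x.
      by apply: funext => x; rewrite /re; case: (wderiv setT (u t) x) => p' q' /=; ring.
    by apply: measurable_funM => //; exact: measurable_funM.
  - by apply: (ae_sub wV) => x; rewrite /re => ->.
  - have -> : im (fun x => (al x)%:C * wderiv setT (u t) x * conjc (wderiv setT V x)) =
      fun x => al x * (im (wderiv setT (u t)) x * re (wderiv setT V) x -
                       re (wderiv setT (u t)) x * im (wderiv setT V) x).
      apply: funext => x; rewrite /re /im; case: (wderiv setT V x) => p q.
      by case: (wderiv setT (u t) x) => p' q' /=; ring.
    by apply: measurable_funM => //; apply: measurable_funB; exact: measurable_funM.
  - have -> : im (fun x => (al x)%:C * wderiv setT (u t) x * conjc (restr A B vx x)%:C) =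
      fun x => al x * im (wderiv setT (u t)) x * restr A B vx x.
      by apply: funext => x; rewrite /im; case: (wderiv setT (u t) x) => p' q' /=; ring.
    by apply: measurable_funM => //; exact: measurable_funM.
  - by apply: (ae_sub wV) => x; rewrite /im => ->.
rewrite !cintegral_restr.
have -> : (fun s => cintegral setT (fun x => (be x)%:C * ut s x * conjc (V x))) =
  (fun s => itg A B (fun x => be x * re (ut s) x * v x) +i*
            itg A B (fun x => be x * im (ut s) x * v x)).
  by apply: funext => s; rewrite cintegral_restr.
move=> [d1 d2]; split.
- move: d1; congr is_derive; rewrite /expi /= cosN sinN.
  by move: (itg A B _) (itg A B _) (itg A B _) => ? ? ?; ring.
- move: d2; congr is_derive; rewrite /expi /= cosN sinN.
  have -> : itg A B (fun x => be x * - re F x * v x) = - itg A B (fun x => be x * re F x * v x).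
    have [_ mb _ _ _] := Hc A B; have [_ bM] := coefs_abs (Hc A B).
    have i := sqM (sq_bM mb bM (sF A B).1) (prim_sq pv).
    by rewrite -itgN//; apply: itg_ext => x _; ring.
  by move: (itg A B _) (itg A B _) (itg A B _) => ? ? ?; ring.
Qed.

Lemma wave_extract al be m M om F u ut : (forall X X', coefs X X' al be m M) ->
  (forall X X', sq X X' (re F) /\ sq X X' (im F)) -> wave_sol al be om F u ut -> exists u1 u2 : R -> R -> R,
  [/\ wave_re al be om (re F) (im F) u1 (fun t => re (wderiv setT (u t))) (fun t => re (ut t)),
     wave_re al be om (im F) (fun x => - re F x) u2
        (fun t => im (wderiv setT (u t))) (fun t => im (ut t)) &
     forall t, 0 <= t -> {ae mu, forall x : R, re (u t) x = u1 t x /\ im (u t) x = u2 t x}].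
Proof.
move=> Hc sF Hsol; have [cu cut du [u0 ut0] _] := Hsol; have [Hu _] := cu; have [Hut _] := cut.
have cW := continuous_H1_wderiv cu; have [HW _] := cW.
have Lu t : 0 <= t -> L2 setT (u t) by move=> /Hu[].
(* An absolutely continuous representative is picked at each time separately; the zero function
   fills in at negative times. *)
have /choice[p1 Hp1] (t : R) : exists f : R -> R, 0 <= t ->
    (forall a b, prim a b f (re (wderiv setT (u t)))) /\ {ae mu, forall x : R, re (u t) x = f x}.
  have [t0|t0] := leP 0 t; last by exists (fun=> 0).
  by have [_ /wderivP[/weak_prim[f fP] _] _] := Hu t t0; exists f.
have /choice[p2 Hp2] (t : R) : exists f : R -> R, 0 <= t ->
    (forall a b, prim a b f (im (wderiv setT (u t)))) /\ {ae mu, forall x : R, im (u t) x = f x}.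
  have [t0|t0] := leP 0 t; last by exists (fun=> 0).
  by have [_ /wderivP[_ /weak_prim[f fP]] _] := Hu t t0; exists f.
have z0 : (0 : R) <= 0 by [].
have init (f g : R -> R) : (forall a b, prim a b f g) -> {ae mu, forall x : R, f x = 0} ->
    forall x, f x = 0.
  move=> pf f0 x; apply: (prim_ae0 _ (pf (x - 1) (x + 1))); [lra| |lra].
  exact: ae_aeon.
have ut01 : {ae mu, forall x : R, re (ut 0) x = 0} by apply: (ae_sub ut0) => x; rewrite /re => ->.
have ut02 : {ae mu, forall x : R, im (ut 0) x = 0} by apply: (ae_sub ut0) => x; rewrite /im => ->.
exists p1, p2; split.
- split.
  + move=> t t0 a b; have [? ?] := Hp1 t t0; split => //; first by have [] := L2T_sq a b (HW t t0).
    by have [] := L2T_sq a b (Hut t t0).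
  + move=> a b; have [c1 _] := continuous_L2_L2c a b cW; have [c2 _] := continuous_L2_L2c a b cut.
    split => //; have [d1 _] := deriv_L2_L2d a b Lu Hut du.
    apply: L2d_ext d1; rewrite //=.
    * by move=> t t0; exact: ae_aeon (Hp1 t t0).2 a b.
    * by move=> t t0; exact: aeonW.
    * by move=> t t0; have [] := L2T_sq a b (Lu t t0).
    * by move=> t t0; have [] := L2T_sq a b (Hut t t0).
    * by move=> t t0; exact: prim_meas ((Hp1 t t0).1 a b).
    * by move=> t t0; have [[]] := L2T_sq a b (Hut t t0).
  + split; last by move=> a b; exact: ae_aeon.
    apply: init (Hp1 0 z0).1 _; apply: (ae_sub2 u0 (Hp1 0 z0).2) => x E <-.
    by rewrite /re E.
  + move=> A B v vx pv svx vA vB t t0.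
    by have [] := weak_form Hc sF Hsol pv svx vA vB t0.
- split.
  + move=> t t0 a b; have [? ?] := Hp2 t t0; split => //; first by have [] := L2T_sq a b (HW t t0).
    by have [] := L2T_sq a b (Hut t t0).
  + move=> a b; have [_ c1] := continuous_L2_L2c a b cW; have [_ c2] := continuous_L2_L2c a b cut.
    split => //; have [_ d1] := deriv_L2_L2d a b Lu Hut du.
    apply: L2d_ext d1; rewrite //=.
    * by move=> t t0; exact: ae_aeon (Hp2 t t0).2 a b.
    * by move=> t t0; exact: aeonW.
    * by move=> t t0; have [] := L2T_sq a b (Lu t t0).
    * by move=> t t0; have [] := L2T_sq a b (Hut t t0).
    * by move=> t t0; exact: prim_meas ((Hp2 t t0).1 a b).
    * by move=> t t0; have [_ []] := L2T_sq a b (Hut t t0).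
  + split; last by move=> a b; exact: ae_aeon.
    apply: init (Hp2 0 z0).1 _; apply: (ae_sub2 u0 (Hp2 0 z0).2) => x E <-.
    by rewrite /im E.
  + move=> A B v vx pv svx vA vB t t0.
    by have [] := weak_form Hc sF Hsol pv svx vA vB t0.
- move=> t t0; exact: (ae_sub2 (Hp1 t t0).2 (Hp2 t t0).2).
Qed.

End WaveExtract.

(** * Uniqueness and norms *)

Section Uniqueness.
Local Open Scope complex_scope.
Variable R : realType.
Local Notation mu := (@lebesgue_measure R).
Implicit Types (a b A B x t : R) (al be : R -> R).

Lemma expR_small (L N z : R) : 0 < L -> 0 <= N ->
  (forall T, 0 <= T -> z <= N * expR (- (L * T))) -> z <= 0.
Proof.
move=> L0 N0 H; rewrite leNgt; apply/negP => z0.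
(* At this time the hypothesis reads [z * expR (N / z) <= N], against [expR s >= 1 + s]. *)
have T0 : 0 <= N / z / L by rewrite divr_ge0 ?divr_ge0// ltW.
have := H _ T0; rewrite [L * _]mulrC divfK ?gt_eqF// leNgt => /negP; apply.
rewrite expRN ltr_pdivrMr ?expR_gt0//.
apply: (@lt_le_trans _ _ (z * (1 + N / z))); last by rewrite ler_pM2l// expR_ge1Dx.
by rewrite mulrDr mulr1 mulrCA divff ?gt_eqF// mulr1 ltrDr.
Qed.

Lemma nrm0_prim a b f f' : a < b -> prim a b f f' -> nrm a b f <= 0 ->
  forall x, a <= x <= b -> f x = 0.
Proof.
move=> ab pf n0; apply: (prim_ae0 ab pf).
have n00 : nrm a b f = 0 by apply/eqP; rewrite eq_le n0 nrm_ge0.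
have := nrm_sqr a b f; rewrite n00 expr0n/= => /esym i0.
have := itg_eq0 (prim_sq pf).2 (aeonW _) i0; move=> /(_ (fun x _ => sqr_ge0 (f x))).
by apply: aeon1 => x _ /eqP; rewrite sqrf_eq0 => /eqP.
Qed.

Definition tracks al (om c1 A B E t : R) (v vx vt U1 U2 J1 J2 : R -> R) : Prop :=
  [/\ nrm A B (fun x => v x - (cos (om * t) * U1 x + sin (om * t) * U2 x) - c1) <= E,
   nrm A B (fun x => vt x + om * (sin (om * t) * U1 x - cos (om * t) * U2 x)) <= E &
   nrm A B (fun x => al x * vx x - (sin (om * t) * J2 x + cos (om * t) * J1 x)) <= E].

(** Multiplication of [F], [U] and [J] by [- i], which carries the real component of the problem to
    the imaginary one. *)
Lemma helm_sym al be (om g a b : R) F1 F2 U1 U2 J1 J2 :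
  helm_re al be om g a b F1 F2 U1 U2 J1 J2 ->
  helm_re al be om g a b F2 (fun x => - F1 x) U2 (fun x => - U1 x) J2 (fun x => - J1 x).
Proof.
move=> [pU pJ ob oa]; split.
- move=> X X'; have [p1 p2] := pU X X'; split => //.
  by have := primN p1; congr prim; apply: funext => x; rewrite mulrN.
- move=> X X'; have [p1 p2] := pJ X X'; split => //.
  by have := primN p1; congr prim; apply: funext => x; ring.
- by move=> x /ob[-> ->]; split; ring.
- by move=> x /oa[-> ->]; split; ring.
Qed.

Lemma helmW al be (om g a b a' b' : R) F1 F2 U1 U2 J1 J2 : a' <= a -> b <= b' ->
  helm_re al be om g a b F1 F2 U1 U2 J1 J2 -> helm_re al be om g a' b' F1 F2 U1 U2 J1 J2.
Proof.
move=> aa bb [pU pJ ob oa]; split=> // x hx; first by apply: ob; exact: le_trans hx.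
by apply: oa; exact: le_trans aa.
Qed.

(* A wave solution converges to both time-harmonic waves, so these coincide on the window:
   this is why the constant does not depend on U. *)
Lemma tracks_unique al be (m M om c1 g a b A B C C' L : R) F1 F2 v vx vt
   U1 U2 J1 J2 U1' U2' J1' J2' :
  A < B -> 0 < om -> 0 < L -> 0 <= C -> 0 <= C' -> coefs A B al be m M ->
  (forall t, 0 <= t -> sq A B (v t) /\ sq A B (vt t)) ->
  helm_re al be om g a b F1 F2 U1 U2 J1 J2 -> helm_re al be om g a b F1 F2 U1' U2' J1' J2' ->
  (forall t, 0 <= t -> tracks al om c1 A B (C * expR (- (L * t))) t (v t) (vx t) (vt t) U1 U2 J1 J2) ->
  (forall t, 0 <= t -> tracks al om c1 A B (C' * expR (- (L * t))) t (v t) (vx t) (vt t) U1' U2' J1' J2') ->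
  forall x, A <= x <= B -> [/\ U1 x = U1' x, U2 x = U2' x, J1 x = J1' x & J2 x = J2' x].
Proof.
move=> AB om0 L0 C0 C'0 Hc sv [pU pJ _ _] [pU' pJ' _ _] H H'.
have [[pU1 pU2] [pJ1 pJ2]] := (pU A B, pJ A B).
have [[pU1' pU2'] [pJ1' pJ2']] := (pU' A B, pJ' A B).
have [_ _ m0 [alm _] _] := Hc.
have alN0 x : (al x)^-1 != 0 by rewrite invr_eq0 gt_eqF// (lt_le_trans m0).
have sub_eq (f f' X k k' : R -> R) : prim A B f f' -> prim A B X k' -> nrm A B (fun x => f x - X x) <= 0 ->
    forall x, A <= x <= B -> f x = X x.
  move=> p1 p2 n0 x xi; apply/eqP; rewrite -subr_eq0; apply/eqP.
  exact: (nrm0_prim AB (prim_sub p1 p2) n0).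
have [sU1 sU2] := (prim_sq pU1, prim_sq pU2); have [sU1' sU2'] := (prim_sq pU1', prim_sq pU2').
pose N := (1 + om^-1) * (C + C').
have N0 : 0 <= N by rewrite mulr_ge0 ?addr_ge0// invr_ge0 ltW.
(* At time [t] the position error and the velocity error divided by [om] form an orthogonal image of
   the pair [(U1 - U1', U2 - U2')]. Inverting it by [cos^2 + sin^2 = 1] bounds quantities
   independent of [t] by an exponentially small one. *)
have est t : 0 <= t -> nrm A B (fun x => U1 x - U1' x) <= N * expR (- (L * t)) /\
    nrm A B (fun x => U2 x - U2' x) <= N * expR (- (L * t)).
  move=> t0; have [h1 h2 _] := H t t0; have [h1' h2' _] := H' t t0.
  have [s1 s2] := sv t t0.
  move: h1 h2 h1' h2'; set co := cos (om * t); set si := sin (om * t).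
  have cs : co ^+ 2 + si ^+ 2 = 1 by rewrite cos2Dsin2.
  have [co1 si1] : `|co| <= 1 /\ `|si| <= 1 by rewrite ler_norml cos_geN1 cos_le1 ler_norml sin_geN1 sin_le1.
  set P := (fun x => v t x - _ - _); set Q := (fun x => vt t x + _) => h1 h2.
  set P' := (fun x => v t x - _ - _); set Q' := (fun x => vt t x + _) => h1' h2'.
  have sP : sq A B P by apply: sqB; [apply: sqB => //; apply: sqD; exact: sqZ|exact: sq_cst].
  have sP' : sq A B P' by apply: sqB; [apply: sqB => //; apply: sqD; exact: sqZ|exact: sq_cst].
  have sQ : sq A B Q by apply: sqD => //; apply: sqZ; apply: sqB; exact: sqZ.
  have sQ' : sq A B Q' by apply: sqD => //; apply: sqZ; apply: sqB; exact: sqZ.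
  have dP : nrm A B (fun x => P' x - P x) <= (C + C') * expR (- (L * t)).
    rewrite (@nrm_ext _ A B _ (fun x => P' x + (-1) * P x)); last by move=> x _; rewrite mulN1r.
    apply: le_trans (nrmD sP' (sqZ _ sP)) _.
    by rewrite nrmZ// normrN1 mul1r mulrDl addrC lerD.
  have dQ : nrm A B (fun x => Q x - Q' x) <= (C + C') * expR (- (L * t)).
    rewrite (@nrm_ext _ A B _ (fun x => Q x + (-1) * Q' x)); last by move=> x _; rewrite mulN1r.
    apply: le_trans (nrmD sQ (sqZ _ sQ')) _.
    by rewrite nrmZ// normrN1 mul1r mulrDl lerD.
  have sdP := sqB sP' sP; have sdQ := sqB sQ sQ'.
  have comb (k1 k2 : R) f : `|k1| <= 1 -> `|k2| <= 1 ->
     (forall x, f x = k1 * (P' x - P x) + k2 * om^-1 * (Q x - Q' x)) ->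
     nrm A B f <= N * expR (- (L * t)).
    move=> k11 k21 E; rewrite (@nrm_ext _ A B _ (fun x => k1 * (P' x - P x) + k2 * om^-1 * (Q x - Q' x)))//.
    apply: le_trans (nrmD (sqZ _ sdP) (sqZ _ sdQ)) _; rewrite !nrmZ// /N -mulrA mulrDl mul1r.
    apply: lerD.
      by rewrite -[leRHS]mul1r ler_pM// nrm_ge0.
    rewrite normrM [`|om^-1|]ger0_norm ?invr_ge0 ?(ltW om0)//.
    by rewrite ler_pM// ?nrm_ge0// ?mulr_ge0 ?invr_ge0 ?(ltW om0)// ler_piMl// invr_ge0 ltW.
  have omN : om != 0 by rewrite gt_eqF.
  split; [apply: (comb co si) => // x|apply: (comb si (- co)) => //; rewrite ?normrN// => x].
  - rewrite -[LHS]mul1r -cs /P /P' /Q /Q'.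
    by move: (v t x) (vt t x) (U1 x) (U1' x) (U2 x) (U2' x) => *; field.
  - rewrite -[LHS]mul1r -cs /P /P' /Q /Q'.
    by move: (v t x) (vt t x) (U1 x) (U1' x) (U2 x) (U2' x) => *; field.
have n1 := expR_small L0 N0 (fun t ht => (est t ht).1).
have n2 := expR_small L0 N0 (fun t ht => (est t ht).2).
have E1 := nrm0_prim AB (prim_sub pU1 pU1') n1; have E2 := nrm0_prim AB (prim_sub pU2 pU2') n2.
(* The fluxes follow from the equality of the solutions: [(al)^-1 * J] is determined almost
   everywhere as a density, and [J] is absolutely continuous. *)
have Jeq (X X' Y Y' k k' : R -> R) : prim A B X (fun x => (al x)^-1 * Y x) ->
    prim A B X' (fun x => (al x)^-1 * Y' x) -> prim A B Y k -> prim A B Y' k' ->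
    (forall x, A <= x <= B -> X x - X' x = 0) -> forall x, A <= x <= B -> Y x = Y' x.
  move=> p1 p2 p3 p4 X0 x xi; apply/eqP; rewrite -subr_eq0; apply/eqP.
  apply: (prim_ae0 AB (prim_sub p3 p4)) => //.
  have : aeon A B (fun x => (al x)^-1 * Y x - (al x)^-1 * Y' x = 0).
    apply: (prim_unique (prim_sub p1 p2)); apply: (@prim_ext _ A B (fun=> 0)); last exact: prim_cst.
    by move=> z zi; rewrite X0.
  apply: aeon1 => z _; rewrite -mulrBr => /eqP; rewrite mulf_eq0 (negbTE (alN0 z)) /=.
  by move=> /eqP.
move=> x xi; split.
- by apply/eqP; rewrite -subr_eq0 E1.
- by apply/eqP; rewrite -subr_eq0 E2.
- exact: Jeq pU1 pU1' pJ1 pJ1' E1 x xi.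
- exact: Jeq pU2 pU2' pJ2 pJ2' E2 x xi.
Qed.

End Uniqueness.

(** * From interval estimates to the norms on the bounded domain *)

Section Norms.
Local Open Scope complex_scope.
Variable R : realType.
Local Notation mu := (@lebesgue_measure R).
Implicit Types (a b A B x t : R) (Om : set R).

(** [Om] is covered by countably many compact intervals with rational ends, and [wd_unique] applies
    on each. *)
Lemma wd_open_unique Om (f g1 g2 : R -> R) : open Om -> is_weak_deriv Om f g1 ->
  is_weak_deriv Om f g2 -> {ae mu, forall x : R, Om x -> g1 x = g2 x}.
Proof.
move=> oO w1 w2.
pose P (n : nat) (x : R) := forall q : rat * rat, unpickle n = Some q ->
  `[ratr q.1, ratr q.2]%classic `<=` Om -> ratr q.1 <= x <= ratr q.2 -> g1 x = g2 x.
have HP n : {ae mu, forall x : R, P n x}.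
  case E : (unpickle n) => [q|]; last first.
    by apply: (ae_sub (aeonW (a := 0) (b := 0) (P := fun=> True) (fun _ _ => I))) => x _ q; rewrite E.
  have [H|nH] := pselect (`[ratr q.1, ratr q.2]%classic `<=` Om).
    have := wd_unique H w1 w2 (aeonW (fun _ _ => erefl)).
    by move=> h; apply: (ae_sub h) => x /= Hx q'; rewrite E => -[<-] _.
  by apply: (ae_sub (aeonW (a := 0) (b := 0) (P := fun=> True) (fun _ _ => I))) => x _ q'; rewrite E => -[<-].
have /ae_foralln H := HP; apply: (ae_sub H) => x Hx Ox.
have [d /= d0 dO] := open_nbhs_nbhs (conj oO Ox).
have [q1 q1P] := @rat_in_itvoo R (x - d) x (ltac:(by rewrite ltrBlDr ltrDl)).
have [q2 q2P] := @rat_in_itvoo R x (x + d) (ltac:(by rewrite ltrDl)).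
move: q1P q2P; rewrite !in_itv/= => /andP[l1 u1] /andP[l2 u2].
apply: (Hx (pickle (q1, q2)) (q1, q2)); first by rewrite pickleK.
- move=> y; rewrite /= in_itv/= => /andP[y1 y2]; apply: dO => /=.
  by rewrite ltr_norml; apply/andP; split; lra.
- by rewrite /= !ltW.
Qed.

Lemma L2norm_ae Om (f g : R -> R[i]) : measurable Om ->
  measurable_fun Om (re f) -> measurable_fun Om (im f) ->
  measurable_fun Om (re g) -> measurable_fun Om (im g) ->
  {ae mu, forall x : R, Om x -> re f x = re g x /\ im f x = im g x} -> L2norm Om f = L2norm Om g.
Proof.
move=> mO m1 m2 m3 m4 fg; rewrite !L2normE; congr (_ `^ _)%E; apply: ae_eq_integral => //.
- by apply/measurable_EFinP; apply: measurable_funD; exact: measurable_funX.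
- by apply/measurable_EFinP; apply: measurable_funD; exact: measurable_funX.
- by apply: (ae_sub fg) => x /= H Ox; have [-> ->] := H Ox.
Qed.

Lemma L2norm_sum_le Om (f : R -> R[i]) a b (e1 e2 : R) : measurable Om -> Om `<=` `[a, b]%classic ->
  sq a b (re f) -> sq a b (im f) -> nrm a b (re f) <= e1 -> nrm a b (im f) <= e2 ->
  (L2norm Om f <= (e1 + e2)%:E)%E.
Proof.
move=> mO sub s1 s2 h1 h2; have n1 := nrm_ge0 a b (re f); have n2 := nrm_ge0 a b (im f).
apply: (L2norm_le mO sub s1 s2); first exact: addr_ge0 (le_trans n1 h1) (le_trans n2 h2).
move: h1 h2 n1 n2; move: (nrm _ _ _) (nrm _ _ _) => x y *; nra.
Qed.

(** The norm uses the weak derivative chosen on [Om], whereas the estimates concern densities on the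
    line. A density on the line restricts to a weak derivative on [Om], and uniqueness there
    identifies the two. *)
Lemma H1norm_prim Om (f : R -> R[i]) A B (f1 f2 h1 h2 : R -> R) (e1 e2 e3 e4 : R) :
  open Om -> Om `<=` `[A, B]%classic ->
  measurable_fun setT (re f) -> measurable_fun setT (im f) ->
  {ae mu, forall x : R, re f x = f1 x /\ im f x = f2 x} ->
  (forall a b, prim a b f1 h1) -> (forall a b, prim a b f2 h2) ->
  sq A B h1 -> sq A B h2 ->
  nrm A B f1 <= e1 -> nrm A B f2 <= e2 -> nrm A B h1 <= e3 -> nrm A B h2 <= e4 ->
  (H1norm Om f <= (e1 + e2 + (e3 + e4))%:E)%E.
Proof.
move=> oO sub mf1 mf2 fE p1 p2 s1 s2 n1 n2 n3 n4.
have mO : measurable Om := open_measurable oO.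
have fE1 : {ae mu, forall x : R, re f x = f1 x} := ae_sub fE (fun x h => h.1).
have fE2 : {ae mu, forall x : R, im f x = f2 x} := ae_sub fE (fun x h => h.2).
have w1 := wd_restrict oO (prim_weak_ae p1 mf1 fE1).
have w2 := wd_restrict oO (prim_weak_ae p2 mf2 fE2).
pose h x := h1 x +i* h2 x.
have wh : is_cweak_deriv Om f h by split.
have [w1' w2'] := wderivP (ex_intro _ h wh : weakly_derivable Om f).
have sf1 := prim_sq (p1 A B); have sf2 := prim_sq (p2 A B).
have nn n e k : nrm A B k <= e -> n = nrm A B k -> n <= e by move=> ? ->.
have e0 k e : nrm A B k <= e -> 0 <= e by apply: le_trans; exact: nrm_ge0.
apply: H1norm_le; try by rewrite addr_ge0// (e0 _ _ n1, e0 _ _ n2, e0 _ _ n3, e0 _ _ n4).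
- have E1 : aeon A B (fun x => f1 x = re f x) by apply: ae_aeon; apply: (ae_sub fE1) => x ->.
  have E2 : aeon A B (fun x => f2 x = im f x) by apply: ae_aeon; apply: (ae_sub fE2) => x ->.
  apply: (L2norm_sum_le mO sub).
  + by apply: sq_ae sf1 E1; exact: meas_T.
  + by apply: sq_ae sf2 E2; exact: meas_T.
  + by apply: (nn _ _ _ n1); apply/esym/nrm_ae => //; [exact: sf1.1|exact: meas_T].
  + by apply: (nn _ _ _ n2); apply/esym/nrm_ae => //; [exact: sf2.1|exact: meas_T].
- have [_ m1] := weak_meas w1'; have [_ m2] := weak_meas w2'.
  have [_ m3] := weak_meas w1; have [_ m4] := weak_meas w2.
  rewrite (@L2norm_ae Om (wderiv Om f) h)//; first exact: (L2norm_sum_le mO sub).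
  exact: (ae_sub2 (wd_open_unique oO w1' w1) (wd_open_unique oO w2' w2)
    (fun x h h' Ox => conj (h Ox) (h' Ox))).
Qed.

End Norms.

(** * The decay estimate *)

Section Main.
Local Open Scope complex_scope.
Variable R : realType.
Local Notation mu := (@lebesgue_measure R).
Implicit Types (a b A B x t : R) (al be : R -> R) (Om : set R).

Lemma Rintegral_core a b A B (k : R -> R) : A <= a -> b <= B -> measurable_fun setT k ->
  {ae mu, forall x : R, x <= a \/ b <= x -> k x = 0} ->
  Rintegral mu `]a, b[ k = itg A B k.
Proof.
move=> Aa bB mk k0; rewrite itg_restrict Rintegral_mkcond; apply: Rintegral_ae.
- apply/(measurable_restrictT _ (measurable_itv _)); exact: (measurable_funS measurableT (@subsetT _ _) mk).
- apply/(measurable_restrictT _ (mitv A B)); exact: (measurable_funS measurableT (@subsetT _ _) mk).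
apply: (ae_sub k0) => x kx; rewrite !patchE.
have [xa|ax] := leP x a; last have [bx|xb] := leP b x.
- by rewrite kx ?if_same//; left.
- by rewrite kx ?if_same//; right.
- rewrite !mem_set//= in_itv/= ?ax//.
  by rewrite (le_trans Aa (ltW ax)) (le_trans (ltW xb) bB).
Qed.

(** Division by [i] sends a pair of real and imaginary parts to the imaginary part and minus the
    real part. These are the constants [c1] of [real_decay] for the two components. *)
Lemma U_inftyE a0 b0 be a b A B om (F : R -> R[i]) : A <= a -> b <= B ->
  0 < om * Num.sqrt (a0 * b0) -> measurable_fun setT be ->
  measurable_fun setT (re F) -> measurable_fun setT (im F) ->
  {ae mu, forall x : R, x <= a \/ b <= x -> F x = 0} ->
  intb A B (fun x => be x * re F x) ->
  U_infty a0 b0 be `]a, b[%classic om F =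
  (itg A B (fun x => be x * im F x) / (2 * om * Num.sqrt (a0 * b0))) +i*
  (itg A B (fun x => be x * - re F x) / (2 * om * Num.sqrt (a0 * b0))).
Proof.
move=> Aa bB g0 mbe m1 m2 F0 iF; rewrite /U_infty /cintegral.
have reE : re (fun x => F x * (be x)%:C) = fun x => be x * re F x.
  by apply: funext => x; rewrite /re; case: (F x) => p q /=; ring.
have imE : im (fun x => F x * (be x)%:C) = fun x => be x * im F x.
  by apply: funext => x; rewrite /im; case: (F x) => p q /=; ring.
rewrite reE imE !(@Rintegral_core a b A B)//.
- have -> : itg A B (fun x => be x * - re F x) = - itg A B (fun x => be x * re F x).
    by rewrite -itgN//; apply: itg_ext => x _; ring.
  rewrite -[2 * om * _]mulrA; move: (itg A B _) (itg A B _) g0 => I1 I2.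
  move: (om * _) => c c0.
  have E : (2 * 'i%C * c%:C) * (0 +i* (- (2 * c)^-1)) = 1 :> R[i].
    apply/eqP; rewrite eq_complex /=; apply/andP; split; apply/eqP; field; rewrite gt_eqF//.
  have X0 : (2 * 'i%C * c%:C : R[i]) != 0.
    by apply/eqP => X0; move: E; rewrite X0 mul0r => /esym/eqP; rewrite oner_eq0.
  have -> : (2 * 'i%C * c%:C : R[i])^-1 = 0 +i* (- (2 * c)^-1).
    by apply: (mulfI X0); rewrite divff// E.
  by apply/eqP; rewrite eq_complex /=; apply/andP; split; apply/eqP; field; rewrite gt_eqF.
- exact: measurable_funM.
- by apply: (ae_sub F0) => x H /H; rewrite /im => ->; rewrite mulr0.
- exact: measurable_funM.
- by apply: (ae_sub F0) => x H /H; rewrite /re => ->; rewrite mulr0.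
Qed.

Lemma bounded_itv Om A B : bounded_set Om ->
  exists A' B', [/\ A' < A, B < B' & Om `<=` `[A', B']%classic].
Proof.
move=> /pinfty_ex_gt0[N N0 HN].
exists (Num.min A (- N) - 1), (Num.max B N + 1); split.
- by rewrite ltrBlDr (le_lt_trans (_ : _ <= A)) ?ge_min ?lexx// ltrDl.
- by rewrite (le_lt_trans (_ : _ <= Num.max B N)) ?le_max ?lexx// ltrDl.
- move=> x /HN /=; rewrite in_itv/= ler_norml => /andP[h1 h2].
  rewrite lerBlDr (@le_trans _ _ (- N)) ?ge_min ?lexx ?orbT//; last by rewrite (le_trans h1)// lerDl.
  by rewrite (le_trans h2)// (@le_trans _ _ (Num.max B N)) ?le_max ?lexx ?orbT// lerDl.
Qed.

Lemma decay_core al be (m M K : R) (q q' : R -> R) (p r a0 b0 a b om : R) (F : R -> R[i]) Om :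
  0 < M -> 0 <= K -> (forall X X', coefs X X' al be m M) -> p <= r ->
  prim p r q q' -> aeon p r (fun x => q x = al x * be x) -> aeon p r (fun x => `|q' x| <= K) ->
  0 < a0 -> 0 < b0 -> q p = a0 * b0 -> q r = a0 * b0 -> Num.sqrt (a0 * b0) <= 1 + M ^+ 2 ->
  (forall x, x <= p \/ r <= x -> al x = a0 /\ be x = b0) ->
  (forall x, x <= a \/ b <= x -> al x = a0 /\ be x = b0) ->
  0 < om -> L2 setT F -> ess_support F `<=` `]a, b[%classic -> bounded_domain Om ->
  exists2 C, 0 < C & forall U u ut,
    helmholtz_sol al be a0 b0 `]a, b[%classic om F U -> wave_sol al be om F u ut ->
    forall t, 0 <= t ->
    let w := fun x => u t x - expi (- (om * t)) * U x - U_infty a0 b0 be `]a, b[%classic om F in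
    let wt := fun x => ut t x + 'i%C * om%:C * expi (- (om * t)) * U x in
    (H1norm Om w + L2norm Om wt <= (C * expR (- (rate K m M p r / 2 * t)))%:E)%E.
Proof.
move=> M0 K0 Hc pr pq qE q'K a00 b00 qp qr gM outp outa om0 LF supF [_ oO _ bO].
pose g := Num.sqrt (a0 * b0); pose L := rate K m M p r / 2.
have g0 : 0 < g by rewrite sqrtr_gt0 mulr_gt0.
have gE : g ^+ 2 = a0 * b0 by rewrite sqr_sqrtr// mulr_ge0// ltW.
have [_ _ m0 [alm _] _] := Hc 0 0.
have L0 : 0 < L by rewrite divr_gt0// rate_gt0.
have omN : om != 0 by rewrite gt_eqF.
(* The core [[p, r]], which fixes the rate, and the interval []a, b[] carrying the source are
   unrelated; [[A0, B0]] contains both. *)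
pose A0 := Num.min a p; pose B0 := Num.max b r.
have [A0a A0p] : A0 <= a /\ A0 <= p by rewrite !ge_min !lexx orbT.
have [bB0 rB0] : b <= B0 /\ r <= B0 by rewrite !le_max !lexx orbT.
have [A [B [AA0 B0B OAB]]] := bounded_itv A0 B0 bO.
have AB : A < B by apply: (lt_le_trans AA0); apply: (le_trans A0p); apply: (le_trans pr); apply: (le_trans rB0); exact: ltW.
have sF X X' := L2T_sq X X' LF.
have sF' X X' : sq X X' (im F) /\ sq X X' (fun x => - re F x).
  by have [? ?] := sF X X'; split => //; exact: sqN.
have F0 := ess_support_ae supF.
have Fz X X' : X' <= A0 \/ B0 <= X -> aeon X X' (fun x => F x = 0).
  move=> h; apply: aeon1 (ae_aeon F0 X X') => x /andP[Xx xX'] Fx; apply: Fx.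
  case: h => h; [left; exact: le_trans (le_trans xX' h) A0a|right; exact: le_trans bB0 (le_trans h Xx)].
have F0r X X' : X' <= A0 \/ B0 <= X -> aeon X X' (fun x => re F x = 0 /\ im F x = 0).
  by move=> /Fz; apply: aeon1 => x _; rewrite /re /im => ->.
have F0i X X' : X' <= A0 \/ B0 <= X -> aeon X X' (fun x => im F x = 0 /\ - re F x = 0).
  by move=> /Fz; apply: aeon1 => x _; rewrite /re /im => -> /=; rewrite oppr0.
have RD := real_decay M0 K0 Hc pr pq qE q'K a00 b00 g0 gE (etrans qp (esym gE))
  (etrans qr (esym gE)) gM AA0 A0p rB0 B0B outp omN.
have RDr := RD _ _ sF F0r; have RDi := RD _ _ sF' F0i => {RD}.
pose c1 := itg A0 B0 (fun x => be x * im F x) / (2 * om * g).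
pose c2 := itg A0 B0 (fun x => be x * - re F x) / (2 * om * g).
have mbe : measurable_fun setT be by apply: measT => X X'; have [] := Hc X X'.
have [mF1 mF2] := L2T_meas LF.
have UinfE : U_infty a0 b0 be `]a, b[%classic om F = c1 +i* c2.
  apply: U_inftyE => //; first exact: mulr_gt0.
  have [_ mb _ _ _] := Hc A0 B0; have [_ bM] := coefs_abs (Hc A0 B0).
  exact: sq_intb (sq_bM mb bM (sF A0 B0).1).
(* The constant must precede [U], so it is computed from one Helmholtz solution [U0]. If there is
   none the claim is vacuous and any positive constant serves. *)
have [[U0 hU0]|noU] := pselect (exists U, helmholtz_sol al be a0 b0 `]a, b[%classic om F U); last first.
  by exists 1 => // U u ut hU; case: noU; exists U.
have ext U (hU : helmholtz_sol al be a0 b0 `]a, b[%classic om F U) := helm_extract Hc a00 b00 g0 gE outa sF F0 hU.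
have [V1 [V2 [K1 [K2 [hV _]]]]] := ext U0 hU0.
have hV' := helmW A0a bB0 hV.
have [C1 C10 D1] := RDr _ _ _ _ c1 hV' erefl.
have [C2 C20 D2] := RDi _ _ _ _ c2 (helm_sym hV') erefl.
(* The contributions are one for the values, one for the velocity, and [m^-1] for the space
   derivative, which is recovered from the flux. *)
exists ((C1 + C2) * (2 + m^-1)).
  by rewrite mulr_gt0 ?addr_gt0// invr_gt0.
move=> U u ut hU hu t t0; cbv zeta; set w := (X in H1norm _ X); set wt := (X in L2norm _ X).
have [U1 [U2 [J1 [J2 [hr UE]]]]] := ext U hU.
have hr' := helmW A0a bB0 hr.
have [C1' C10' D1'] := RDr _ _ _ _ c1 hr' erefl.
have [u1 [u2 [wr wi uE]]] := wave_extract Hc sF hu.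
have [Hwr _ _ _] := wr; have [Hwi _ _ _] := wi.
have sv s : 0 <= s -> sq A B (u1 s) /\ sq A B (re (ut s)).
  by move=> s0; have [/prim_sq ? _ ?] := Hwr s s0 A B.
(* On the window [U] agrees with [U0]. The real component of the wave alone determines both parts of
   the Helmholtz solution, since its phase passes through all values. *)
have UV := tracks_unique AB om0 L0 (ltW C10) (ltW C10') (Hc A B) sv hV' hr'
  (fun s hs => D1 _ _ _ wr s hs) (fun s hs => D1' _ _ _ wr s hs).
have [d1 d2 d3] := D1 _ _ _ wr t t0; have [d4 d5 d6] := D2 _ _ _ wi t t0.
set e := expR _ in d1 d2 d3 d4 d5 d6 *.
set W := wderiv setT (u t) in d3 d6.
set co := cos (om * t) in d1 d2 d3 d4 d5 d6; set si := sin (om * t) in d1 d2 d3 d4 d5 d6.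
have mi : meas A B (fun x => (al x)^-1) by have [mal _ _ _ _] := Hc A B; exact: meas_inv m0 alm mal.
have miM : aeon A B (fun x => `|(al x)^-1| <= m^-1).
  apply: aeonW => x _; have ax := lt_le_trans m0 (alm x).
  by rewrite gtr0_norm ?invr_gt0// lef_pV2// posrE.
have alN x : al x != 0 by rewrite gt_eqF// (lt_le_trans m0).
have [pu1 pu2] : (forall X X', prim X X' (u1 t) (re W)) /\ (forall X X', prim X X' (u2 t) (im W)).
  by split=> X X'; [have [] := Hwr t t0 X X'|have [] := Hwi t t0 X X'].
have [sW1 sut1] : sq A B (re W) /\ sq A B (re (ut t)) by have [] := Hwr t t0 A B.
have [sW2 sut2] : sq A B (im W) /\ sq A B (im (ut t)) by have [] := Hwi t t0 A B.
have [pU pJ _ _] := hr.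
have [sJ1 sJ2] := (prim_sq (pJ A B).1, prim_sq (pJ A B).2).
have [sU1 sU2] := (prim_sq (pU A B).1, prim_sq (pU A B).2).
pose f1 x := u1 t x - (co * U1 x + si * U2 x) - c1.
pose f2 x := u2 t x - (co * U2 x + si * - U1 x) - c2.
pose h1 x := re W x - (co * ((al x)^-1 * J1 x) + si * ((al x)^-1 * J2 x)) - 0.
pose h2 x := im W x - (co * ((al x)^-1 * J2 x) + si * - ((al x)^-1 * J1 x)) - 0.
have pf1 X X' : prim X X' f1 h1.
  have [p1 p2] := pU X X'.
  exact: prim_sub (prim_sub (pu1 X X') (primD (primZ co p1) (primZ si p2))) (prim_cst X X' c1).
have pf2 X X' : prim X X' f2 h2.
  have [p1 p2] := pU X X'.
  exact: prim_sub (prim_sub (pu2 X X') (primD (primZ co p2) (primZ si (primN p1)))) (prim_cst X X' c2).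
have wE x : w x = (re (u t) x - (co * re U x + si * im U x) - c1) +i*
    (im (u t) x - (co * im U x + si * - re U x) - c2).
  rewrite /w UinfE /expi cosN sinN -/co -/si /re /im.
  by case: (u t x) (U x) => [x1 x2] [y1 y2]; apply/eqP; rewrite eq_complex /=;
    apply/andP; split; apply/eqP; ring.
have wtE x : wt x = (re (ut t) x + om * (si * re U x - co * im U x)) +i*
    (im (ut t) x + om * (si * im U x - co * - re U x)).
  rewrite /wt /expi cosN sinN -/co -/si /re /im.
  by case: (ut t x) (U x) => [x1 x2] [y1 y2]; apply/eqP; rewrite eq_complex /=;
    apply/andP; split; apply/eqP; ring.
have [[Hu1 _] [Hut _] _ _ _] := hu.
have [mu1 mu2] := L2T_meas (let: And3 h _ _ := Hu1 t t0 in h).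
have [mut1 mut2] := L2T_meas (Hut t t0).
have [[_ wU _ _ _] _ _ _] := hU.
have [/weak_meas[mU1 _] /weak_meas[mU2 _]] := wderivP wU.
have reE : re w = fun x => re (u t) x - (co * re U x + si * im U x) - c1.
  by apply: funext => x; rewrite /re wE.
have imE : im w = fun x => im (u t) x - (co * im U x + si * - re U x) - c2.
  by apply: funext => x; rewrite /im wE.
have retE : re wt = fun x => re (ut t) x + om * (si * re U x - co * im U x).
  by apply: funext => x; rewrite /re wtE.
have imtE : im wt = fun x => im (ut t) x + om * (si * im U x - co * - re U x).
  by apply: funext => x; rewrite /im wtE.
have mZ (k : R) (f : R -> R) : measurable_fun setT f -> measurable_fun setT (fun x => k * f x).
  by move=> mf; apply: measurable_funM.
have mN (f : R -> R) : measurable_fun setT f -> measurable_fun setT (fun x => - f x).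
  by move=> mf; apply: measurableT_comp.
have mw1 : measurable_fun setT (re w).
  by rewrite reE; apply: measurable_funB => //; apply: measurable_funB => //;
    apply: measurable_funD; exact: mZ.
have mw2 : measurable_fun setT (im w).
  by rewrite imE; apply: measurable_funB => //; apply: measurable_funB => //;
    apply: measurable_funD; apply: mZ => //; exact: mN.
have mwt1 : measurable_fun setT (re wt).
  by rewrite retE; apply: measurable_funD => //; apply: (mZ om); apply: measurable_funB; exact: mZ.
have mwt2 : measurable_fun setT (im wt).
  by rewrite imtE; apply: measurable_funD => //; apply: (mZ om); apply: measurable_funB;
    apply: mZ => //; exact: mN.
have wae : {ae mu, forall x : R, re w x = f1 x /\ im w x = f2 x}.
  by apply: (ae_sub2 UE (uE t t0)) => x [E1 E2] [E3 E4]; rewrite reE imE E1 E2 E3 E4.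
have sal (f : R -> R) : sq A B f -> sq A B (fun x => (al x)^-1 * f x) by move=> sf; exact: sq_bM mi miM sf.
have sh1 : sq A B h1.
  by apply: sqB (sq_cst _ _ _); apply: sqB => //; apply: sqD; apply: sqZ; exact: sal.
have sh2 : sq A B h2.
  by apply: sqB (sq_cst _ _ _); apply: sqB => //; apply: sqD; apply: sqZ; try exact: sqN (sal _ _); exact: sal.
have [mal _ _ _ _] := Hc A B; have [alM _] := coefs_abs (Hc A B).
have saW (f : R -> R) : sq A B f -> sq A B (fun x => al x * f x) by move=> sf; exact: sq_bM mal alM sf.
have n1 : nrm A B f1 <= C1 * e.
  by apply: le_trans d1; rewrite le_eqVlt; apply/orP; left; apply/eqP/nrm_ext => x /UV[E1 E2 _ _]; rewrite /f1 E1 E2.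
have n2 : nrm A B f2 <= C2 * e.
  by apply: le_trans d4; rewrite le_eqVlt; apply/orP; left; apply/eqP/nrm_ext => x /UV[E1 E2 _ _]; rewrite /f2 E1 E2.
have mi0 : 0 <= m^-1 by rewrite invr_ge0 ltW.
(* The decay estimate controls [al] times the derivative; the lower bound [m] on [al] gives the
   derivative itself. *)
have n3 : nrm A B h1 <= m^-1 * (C1 * e).
  rewrite (@nrm_ext _ A B _ (fun x => (al x)^-1 * (al x * re W x - (si * J2 x + co * J1 x)))); last first.
    by move=> x _; rewrite /h1; field; exact: alN.
  apply: le_trans (nrm_bM mi0 mi miM _) _.
    by apply: sqB; [exact: saW|apply: sqD; exact: sqZ].
  rewrite ler_wpM2l//; apply: le_trans d3; rewrite le_eqVlt; apply/orP; left.
  by apply/eqP/nrm_ext => x /UV[_ _ E1 E2]; rewrite E1 E2.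
have n4 : nrm A B h2 <= m^-1 * (C2 * e).
  rewrite (@nrm_ext _ A B _ (fun x => (al x)^-1 * (al x * im W x - (si * - J1 x + co * J2 x)))); last first.
    by move=> x _; rewrite /h2; field; exact: alN.
  apply: le_trans (nrm_bM mi0 mi miM _) _.
    by apply: sqB; [exact: saW|apply: sqD; apply: sqZ => //; exact: sqN].
  rewrite ler_wpM2l//; apply: le_trans d6; rewrite le_eqVlt; apply/orP; left.
  by apply/eqP/nrm_ext => x /UV[_ _ E1 E2]; rewrite E1 E2.
have mO : measurable Om := open_measurable oO.
have swt1 : sq A B (fun x => re (ut t) x + om * (si * U1 x - co * U2 x)).
  by apply: sqD => //; apply: sqZ; apply: sqB; exact: sqZ.
have swt2 : sq A B (fun x => im (ut t) x + om * (si * U2 x - co * - U1 x)).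
  by apply: sqD => //; apply: sqZ; apply: sqB; apply: sqZ => //; exact: sqN.
have e1 : aeon A B (fun x => re (ut t) x + om * (si * U1 x - co * U2 x) = re wt x).
  by apply: ae_aeon; apply: (ae_sub UE) => x [E1 E2]; rewrite retE E1 E2.
have e2 : aeon A B (fun x => im (ut t) x + om * (si * U2 x - co * - U1 x) = im wt x).
  by apply: ae_aeon; apply: (ae_sub UE) => x [E1 E2]; rewrite imtE E1 E2.
have n5 : nrm A B (re wt) <= C1 * e.
  rewrite -(nrm_ae swt1.1 (meas_T mwt1) e1); apply: le_trans d2; rewrite le_eqVlt; apply/orP; left.
  by apply/eqP/nrm_ext => x /UV[E1 E2 _ _]; rewrite E1 E2.
have n6 : nrm A B (im wt) <= C2 * e.
  rewrite -(nrm_ae swt2.1 (meas_T mwt2) e2); apply: le_trans d5; rewrite le_eqVlt; apply/orP; left.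
  by apply/eqP/nrm_ext => x /UV[E1 E2 _ _]; rewrite E1 E2.
have H1w := H1norm_prim oO OAB mw1 mw2 wae pf1 pf2 sh1 sh2 n1 n2 n3 n4.
have L2w := L2norm_sum_le mO OAB (sq_ae (meas_T mwt1) swt1 e1) (sq_ae (meas_T mwt2) swt2 e2) n5 n6.
apply: le_trans (leeD H1w L2w) _; rewrite -EFinD lee_fin le_eqVlt; apply/orP; left; apply/eqP.
ring.
Qed.

End Main.

Local Open Scope complex_scope.

Theorem theorem1p5 (R : realType) (alpha beta : R -> R)
    (Halpha : W1inf alpha) (Hbeta : W1inf beta) :
  exists2 Lambda : R, 0 < Lambda &
  forall (alpha_min beta_min alpha0 beta0 a b : R),
    0 < alpha_min -> 0 < beta_min -> 0 < alpha0 -> 0 < beta0 -> a < b ->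
    let Om_in : set R := `]a, b[%classic in
    (forall x, alpha_min <= alpha x) -> (forall x, beta_min <= beta x) ->
    (forall x, ~ Om_in x -> alpha x = alpha0 /\ beta x = beta0) ->
  forall (omega : R) (F : R -> R[i]),
    0 < omega -> L2 setT F -> ess_support F `<=` Om_in ->
  forall Om : set R, bounded_domain Om ->
  exists2 C : R, 0 < C &
  forall (U : R -> R[i]) (u ut : R -> R -> R[i]),
    helmholtz_sol alpha beta alpha0 beta0 Om_in omega F U ->
    wave_sol alpha beta omega F u ut ->
  forall t : R, 0 <= t ->
    let w := fun x => u t x - expi (- (omega * t)) * U x
                      - U_infty alpha0 beta0 beta Om_in omega F in
    let wt := fun x => ut t x + 'i%C * omega%:C * expi (- (omega * t)) * U x in
    (H1norm Om w + L2norm Om wt <= (C * expR (- (Lambda * t)))%:E)%E.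
Proof.
have adm am bm a0 b0 a b : 0 < am -> 0 < bm -> 0 < a0 -> 0 < b0 -> a < b ->
    (forall x, am <= alpha x) -> (forall x, bm <= beta x) ->
    (forall x, ~ `]a, b[%classic x -> alpha x = a0 /\ beta x = b0) ->
    admissible alpha beta am bm a0 b0 a b.
  move=> ? ? ? ? ab ? ? out; split=> // x xo; apply: out; rewrite /= in_itv/= => /andP[ax xb].
  by case: xo => h; [move: ax; rewrite ltNge h|move: xb; rewrite ltNge h].
(* The rate is quantified before the bounds, the limits and the interval, so one admissible tuple is
   fixed by a case distinction; without any such tuple the claim is vacuous. *)
have [[z Hz]|none] := pselect (exists z : (R * R) * (R * R) * (R * R),
    admissible alpha beta z.1.1.1 z.1.1.2 z.1.2.1 z.1.2.2 z.2.1 z.2.2); last first.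
  exists 1 => // am bm a0 b0 a b h1 h2 h3 h4 h5 Om_in h6 h7 h8; case: none.
  exists (((am, bm), (a0, b0)), (a, b)); exact: (@adm am bm a0 b0 a b h1 h2 h3 h4 h5 h6 h7 h8).
move: z Hz => [[[am bm] [a0 b0]] [p r]] /= Hz.
have [m [M [K [q [q' [[M0 K0] Hc [pq qE q'K] [qp qr] gM]]]]]] := coef_data Halpha Hbeta Hz.
have [_ [a00 b00] pr _ outp] := Hz.
have [_ _ m0 _ _] := Hc 0 0.
(* alpha0 and beta0 are the values of alpha and beta near infinity, so all admissible data
   share them, and the interval of one serves as core for all. *)
exists (rate K m M p r / 2); first by rewrite divr_gt0// rate_gt0.
move=> am' bm' a0' b0' a b h1 h2 h3 h4 ab h6 h7 h8 om F om0 LF supF Om bO.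
have Ha := @adm am' bm' a0' b0' a b h1 h2 h3 h4 ab h6 h7 h8; have [_ _ _ _ outa] := Ha.
(* A point to the right of both intervals, where the two descriptions of the coefficients can be
   compared. *)
have [bx rx] : b <= Num.max b r /\ r <= Num.max b r by rewrite !le_max !lexx orbT.
have [E1 E2] := outp _ (or_intror rx); have [E1' E2'] := outa _ (or_intror bx).
rewrite -E1' -E2' E1 E2 in outa *.
exact: decay_core M0 K0 Hc (ltW pr) pq qE q'K a00 b00 qp qr gM outp outa om0 LF supF bO.
Qed.
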